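(* Let $\Omega\subset B_{1/2}\subset\mathbb{R}^2$ be a domain. If a sequence $u_k\in H_0^1(\Omega)$ is $D$-weakly convergent to zero, then, for every $q\in(2,\infty]$, it converges to zero in the Lorentz–Zygmund space $L^{\infty,q;-1/q-1/2}$.
   Context: $B$ is the open unit disk in $\mathbb{R}^2$ centered at the origin, $B_{1/2}$ the open disk of radius $1/2$ centered at the origin. Points $z\in\mathbb{R}^2$ are identified with complex numbers, and $z^j$ ($j\in\mathbb{N}$) is the complex power. $H_0^1(B)$ and $H_0^1(\Omega)$ carry the norm $\|\nabla u\|_2$; functions in $H_0^1(\Omega)$ are extended by zero. The operator set is $$D=\{g_{j,\zeta}:\ (g_{j,\zeta}u)(z)=j^{-1/2}u(\zeta+z^j),\ z\in B,\ \zeta\in\bar\Omega,\ j\in\mathbb{N}\};$$ each $g_{j,\zeta}$ is a linear isometry from $H_0^1(\Omega)$ to $H_0^1(B)$. A sequence $u_k\in H_0^1(\Omega)$ is $D$-weakly convergent to zero if for every sequence $g_k\in D$ one has $g_ku_k\rightharpoonup0$ weakly in $H_0^1(B)$. For a measurable $u$ let $u^*(t)=\inf\{s>0:\ |\{|u|>s\}|\le t\}$ be its nonincreasing rearrangement. The Lorentz–Zygmund space $L^{\infty,q;\alpha}$ is given by the quasinorm $$\|u\|_{\infty,q;\alpha}=\left(\int_0^1\left[(\log\tfrac{e}{t})^{\alpha}u^*(t)\right]^q\frac{\mathrm{d}t}{t}\right)^{1/q}\ (q<\infty),\qquad \|u\|_{\infty,\infty;\alpha}=\sup_{t\in(0,1)}(\log\tfrac{e}{t})^{\alpha}u^*(t).$$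 For $q=\infty$, $1/q$ is read as $0$. *)

(* Defs.v *)
From HB Require Import structures.
From mathcomp Require Import all_boot all_order all_algebra.
From mathcomp Require Import complex.
From mathcomp Require Import all_classical all_reals all_analysis.

Set Implicit Arguments.
Unset Strict Implicit.
Unset Printing Implicit Defensive.

Import Order.TTheory GRing.Theory Num.Theory.
Import numFieldNormedType.Exports.

Local Open Scope classical_set_scope.
Local Open Scope ring_scope.

Section Plane.
Context {R : realType}.

Definition leb2 : {measure set (measurableTypeR R * measurableTypeR R)%type -> \bar R} :=
  (@lebesgue_measure R \x @lebesgue_measure R)%E.

Definition enorm (z : R * R) : R := Num.sqrt (z.1 ^+ 2 + z.2 ^+ 2).

Definition disk (r : R) : set (R * R) := [set z | enorm z < r].

Definition domain (Om : set (R * R)) : Prop :=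
  [/\ Om !=set0, open Om & connected Om].

(* Complex power, through the identification of R^2 with R[i]. *)
Definition cpow (z : R * R) (j : nat) : R * R :=
  let w := (Complex z.1 z.2 : R[i]) ^+ j in (complex.Re w, complex.Im w).

Definition L2norm (f : R * R -> R) : \bar R := Lnorm leb2 2%:E (EFin \o f).

Definition d1 (f : R * R -> R) : R * R -> R := fun z => 'D_((1, 0) : R * R) f z.
Definition d2 (f : R * R -> R) : R * R -> R := fun z => 'D_((0, 1) : R * R) f z.

(* Iterated partial derivative; [true] stands for d1 and [false] for d2. *)
Definition iter_partial (s : seq bool) (f : R * R -> R) : R * R -> R :=
  foldr (fun (b : bool) g => if b then d1 g else d2 g) f s.

Definition smooth (f : R * R -> R) : Prop :=
  forall s : seq bool, continuous (iter_partial s f) /\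
    forall z, derivable (iter_partial s f) z (1, 0) /\
              derivable (iter_partial s f) z (0, 1).

Definition test_fun (Om : set (R * R)) (phi : R * R -> R) : Prop :=
  let supp := closure [set z | phi z != 0] in
  [/\ smooth phi, compact supp & supp `<=` Om].

(* [v] is a square-integrable weak gradient of [u] on the whole plane. *)
Definition weak_gradient (u : R * R -> R) (v : R * R -> R * R) : Prop :=
  [/\ fst \o v \in Lfun leb2 2%:E, snd \o v \in Lfun leb2 2%:E &
      forall phi, test_fun setT phi ->
        (\int[leb2]_z (u z * d1 phi z) = - (\int[leb2]_z ((v z).1 * phi z)))%R /\
        (\int[leb2]_z (u z * d2 phi z) = - (\int[leb2]_z ((v z).2 * phi z)))%R].

Definition grad (u : R * R -> R) : R * R -> R * R :=
  xget (fun=> 0) [set v | weak_gradient u v].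

Definition grad_norm (u : R * R -> R) : R := fine (L2norm (enorm \o grad u)).

(* Closure of the test functions on [Om] in the H^1 norm.  Elements are Borel
   representatives, extended by zero outside [Om]. *)
Definition H01 (Om : set (R * R)) (u : R * R -> R) : Prop :=
  [/\ u \in Lfun leb2 2%:E,
      forall z, ~ Om z -> u z = 0 &
      exists v : R * R -> R * R, weak_gradient u v /\
        exists phi : nat -> R * R -> R,
          [/\ forall n, test_fun Om (phi n),
              L2norm (fun z => phi n z - u z) @[n --> \oo] --> 0%E &
              L2norm (fun z => enorm ((d1 (phi n) z, d2 (phi n) z) - v z))
                @[n --> \oo] --> 0%E]].

(* Elements of the dual space of H01 Om.  Boundedness makes such a functional
   independent of the choice of representatives. *)
Definition H01_dual (Om : set (R * R)) (l : (R * R -> R) -> R) : Prop :=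
  (forall (a : R) u v, H01 Om u -> H01 Om v ->
     l (fun z => a * u z + v z) = a * l u + l v) /\
  exists C : R, forall u, H01 Om u -> `|l u| <= C * grad_norm u.

Definition weakly_cvg0 (Om : set (R * R)) (w : nat -> R * R -> R) : Prop :=
  (forall k, H01 Om (w k)) /\
  forall l, H01_dual Om l -> l (w k) @[k --> \oo] --> (0 : R).

Definition gop (j : nat) (zeta : R * R) (u : R * R -> R) : R * R -> R :=
  fun z => if z \in disk 1 then j%:R `^ (- 2^-1) * u (zeta + cpow z j) else 0.

Definition gop_set (Om : set (R * R)) : set ((R * R -> R) -> (R * R -> R)) :=
  [set g | exists (j : nat) (zeta : R * R),
     [/\ (0 < j)%N, closure Om zeta & g = gop j zeta]].

Definition D_weakly_cvg0 (Om : set (R * R)) (u : nat -> R * R -> R) : Prop :=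
  forall g : nat -> (R * R -> R) -> (R * R -> R),
    (forall k, gop_set Om (g k)) -> weakly_cvg0 (disk 1) (fun k => g k (u k)).

Definition rearrangement (u : R * R -> R) (t : R) : \bar R :=
  ereal_inf [set s%:E | s in
    [set s : R | 0 < s /\ (leb2 [set z : R * R | (s < `|u z|)%R] <= t%:E)%E]].

(* The quasinorm of L^{oo,q;alpha}, meaningful for 0 < q <= +oo. *)
Definition LZnorm (q : \bar R) (alpha : R) (u : R * R -> R) : \bar R :=
  let f (t : R) := ((ln (expR 1 / t) `^ alpha)%R%:E * rearrangement u t)%E in
  if q is r%:E then
    poweR (\int[lebesgue_measure]_(t in `]0%R, 1%R[) (poweR (f t) r * (t^-1)%R%:E))%E
          r^-1
  else ereal_sup [set f t | t in `]0%R, 1%R[].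

Definition LZ_cvg0 (q : \bar R) (alpha : R) (u : nat -> R * R -> R) : Prop :=
  (forall k, (LZnorm q alpha (u k) < +oo)%E) /\
  LZnorm q alpha (u k) @[k --> \oo] --> 0%E.

End Plane.

(* Main.v *)
(** Write L(t) = ln(e/t) and r_k for the rearrangement of u_k.  D-weak convergence,
applied to the constant sequence j = 1, makes the translates of u_k converge weakly
to 0, so a gliding hump argument bounds their energies uniformly.

For q = oo, testing against the functional w |-> (integral of w over B_{1/2})
shows, uniformly in zeta and j, that the mean of z |-> u_k(zeta + z^j) over B_{1/2} is
o(sqrt j).  On the level set {|u_k| > s} with s = eps sqrt(L(t)) and
j = n floor(L(t)) for a fixed large n, the increments u_k(x + z^j) - u_k(x) are then
of size at least s/2 on average over z in B_{1/2}.  Since |z^j| <= 2^-j, their L^2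
norms are at most C 2^-j |grad u_k|, which forces the level set to have measure at
most t, i.e., r_k(t) <= eps sqrt(L(t)).

For q < oo, (L^(-1/q-1/2) r_k)^q <= eps^(q-2) L^-2 r_k^2, so it remains to bound the
integral of L^-2 r_k^2 dt/t (the Hansson / Brezis-Wainger inequality).  It is at
most 1 + 4 (sum of 4^i / L(|{|u_k| > 2^i}|) over i), and this sum is controlled by
the energy: a function that is at least 1/4 on a set of measure m has energy at least
c/L(m), and the energies of the smooth truncations of u_k at the levels 2^i add up.  *)

From HB Require Import structures.
Require Import Defs.
From mathcomp Require Import all_boot all_order all_algebra.
From mathcomp Require Import complex ring lra.
From mathcomp Require Import all_classical all_reals all_analysis.
From mathcomp Require Import measurable_realfun.

Set Implicit Arguments.
Unset Strict Implicit.
Unset Printing Implicit Defensive.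

Import Order.TTheory GRing.Theory Num.Theory.
Import numFieldNormedType.Exports.
Local Open Scope classical_set_scope.
Local Open Scope ring_scope.

(** The level-set decay and the capacity estimate share one mechanism, [spread]: if the increments
    [u(x + tau z) - u(x)] are small in L^2 for each [z], they cannot be large on average over [z] at
    every point [x] of a big set. The factor [j^(-1/2)] of the operators is what ties [j] to [L(t)]:
    a mean that is [o(1)] after normalisation is [o(sqrt j)] before it, and this matches a level
    [eps * sqrt(L(t))] when [j] is of order [L(t)]; the contraction coming from [|z| < 1/2] then
    beats every fixed factor once [n] is large. Since [j] grows as [t] tends to [0], the means must
    be small uniformly in [j] and [zeta]; this comes from the freedom to choose another operator for
    each [k]. [H01] is a predicate on functions and [grad] an arbitrary choice among weak gradients.
    Boundedness of the energies is therefore obtained from an explicit series of functionals written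
    through [w] alone, and estimates go through a weak gradient that is a limit of gradients of test
    functions. *)

Local Notation plane R := (measurableTypeR R * measurableTypeR R)%type.
Local Notation mu R := (@lebesgue_measure R).

(** * Measure and square-integrable functions on the plane *)

Section PlaneMeasure.
Context {R : realType}.

(** The sigma-algebra of the plane is the product one; an open set is a countable union of boxes
    with rational end points. *)
Lemma open_measurable_plane (A : set (R * R)) :
  open A -> measurable (A : set (plane R)).
Proof.
move=> oA.
pose I (q : rat * rat) : set R := [set` `]ratr q.1, ratr q.2[].
pose F (q : (rat * rat) * (rat * rat)) : set (plane R) :=
  if pselect (I q.1 `*` I q.2 `<=` A) then I q.1 `*` I q.2 else set0.
rewrite (_ : A = \bigcup_q F q); last first.
  apply/seteqP; split => [[x y] Axy|z [q _]]; last first.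
    by rewrite /F; case: pselect => // qA; exact: qA.
  have /nbhs_ballP[e /= e0 eA] : nbhs (x, y) A by exact: open_nbhs_nbhs.
  have box (t : R) : exists q : rat * rat, I q t /\ I q `<=` ball t e.
    have /rat_in_itvoo[a /itvP ha] : t - e < t by rewrite ltrBlDr ltrDl.
    have /rat_in_itvoo[b /itvP hb] : t < t + e by rewrite ltrDl.
    exists (a, b); split; first by rewrite /I /= in_itv /= ha hb.
    move=> s; rewrite /I /= in_itv /= => /andP[as_ sb].
    rewrite /ball /= distrC ltr_distl (lt_trans _ as_) ?ha//=.
    by rewrite (lt_trans sb)// hb.
  have [p [Ip pb]] := box x; have [q [Iq qb]] := box y.
  exists (p, q) => //; rewrite /F; case: pselect => // -[] [s t] [/= Is It].
  by apply: eA; split; [exact: pb|exact: qb].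
have cU : countable [set: (rat * rat) * (rat * rat)] by exact/countableP.
apply: (countable_bigcupT_measurable cU) => q; rewrite /F.
case: (pselect _) => ?; last exact: measurable0.
by apply: measurableX; exact: measurable_itv.
Qed.

Lemma continuous_measurable_plane (f : R * R -> R) :
  continuous f -> measurable_fun [set: plane R] (f : _ -> measurableTypeR R).
Proof.
move=> /continuousP cf; apply: (measurability _ (RGenOpens.measurableE R)).
move=> _ [_ [a [b ->] <-]]; rewrite setTI.
by apply: open_measurable_plane; exact/cf/interval_open.
Qed.

Definition translate (a : R) (x : measurableTypeR R) : measurableTypeR R :=
  x + a.

Lemma measurable_translate (a : R) :
  measurable_fun setT (translate a).
Proof. exact: measurable_funD. Qed.

Lemma lebesgue_measureD (a : R) (A : set R) : measurable A ->
  pushforward (mu R) (translate a) A = mu R A.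
Proof.
move=> mA; apply/esym/lebesgue_measure_unique => //=.
  exact: measurable_translate.
move=> ? _ [[x y]] _ <-.
rewrite /pushforward (_ : _ @^-1` _ = [set` `]x - a, y - a]]); last first.
  by apply/seteqP; split => z /=; rewrite !in_itv/= ltrBlDr lerBrDr.
by rewrite !lebesgue_measure_itv/= !lte_fin ltrD2r -!EFinB opprB addrA subrK.
Qed.

Definition shift_plane (a z : plane R) : plane R := (a.1 + z.1, a.2 + z.2).

Lemma measurable_shift_plane (a : plane R) :
  measurable_fun setT (shift_plane a).
Proof.
apply: measurable_fun_pair.
  by apply: measurable_funD => //; exact: measurable_fst.
by apply: measurable_funD => //; exact: measurable_snd.
Qed.

(** Uniqueness of the product measure: on rectangles the shifted measure factors into two translated
    Lebesgue measures. *)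
Lemma leb2_shift (a : plane R) (A : set (plane R)) : measurable A ->
  leb2 (shift_plane a @^-1` A) = leb2 A.
Proof.
move=> mA; apply/esym; pose m' : {measure set (plane R) -> \bar R} :=
  measure_function_pushforward__canonical__measure_function_Measure
    leb2 (measurable_shift_plane a).
apply: (product_measure_unique (m' := m')) => // B C mB mC.
transitivity (leb2 ((translate a.1 @^-1` B) `*` (translate a.2 @^-1` C))).
  congr (leb2 _); apply/seteqP; split => -[x y] /=;
  by rewrite /translate !(addrC _ a.1) !(addrC _ a.2).
have mD (b : R) (D : set R) : measurable D -> measurable (translate b @^-1` D).
  by move=> mD; rewrite -[X in measurable X]setTI; exact: measurable_translate.
transitivity (mu R (translate a.1 @^-1` B) * mu R (translate a.2 @^-1` C))%E.
  by apply: product_measure1E; exact: mD.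
by congr (_ * _)%E; exact: lebesgue_measureD.
Qed.

Lemma ge0_integral_shift (a : plane R) (f : plane R -> \bar R) :
  measurable_fun setT f -> (forall z, 0 <= f z)%E ->
  (\int[leb2]_z f (shift_plane a z) = \int[leb2]_z f z)%E.
Proof.
move=> mf f0.
have := @ge0_integral_pushforward _ _ _ _ _ _ (measurable_shift_plane a) leb2
  setT f measurableT mf (fun y _ => f0 y).
rewrite preimage_setT /= => <-.
apply: eq_measure_integral => [|? A mA _]; first exact: measurable_shift_plane.
exact: leb2_shift.
Qed.

End PlaneMeasure.

(** The integral of a nonnegative function is a supremum over the simple functions below it, so the
    comparison is an inclusion of sets. It is applied to integrands whose measurability is not at
    hand, such as those containing a rearrangement. *)
Lemma ge0_le_integral_nm d (T : measurableType d) (R : realType)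
    (m : {measure set T -> \bar R}) (D : set T) (f g : T -> \bar R) :
  (forall x, D x -> 0 <= f x)%E -> (forall x, D x -> f x <= g x)%E ->
  (\int[m]_(x in D) f x <= \int[m]_(x in D) g x)%E.
Proof.
move=> f0 fg; rewrite !ge0_integralE//; last first.
  by move=> x Dx; rewrite (le_trans (f0 _ Dx))// fg.
apply: ge_ereal_sup => _ [h hf <-]; apply: ereal_sup_ubound.
exists h => // x; apply: (le_trans (hf x)); rewrite !patchE.
by case: ifPn => // /[1!inE]; exact: fg.
Qed.

Section L2.
Context {R : realType}.
Implicit Types f g h : plane R -> R.

(** The squared L^2 norm as an extended real, so that comparison and Tonelli arguments run before
    finiteness is known; [n2] is its real value, used under [L2]. *)
Definition sqint f : \bar R := (\int[leb2]_z (f z ^+ 2)%:E)%E.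

Definition L2 f := measurable_fun setT f /\ (sqint f < +oo)%E.

Definition n2 f : R := fine (sqint f).

Definition ip f g : R := (\int[leb2]_z (f z * g z))%R.

Lemma sqint_ge0 f : (0 <= sqint f)%E.
Proof. by apply: integral_ge0 => z _; rewrite lee_fin sqr_ge0. Qed.

Lemma n2_ge0 f : 0 <= n2 f.
Proof. exact/fine_ge0/sqint_ge0. Qed.

Lemma measurable_sqr f : measurable_fun setT f ->
  measurable_fun setT (fun z => (f z ^+ 2)%:E).
Proof. by move=> mf; apply/measurable_EFinP; exact: measurable_funX. Qed.

Lemma sqintE f : sqint f = (L2norm f `^ 2%:R)%E.
Proof.
rewrite /L2norm poweR_Lnorm//; apply: eq_integral => z _ /=.
by rewrite powR_mulrn// -normrX ger0_norm// sqr_ge0.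
Qed.

Lemma L2norm_sqint f : L2norm f = (sqint f `^ 2^-1)%E.
Proof. by rewrite sqintE -poweRrM divff// poweRe1// Lnorm_ge0. Qed.

Lemma LfunP2 f : (f \in Lfun leb2 2%:E) <-> L2 f.
Proof.
split=> [|[mf ff]].
  rewrite inE => /andP[/[!inE]/= mf ff]; split => //.
  rewrite sqintE; exact: poweR_lty.
rewrite inE; apply/andP; split; rewrite inE//=.
rewrite /finite_norm.
have -> : Lnorm leb2 2%:E (EFin \o f) = L2norm f by [].
by rewrite L2norm_sqint poweR_lty.
Qed.

Lemma L2_fin f : L2 f -> sqint f = (n2 f)%:E.
Proof. by move=> [_ ff]; rewrite fineK// ge0_fin_numE// sqint_ge0. Qed.

Lemma sqint_le f g :
  (forall z, `|f z| <= `|g z|) -> (sqint f <= sqint g)%E.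
Proof.
move=> fg; apply: ge0_le_integral_nm => //.
  by move=> z _; rewrite lee_fin sqr_ge0.
move=> z _; rewrite lee_fin -real_normK ?num_real// -[leRHS]real_normK ?num_real//.
by rewrite lerXn2r ?nnegrE.
Qed.

Lemma sqintD f g : measurable_fun setT f -> measurable_fun setT g ->
  (sqint (fun z => f z + g z)%R <= 2%:E * sqint f + 2%:E * sqint g)%E.
Proof.
move=> mf mg; rewrite -!ge0_integralZl//; last 4 first.
- exact: measurable_sqr.
- by move=> z _; rewrite lee_fin sqr_ge0.
- exact: measurable_sqr.
- by move=> z _; rewrite lee_fin sqr_ge0.
rewrite -ge0_integralD//; last 4 first.
- by move=> z _; rewrite -EFinM lee_fin mulr_ge0// sqr_ge0.
- by apply: measurable_funeM; exact: measurable_sqr.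
- by move=> z _; rewrite -EFinM lee_fin mulr_ge0// sqr_ge0.
- by apply: measurable_funeM; exact: measurable_sqr.
apply: ge0_le_integral_nm => z _; first by rewrite lee_fin sqr_ge0.
rewrite -!EFinM -EFinD lee_fin.
have := sqr_ge0 (f z - g z)%R; nra.
Qed.

Lemma sqintN f : sqint (fun z => - f z)%R = sqint f.
Proof. by apply: eq_integral => z _; rewrite sqrrN. Qed.

Lemma sqintB f g : measurable_fun setT f -> measurable_fun setT g ->
  (sqint (fun z => f z - g z)%R <= 2%:E * sqint f + 2%:E * sqint g)%E.
Proof.
move=> mf mg; rewrite -(sqintN g); apply: sqintD => //.
exact: measurable_funN.
Qed.

Lemma sqintZ (a : R) f : measurable_fun setT f ->
  sqint (fun z => a * f z)%R = ((a ^+ 2)%:E * sqint f)%E.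
Proof.
move=> mf; rewrite -ge0_integralZl//; last 3 first.
- exact: measurable_sqr.
- by move=> z _; rewrite lee_fin sqr_ge0.
- by rewrite lee_fin sqr_ge0.
by apply: eq_integral => z _; rewrite exprMn EFinM.
Qed.

Lemma sqint_shift (a : plane R) f : measurable_fun setT f ->
  sqint (fun z => f (shift_plane a z))%R = sqint f.
Proof.
move=> mf; apply: (ge0_integral_shift a (f := fun z => (f z ^+ 2)%:E)).
  exact: measurable_sqr.
by move=> z; rewrite lee_fin sqr_ge0.
Qed.

Lemma L2D f g : L2 f -> L2 g -> L2 (fun z => f z + g z).
Proof.
move=> [mf ff] [mg fg]; split; first exact: measurable_funD.
apply: le_lt_trans (sqintD mf mg) _.
by rewrite lte_add_pinfty// lte_mul_pinfty// ge0_fin_numE// ?sqint_ge0.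
Qed.

Lemma L2Z (a : R) f : L2 f -> L2 (fun z => a * f z).
Proof.
move=> [mf ff]; split; first exact: measurable_funM.
by rewrite sqintZ// lte_mul_pinfty// ?lee_fin ?sqr_ge0.
Qed.

Lemma L2B f g : L2 f -> L2 g -> L2 (fun z => f z - g z).
Proof.
move=> Lf Lg; have := L2D Lf (L2Z (-1) Lg).
by congr L2; apply/funext => z; rewrite mulN1r.
Qed.

Lemma L2_integrable f g : L2 f -> L2 g ->
  leb2.-integrable setT (EFin \o (fun z => f z * g z)).
Proof.
by move=> /LfunP2 Lf /LfunP2 Lg; apply/Lfun1_integrable; exact: Lfun2_mul_Lfun1.
Qed.

Lemma ipC f g : ip f g = ip g f.
Proof. by apply: eq_Rintegral => z _; rewrite mulrC. Qed.

Lemma ipZl (a : R) f g : L2 f -> L2 g -> ip (fun z => a * f z) g = a * ip f g.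
Proof.
move=> Lf Lg; rewrite -RintegralZl//; last exact: L2_integrable.
by apply: eq_Rintegral => z _; rewrite mulrA.
Qed.

Lemma ipDl f g h : L2 f -> L2 g -> L2 h ->
  ip (fun z => f z + g z) h = ip f h + ip g h.
Proof.
move=> Lf Lg Lh; rewrite -RintegralD//; try exact: L2_integrable.
by apply: eq_Rintegral => z _; rewrite mulrDl.
Qed.

Lemma ipBl f g h : L2 f -> L2 g -> L2 h ->
  ip (fun z => f z - g z) h = ip f h - ip g h.
Proof.
move=> Lf Lg Lh; rewrite -[ip g h]mul1r -mulNr -ipZl// -ipDl//.
  by congr ip; apply/funext => z; rewrite mulN1r.
exact: L2Z.
Qed.

Lemma ipBr f g h : L2 f -> L2 g -> L2 h ->
  ip h (fun z => f z - g z) = ip h f - ip h g.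
Proof. by move=> *; rewrite ipC ipBl// !(ipC h). Qed.

Lemma ipff f : ip f f = n2 f.
Proof. by rewrite /ip /n2 /Rintegral; congr fine; apply: eq_integral. Qed.

Lemma ip_le_sqrt f g : L2 f -> L2 g ->
  `|ip f g| <= Num.sqrt (n2 f) * Num.sqrt (n2 g).
Proof.
move=> Lf Lg; have [mf _] := Lf; have [mg _] := Lg.
rewrite -lee_fin EFin_normr_Rintegral//; last exact: L2_integrable.
have /integrableP[mfg _] := L2_integrable Lf Lg.
apply: (le_trans (le_abse_integral _ _ mfg)) => //.
have := @hoelder _ _ _ leb2 f g 2 2 mf mg; rewrite Lnorm1 => H.
apply: le_trans (H _ _ _) _ => //; first lra.
rewrite -[Lnorm _ _ (_ \o f)]/(L2norm f) -[Lnorm _ _ (_ \o g)]/(L2norm g).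
by rewrite !L2norm_sqint !L2_fin// !poweR_EFin -EFinM lee_fin !powR12_sqrt ?n2_ge0.
Qed.

Lemma cvg_L2norm_sqint (f : nat -> plane R -> R) :
  L2norm (f n) @[n --> \oo] --> 0%E ->
  forall e : R, 0 < e -> \forall n \near \oo, (sqint (f n) < e%:E)%E.
Proof.
move=> f0 e e0.
have se0 : 0 < Num.sqrt e by rewrite sqrtr_gt0.
have : \forall n \near \oo, (L2norm (f n) < (Num.sqrt e)%:E)%E.
  by apply: (f0 [set x | x < _]%E); apply: lt_nbhsl; rewrite -lte_fin in se0.
apply: filterS => n; have := Lnorm_ge0 leb2 2%:E (EFin \o f n).
rewrite -/(L2norm (f n)) sqintE; case: (L2norm (f n)) => [x| |]//.
move=> x0 xe; rewrite lee_fin in x0; rewrite lte_fin in xe.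
rewrite poweR_EFin lte_fin powR_mulrn//.
by rewrite -[ltRHS]sqr_sqrtr ?(ltW e0)// ltrXn2r// nnegrE.
Qed.

End L2.

(** * Translation estimates for C^1 functions *)

Section DirectionalC1.
Context {R : realType}.
Implicit Types (w : R * R -> R) (e z : R * R).

(** The closed ball of the sup norm: a product of segments, with explicit measure, used as a
    container for supports. *)
Definition cbox (r : R) : set (R * R) := [set z | `|z.1| <= r /\ `|z.2| <= r].

Definition C1dir e w :=
  [/\ continuous w, continuous ('D_e w) & forall z, derivable w z e].

Definition vanish_off (A : set (R * R)) w := forall z, ~ A z -> w z = 0.

Lemma cboxE r : cbox r = [set` `[- r, r]] `*` [set` `[- r, r]].
Proof.
by apply/seteqP; split => -[x y]; rewrite /cbox /= !in_itv /= !ler_norml.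
Qed.

Lemma compact_cbox r : compact (cbox r).
Proof. by rewrite cboxE; apply: compact_setX; exact: segment_compact. Qed.

Lemma measurable_cbox r : measurable (cbox r : set (plane R)).
Proof. by rewrite cboxE; apply: measurableX; exact: measurable_itv. Qed.

Lemma closed_cbox r : closed (cbox r).
Proof. by apply: compact_closed; [exact: norm_hausdorff|exact: compact_cbox]. Qed.

Lemma leb2_cbox (r : R) : 0 <= r -> leb2 (cbox r : set (plane R)) = ((2 * r) ^+ 2)%:E.
Proof.
move=> r0; rewrite cboxE; set J := [set` `[- r, r]].
transitivity ((mu R) J * (mu R) J)%E.
  by apply: product_measure1E; exact: measurable_itv.
rewrite /J lebesgue_measure_itv /= lte_fin; case: ltP => [_|r0'].
  by rewrite -EFinD -EFinM; congr EFin; ring.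
have -> : r = 0 by lra.
by rewrite mulr0 expr0n mule0.
Qed.

Lemma bounded_on_cbox w r : continuous w ->
  exists M : R, 0 <= M /\ forall z, cbox r z -> `|w z| <= M.
Proof.
move=> cw; have : compact (w @` cbox r).
  apply: continuous_compact; last exact: compact_cbox.
  exact: continuous_subspaceT.
move=> /compact_bounded [M [_ HM]]; exists (`|M| + 1); split.
  by rewrite addr_ge0.
move=> z Bz; apply: (HM (`|M| + 1)); last by exists z.
by rewrite (le_lt_trans (ler_norm M))// ltrDl.
Qed.

Lemma bounded_vanish w r : continuous w -> vanish_off (cbox r) w ->
  exists M : R, 0 <= M /\ forall z, `|w z| <= M.
Proof.
move=> /(bounded_on_cbox r)[M [M0 HM]] w0; exists M; split=> // z.
by have [/HM//|/w0->] := pselect (cbox r z); rewrite normr0.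
Qed.

Lemma continuous_L2 w r : 0 <= r -> continuous w -> vanish_off (cbox r) w -> L2 w.
Proof.
move=> r0 cw w0; split; first exact: continuous_measurable_plane.
have [M [M0 HM]] := bounded_vanish cw w0.
apply: (@le_lt_trans _ _ (\int[leb2]_(z in (cbox r : set (plane R))) (M ^+ 2)%:E)%E).
  rewrite /sqint [leRHS]integral_mkcond; apply: ge0_le_integral_nm => z _.
    by rewrite lee_fin sqr_ge0.
  rewrite patchE; case: ifPn => [_|]; last by rewrite notin_setE => /w0 ->; rewrite expr0n.
  by rewrite lee_fin -real_normK ?num_real// lerXn2r ?nnegrE.
by rewrite integral_cst//=; [rewrite leb2_cbox// -EFinM ltry|exact: measurable_cbox].
Qed.

Lemma continuous_integrable w r : 0 <= r -> continuous w ->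
  vanish_off (cbox r) w -> leb2.-integrable [set: plane R] (EFin \o w).
Proof.
move=> r0 cw w0; apply/integrableP; split.
  by apply/measurable_EFinP; exact: continuous_measurable_plane.
have [M [M0 HM]] := bounded_vanish cw w0.
apply: (@le_lt_trans _ _ (\int[leb2]_(z in (cbox r : set (plane R))) M%:E)%E).
  rewrite [leRHS]integral_mkcond; apply: ge0_le_integral_nm => z _ //.
  rewrite patchE /=; case: ifPn => [_|]; last by rewrite notin_setE => /w0 ->; rewrite normr0.
  by rewrite lee_fin.
by rewrite integral_cst//=; [rewrite leb2_cbox// -EFinM ltry|exact: measurable_cbox].
Qed.

(** The complement of the closed box is open, so the difference quotients at its points vanish for
    small [h]. *)
Lemma vanish_derive e w r : vanish_off (cbox r) w -> vanish_off (cbox r) ('D_e w).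
Proof.
move=> w0 z nBz.
have : \forall h \near (0 : R)^', h^-1 *: ((w \o shift z) (h *: e) - w z) = 0.
  have nz : nbhs z (~` cbox r).
    by apply: open_nbhs_nbhs; split => //; exact/closed_openC/closed_cbox.
  have cz : (fun h : R => h *: e + z) @ (0 : R)^' --> (0 : R) *: e + z.
    apply: cvg_within_filter; apply: cvgD; last exact: cvg_cst.
    by apply: cvgZl; exact: cvg_id.
  rewrite scale0r add0r in cz.
  have {}cz : \forall h \near (0 : R)^', (~` cbox r) (h *: e + z) := cz _ nz.
  move: cz; apply: filterS => h /= /w0; rewrite /shift /= => ->.
  by rewrite (w0 _ nBz) subrr scaler0.
move=> H; rewrite /derive; apply/cvg_lim => //.
apply: (cvg_trans (near_eq_cvg _)); last exact: cvg_cst.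
by move: H; apply: filterS => h ->.
Qed.

Lemma is_derive_line e w z (t : R) : derivable w (t *: e + z) e ->
  is_derive t (1 : R) (fun s : R => w (s *: e + z)) ('D_e w (t *: e + z)).
Proof.
move=> dw.
have E : (fun h : R => h^-1 *: (((fun s : R => w (s *: e + z)) \o shift t) (h *: (1 : R)) -
    w (t *: e + z))) = (fun h => h^-1 *: ((w \o shift (t *: e + z)) (h *: e) - w (t *: e + z))).
  apply/funext => h /=; rewrite /shift /= scalerDl addrA.
  by rewrite [h *: 1]mulr1.
split; first by rewrite /derivable E.
by rewrite /derive E.
Qed.

Lemma continuous_line e w z : continuous w -> continuous (fun s : R => w (s *: e + z)).
Proof.
move=> cw s; apply: continuous_comp; last exact: cw.
have : (fun t : R => t *: e + z) @ s --> s *: e + z.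
  by apply: cvgD; [apply: cvgZl; exact: cvg_id|exact: cvg_cst].
exact.
Qed.

Lemma FTC_line e w z (h : R) : 0 < h -> C1dir e w ->
  (\int[mu R]_(s in `[0%R, h]) ('D_e w (s *: e + z))%:E
   = (w (h *: e + z) - w z)%:E)%E.
Proof.
move=> h0 [cw cdw dw].
have dl t := is_derive_line (dw (t *: e + z)).
have cl := continuous_line (e := e) (z := z) cw.
rewrite (@continuous_FTC2 _ _ (fun s : R => w (s *: e + z)))//.
- by rewrite scale0r add0r EFinB.
- by apply: continuous_subspaceT; apply: (continuous_line (w := 'D_e w)).
- split; first by move=> t _; case: (dl t).
  + by apply: cvg_at_right_filter; exact: cl.
  + by apply: cvg_at_left_filter; exact: cl.
- by move=> t _; rewrite derive1E; case: (dl t).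
Qed.

End DirectionalC1.

Section TranslationEstimate.
Context {R : realType}.
Implicit Types (w : R * R -> R) (e z : R * R).

(* [leb2] is typed as a plain measure; this copy carries the sigma-finite structure
   required by Tonelli's theorem. *)
Definition leb2_set_fun : set (plane R) -> \bar R := @leb2 R.

HB.instance Definition _ := Measure.copy leb2_set_fun (@leb2 R).

Lemma leb2_sigma_finite : sigma_finite setT leb2_set_fun.
Proof.
exists (fun n => cbox n%:R).
  apply/esym; rewrite -subTset => -[x y] _.
  exists (Num.trunc (`|x| + `|y|)).+1 => //=.
  have := truncnS_gt (`|x| + `|y|); set n := _%:R => xy.
  by split => /=; rewrite ltW// (le_lt_trans _ xy)// ?lerDl ?lerDr.
move=> n; split; first exact: measurable_cbox.
by rewrite [ltLHS](leb2_cbox (ler0n R n)) ltry.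
Qed.

HB.instance Definition _ := Measure_isSigmaFinite.Build _ _ _ leb2_set_fun
  leb2_sigma_finite.

Let leb2' : {sigma_finite_measure set (plane R) -> \bar R} := leb2_set_fun.

Lemma tonelli_leb2_mu (f : plane R * measurableTypeR R -> \bar R) :
  measurable_fun setT f -> (forall x, 0 <= f x)%E ->
  (\int[leb2]_z \int[mu R]_s f (z, s) = \int[mu R]_s \int[leb2]_z f (z, s))%E.
Proof. exact: (@fubini_tonelli _ _ _ _ _ leb2' (mu R) f). Qed.

Lemma tonelli_leb2_leb2 (f : plane R * plane R -> \bar R) :
  measurable_fun setT f -> (forall x, 0 <= f x)%E ->
  (\int[leb2]_z \int[leb2]_s f (z, s) = \int[leb2]_s \int[leb2]_z f (z, s))%E.
Proof. exact: (@fubini_tonelli _ _ _ _ _ leb2' leb2' f). Qed.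

Lemma fubini_leb2_mu (f : plane R * measurableTypeR R -> \bar R) :
  measurable_fun setT f -> (\int[mu R]_s \int[leb2]_z `|f (z, s)| < +oo)%E ->
  (\int[leb2]_z \int[mu R]_s f (z, s) = \int[mu R]_s \int[leb2]_z f (z, s))%E.
Proof.
move=> mf ff; apply: (@Fubini _ _ _ _ _ leb2' (mu R) f).
exact/(@integrable21ltyP _ _ _ _ _ leb2' (mu R) f).
Qed.

Lemma measurable_line w e : measurable_fun setT (w : plane R -> R) ->
  measurable_fun [set: plane R * measurableTypeR R] (fun x => w (x.2 *: e + x.1)).
Proof.
move=> mw; apply: (measurableT_comp mw).
apply: measurable_fun_pair => /=.
  apply: measurable_funD; first exact: measurable_funM.
  by apply: measurableT_comp; [exact: measurable_fst|exact: measurable_fst].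
apply: measurable_funD; first exact: measurable_funM.
by apply: measurableT_comp; [exact: measurable_snd|exact: measurable_fst].
Qed.

Lemma integral_shift (a : plane R) (f : plane R -> \bar R) : measurable_fun setT f ->
  (\int[leb2]_z f (shift_plane a z) = \int[leb2]_z f z)%E.
Proof.
move=> mf; rewrite integralE [RHS]integralE; congr (_ - _)%E.
  rewrite -[RHS](ge0_integral_shift a); first by apply: eq_integral => z _; rewrite (funepos_comp f).
    exact: measurable_funepos.
  by move=> z; exact: funepos_ge0.
rewrite -[RHS](ge0_integral_shift a); first by apply: eq_integral => z _; rewrite (funeneg_comp f).
  exact: measurable_funeneg.
by move=> z; exact: funeneg_ge0.
Qed.

Lemma scale_shift (s : R) e z : s *: e + z = shift_plane (s *: e) z.
Proof. by []. Qed.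

Lemma lebesgue_measure_0c (h : R) : 0 < h -> mu R [set` `[0, h]] = h%:E.
Proof. by move=> h0; rewrite lebesgue_measure_itv /= lte_fin h0 -EFinB subr0. Qed.

(** Cauchy-Schwarz on the segment, applied to the fundamental theorem of calculus along the line. *)
Lemma sqr_increment_line e w z (h : R) : 0 < h -> C1dir e w ->
  (((w (h *: e + z) - w z) ^+ 2)%:E <=
   h%:E * \int[mu R]_(s in `[0%R, h]) (('D_e w (s *: e + z)) ^+ 2)%:E)%E.
Proof.
move=> h0 Cw; have [cw cdw dw] := Cw; have F := FTC_line z h0 Cw.
pose g s := 'D_e w (s *: e + z).
have cg : continuous g by exact: (continuous_line (w := 'D_e w)).
have ci (f : R -> R) : continuous f -> (mu R).-integrable [set` `[0, h]] (EFin \o f).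
  move=> cf; apply: continuous_compact_integrable; first exact: segment_compact.
  exact: continuous_subspaceT.
have cg2 : continuous (fun s => g s ^+ 2).
  by move=> s; exact: (continuousM (cg s) (cg s)).
set D := w _ - w z in F *.
have mI : measurable ([set` `[0, h]] : set (measurableTypeR R)) by exact: measurable_itv.
have F' : (\int[mu R]_(s in `[0, h]) g s)%R = D by rewrite /Rintegral F.
rewrite -[X in (h%:E * X)%E]fineK; last by exact: integrable_fin_num (ci _ cg2).
rewrite -[fine _]/(\int[mu R]_(s in `[0, h]) (g s ^+ 2))%R -EFinM lee_fin.
set I2 := (X in h * X).
(* Cauchy-Schwarz in the form [2 c g <= g^2 + c^2], with [c = D / h] the mean of [g] over the
   segment. *)
have : (\int[mu R]_(s in `[0, h]) ((2 * (D / h)) * g s) <=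
  \int[mu R]_(s in `[0, h]) (g s ^+ 2 + (D / h) ^+ 2))%R.
  apply: le_Rintegral => //.
  - apply: (ci (fun s => _ * g s)) => s.
    by apply: cvgM; [exact: cvg_cst|exact: cg].
  - apply: (ci (fun s => g s ^+ 2 + _)) => s.
    by apply: cvgD; [exact: cg2|exact: cvg_cst].
  - by move=> s _; have := sqr_ge0 (g s - D / h); nra.
rewrite RintegralZl//; last exact: ci.
rewrite RintegralD//; [|exact: ci|by apply: (ci (fun=> _)); exact: cst_continuous].
rewrite F' Rintegral_cst// [X in fine X](lebesgue_measure_0c h0) /= -/I2.
have E : D = (D / h) * h by rewrite divfK// gt_eqF.
move: (D / h) E => c ->; nra.
Qed.

(** The line estimate is integrated over the starting point; after Tonelli every [s] contributes the
    same [sqint] by translation invariance, and the length of the segment supplies the second factor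
    [h]. *)
Lemma sqint_increment e w (h : R) : 0 < h -> C1dir e w ->
  (sqint (fun z => w (h *: e + z) - w z)%R <= (h ^+ 2)%:E * sqint ('D_e w))%E.
Proof.
move=> h0 Cw; have [cw cdw dw] := Cw.
have mD := continuous_measurable_plane cdw.
pose I : set (measurableTypeR R) := [set` `[0, h]].
have mI : measurable I by exact: measurable_itv.
pose G (x : plane R * measurableTypeR R) : \bar R :=
  (('D_e w (x.2 *: e + x.1)) ^+ 2 * \1_I x.2)%:E.
have mG : measurable_fun setT G.
  apply/measurable_EFinP; apply: measurable_funM.
    by apply: measurable_funX; exact: (measurable_line (w := 'D_e w)).
  have mchi : measurable_fun setT (\1_I : measurableTypeR R -> R) by exact: measurable_indic.
  exact: (measurableT_comp mchi measurable_snd).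
have G0 x : (0 <= G x)%E.
  by rewrite lee_fin mulr_ge0// sqr_ge0.
have hG z : (\int[mu R]_(s in `[0%R, h]) (('D_e w (s *: e + z)) ^+ 2)%:E =
    \int[mu R]_s G (z, s))%E.
  rewrite integral_mkcond; apply: eq_integral => s _.
  rewrite patchE /G indicE /=; case: ifPn => _ /=; first by rewrite mulr1.
  by rewrite mulr0.
apply: (@le_trans _ _ (\int[leb2]_z (h%:E * \int[mu R]_s G (z, s)))%E).
  apply: ge0_le_integral_nm => z _; first by rewrite lee_fin sqr_ge0.
  by rewrite -hG; exact: sqr_increment_line.
have mGF : measurable_fun setT (fun z => \int[mu R]_s G (z, s))%E.
  exact: (measurable_fun_fubini_tonelli_F (m2 := mu R) G).
rewrite ge0_integralZl//; last 2 first.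
- by move=> z _; exact: integral_ge0.
- by rewrite lee_fin ltW.
rewrite tonelli_leb2_mu// expr2 EFinM -muleA.
apply: lee_wpmul2l; first by rewrite lee_fin ltW.
have -> : (\int[mu R]_s \int[leb2]_z G (z, s) =
    \int[mu R]_(s in `[0%R, h]) sqint ('D_e w))%E.
  rewrite [RHS]integral_mkcond; apply: eq_integral => s _.
  rewrite patchE /G /=; case: ifPn => hs; last first.
    by rewrite integral0_eq// => z _; rewrite indicE (negbTE hs) mulr0.
  rewrite -(sqint_shift (s *: e) mD); apply: eq_integral => z _.
  by rewrite indicE hs mulr1.
rewrite integral_cst//.
by rewrite [X in (_ * X)%E](lebesgue_measure_0c h0) muleC.
Qed.

Lemma sqint_increment_norm e w (h : R) : C1dir e w ->
  (sqint (fun z => w (h *: e + z) - w z)%R <= (h ^+ 2)%:E * sqint ('D_e w))%E.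
Proof.
move=> Cw; have [cw _ _] := Cw; have mw := continuous_measurable_plane cw.
have [h0|h0|->] := ltgtP h 0; last 2 first.
- exact: sqint_increment.
- rewrite expr0n /= mul0e /sqint integral0_eq// => z _.
  by rewrite scale0r add0r subrr expr0n.
(* For [h < 0], translating by [- h e] turns the backward increment into a forward one, up to
   sign. *)
rewrite -sqrrN -(sqint_shift ((- h) *: e)); last first.
  apply: measurable_funB => //.
  exact: (measurableT_comp mw (measurable_shift_plane (h *: e))).
rewrite -sqintN; apply: le_trans (sqint_increment (h := - h) _ Cw); last by rewrite oppr_gt0.
apply: sqint_le => z; rewrite -!scale_shift addrA -scalerDl subrr scale0r add0r.
by rewrite opprB.
Qed.

(** The increments [w(e + z) - w(z)] integrate to [0] by translation invariance. They are also the
    integrals of ['D_e w] over unit segments, and Fubini turns these into the integral of ['D_e w]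
    over the plane. *)
Lemma integral_derive0 e w r : 0 <= r -> C1dir e w -> vanish_off (cbox r) w ->
  (\int[leb2]_z ('D_e w z)%:E = 0)%E.
Proof.
move=> r0 Cw w0; have [cw cdw dw] := Cw.
have iw := continuous_integrable r0 cw w0.
have idw := continuous_integrable r0 cdw (vanish_derive e w0).
have mw := continuous_measurable_plane cw.
have mD := continuous_measurable_plane cdw.
have mDE : measurable_fun setT (EFin \o 'D_e w : plane R -> _) by exact/measurable_EFinP.
pose I : set (measurableTypeR R) := [set` `[0, 1]].
have mI : measurable I by exact: measurable_itv.
pose G (x : plane R * measurableTypeR R) : \bar R :=
  ('D_e w (x.2 *: e + x.1) * \1_I x.2)%:E.
have mG : measurable_fun setT G.
  apply/measurable_EFinP; apply: measurable_funM.
    exact: (measurable_line (w := 'D_e w)).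
  have mchi : measurable_fun setT (\1_I : measurableTypeR R -> R) by exact: measurable_indic.
  exact: (measurableT_comp mchi measurable_snd).
have swap : (\int[leb2]_z \int[mu R]_s G (z, s) = \int[mu R]_s \int[leb2]_z G (z, s))%E.
  apply: fubini_leb2_mu => //.
  have -> : (\int[mu R]_s \int[leb2]_z `|G (z, s)| =
      \int[mu R]_(s in I) (\int[leb2]_z `|('D_e w z)%:E|))%E.
    rewrite [RHS]integral_mkcond; apply: eq_integral => s _.
    rewrite patchE /G /=; case: ifPn => hs; last first.
      by rewrite integral0_eq// => z _; rewrite indicE (negbTE hs) mulr0 normr0.
    rewrite -(integral_shift (s *: e) (f := fun z => `|('D_e w z)%:E|%E)).
      by apply: eq_integral => z _; rewrite indicE hs mulr1.
    exact: measurableT_comp.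
  have /integrableP[_ fdw] := idw.
  rewrite integral_cst// [X in (_ * X)%E](lebesgue_measure_0c ltr01).
  by rewrite mule1.
have L : (\int[leb2]_z \int[mu R]_s G (z, s) = 0)%E.
  transitivity (\int[leb2]_z ((w (1 *: e + z))%:E - (w z)%:E))%E.
    apply: eq_integral => z _; rewrite -EFinB -FTC_line//.
    rewrite [RHS]integral_mkcond; apply: eq_integral => s _.
    rewrite patchE /G indicE /=; case: ifPn => _ /=; first by rewrite mulr1.
    by rewrite mulr0.
  have shw := integral_shift (1 *: e) (f := EFin \o w : plane R -> _).
  rewrite integralB//.
  - rewrite [X in (X - _)%E]shw; last exact/measurable_EFinP.
    by rewrite subee//; exact: integrable_fin_num.
  - apply/integrableP; split.
      apply/measurable_EFinP.
      exact: (measurableT_comp mw (measurable_shift_plane (1 *: e))).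
    have /integrableP[_] := iw.
    rewrite -(integral_shift (1 *: e) (f := fun z => `|(w z)%:E|%E))//.
    by apply: measurableT_comp => //; exact/measurable_EFinP.
rewrite L in swap.
have : (\int[mu R]_s \int[leb2]_z G (z, s) = \int[mu R]_(s in I) (\int[leb2]_z ('D_e w z)%:E))%E.
  rewrite [RHS]integral_mkcond; apply: eq_integral => s _.
  rewrite patchE /G /=; case: ifPn => hs; last first.
    by rewrite integral0_eq// => z _; rewrite indicE (negbTE hs) mulr0.
  rewrite -(integral_shift (s *: e) (f := fun z => ('D_e w z)%:E)%E)//.
  by apply: eq_integral => z _; rewrite indicE hs mulr1.
rewrite -swap integral_cst// [X in (_ * X)%E](lebesgue_measure_0c ltr01).
by rewrite mule1.
Qed.

End TranslationEstimate.

(** * Rules of calculus for continuous directional derivatives *)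

Section DirectionalCalculus.
Context {R : realType}.
Implicit Types (f g df dg : R * R -> R) (e z : R * R).

(** The derivative is carried as an explicit function, so that the product and inverse rules produce
    formulas ready for [field]. *)
Definition isC1 e f df :=
  [/\ continuous f, continuous df & forall z, is_derive z e f (df z)].

Lemma isC1_C1dir e f df : isC1 e f df -> C1dir e f /\ 'D_e f = df.
Proof.
move=> [cf cdf Df]; have E : 'D_e f = df by apply/funext => z; case: (Df z).
by split=> //; split; rewrite ?E// => z; case: (Df z).
Qed.

Lemma isC1_cst e (c : R) : isC1 e (fun=> c) (fun=> 0).
Proof. by split; try exact: cst_continuous; move=> z; exact: is_derive_cst. Qed.

Lemma isC1D e f df g dg : isC1 e f df -> isC1 e g dg ->
  isC1 e (fun z => f z + g z) (fun z => df z + dg z).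
Proof.
move=> [cf cdf Df] [cg cdg Dg]; split.
- by move=> z; exact: cvgD (cf z) (cg z).
- by move=> z; exact: cvgD (cdf z) (cdg z).
- by move=> z; exact: is_deriveD.
Qed.

Lemma isC1M e f df g dg : isC1 e f df -> isC1 e g dg ->
  isC1 e (fun z => f z * g z) (fun z => f z * dg z + g z * df z).
Proof.
move=> [cf cdf Df] [cg cdg Dg]; split.
- by move=> z; exact: cvgM (cf z) (cg z).
- by move=> z; apply: cvgD; [exact: cvgM (cf z) (cdg z)|exact: cvgM (cg z) (cdf z)].
- by move=> z; exact: is_deriveM.
Qed.

Lemma isC1V e f df : (forall z, f z != 0) -> isC1 e f df ->
  isC1 e (fun z => (f z)^-1) (fun z => - (f z) ^- 2 * df z).
Proof.
move=> f0 [cf cdf Df]; split.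
- by move=> z; exact: cvgV (f0 z) (cf z).
- move=> z; apply: cvgM; last exact: cdf.
  apply: cvgN; apply: cvgV; first by rewrite expf_neq0.
  exact: cvgM (cf z) (cf z).
- move=> z; have [dz Ez] := Df z; split; first exact: derivableV.
  by rewrite deriveV// Ez.
Qed.

Lemma isC1_linear e (a b : R) :
  isC1 e (fun z => a * z.1 + b * z.2) (fun=> a * e.1 + b * e.2).
Proof.
split; last 2 first.
- exact: cst_continuous.
- move=> z.
  have H : (fun h : R => h^-1 *: (((fun z => a * z.1 + b * z.2) \o shift z) (h *: e)
     - (a * z.1 + b * z.2))) @ (0 : R)^' --> a * e.1 + b * e.2.
    apply: (cvg_trans (near_eq_cvg _)); last exact: cvg_cst.
    near=> h; have h0 : h != 0 by near: h; exact: nbhs_dnbhs_neq.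
    by rewrite /shift /= /GRing.scale /=; field.
  by split; [apply/cvg_ex; exists (a * e.1 + b * e.2)|exact/cvg_lim].
- move=> z; apply: cvgD; apply: cvgM; try exact: cvg_cst.
    exact: cvg_fst.
  exact: cvg_snd.
Unshelve. all: by end_near. Qed.

Lemma isC1_shift e f df (x : R * R) : isC1 e f df ->
  isC1 e (fun z => f (x + z)) (fun z => df (x + z)).
Proof.
have cs (g : R * R -> R) : continuous g -> continuous (fun z => g (x + z)).
  move=> cg z; apply: continuous_comp; last exact: cg.
  have : (fun y : R * R => x + y) @ z --> x + z.
    by apply: cvgD; [exact: cvg_cst|exact: cvg_id].
  exact.
move=> [cf cdf Df]; split; [exact: cs|exact: cs|move=> z].
have E : (fun h : R => h^-1 *: (((fun z => f (x + z)) \o shift z) (h *: e) - f (x + z))) =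
   (fun h => h^-1 *: ((f \o shift (x + z)) (h *: e) - f (x + z))).
  by apply/funext => h; rewrite /shift /= addrCA.
have [H1 H2] := Df (x + z).
by split; [rewrite /derivable E|rewrite /derive E].
Qed.

End DirectionalCalculus.

(** * From small increments to small sets *)

Section Spread.
Context {R : realType}.
Implicit Types (u w : plane R -> R).

(** A mean increment of at least [c] over [A] forces a mean square of at least [c^2]. Integrating
    over [F] and exchanging the integrals gives [c^2 a |F| <= a b]. It is used with [tau] the
    identity and with [tau] a complex power. *)
Lemma spread u (A F : set (plane R)) (tau : plane R -> plane R) (a b c : R) :
  measurable_fun setT u -> measurable A -> measurable F ->
  measurable_fun setT tau -> leb2 A = a%:E -> 0 < a -> 0 < c ->
  (forall z, A z -> sqint (fun x => u (shift_plane (tau z) x) - u x)%R <= b%:E)%E ->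
  (forall x, F x -> (c * a)%:E <=
     \int[leb2]_(z in A) (`|u (shift_plane (tau z) x) - u x|)%:E)%E ->
  ((c ^+ 2)%:E * leb2 F <= b%:E)%E.
Proof.
move=> mu mA mF mtau Aa a0 c0 Hb Hc.
pose d (x z : plane R) := u (shift_plane (tau z) x) - u x.
have md : measurable_fun [set: plane R * plane R] (fun y => d y.1 y.2).
  apply: measurable_funB; last exact: (measurableT_comp mu measurable_fst).
  apply: (measurableT_comp mu).
  have mt := measurableT_comp mtau (@measurable_snd _ _ (plane R) (plane R)).
  have m1 := @measurable_fst _ _ (plane R) (plane R).
  apply: measurable_fun_pair => /=.
    apply: measurable_funD; first exact: (measurableT_comp measurable_fst mt).
    exact: (measurableT_comp measurable_fst m1).
  apply: measurable_funD; first exact: (measurableT_comp measurable_snd mt).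
  exact: (measurableT_comp measurable_snd m1).
have md1 x : measurable_fun setT (d x) := measurable_fun_pair2 x md.
have sqF x : F x -> ((c ^+ 2 * a)%:E <= \int[leb2]_(z in A) (d x z ^+ 2)%:E)%E.
  move=> Fx.
  have := Hc x Fx; rewrite -/(d x).
  set I1 := (X in (_ <= X)%E) => H1; set I2 := (X in (_ <= X)%E).
  have I20 : (0 <= I2)%E by apply: integral_ge0 => z _; rewrite lee_fin sqr_ge0.
  (* Integrated form of [2 c |d| <= d^2 + c^2]; with [I1 >= c a] it yields [I2 >= c^2 a]. *)
  have : ((2 * c)%:E * I1 <= I2 + (c ^+ 2 * a)%:E)%E.
    rewrite -ge0_integralZl_EFin//; last 2 first.
    - by apply/measurable_EFinP/measurableT_comp => //; exact: measurable_funTS (md1 x).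
    - by rewrite mulr_ge0// ltW.
    rewrite (EFinM (c ^+ 2)) -Aa -integral_cst// /I2 -ge0_integralD//; last 3 first.
    - by move=> z _; rewrite lee_fin sqr_ge0.
    - by apply/measurable_EFinP; apply: measurable_funX; exact: measurable_funTS (md1 x).
    - by move=> z _; rewrite lee_fin sqr_ge0.
    apply: ge0_le_integral_nm => z _.
      by rewrite -EFinM lee_fin !mulr_ge0// ltW.
    rewrite -EFinM -EFinD lee_fin -[d x z ^+ 2]real_normK ?num_real//.
    by have := sqr_ge0 (`|d x z| - c); nra.
  move: I20; case: I2 => [i2| |]// _; last by move=> _; rewrite leey.
  move=> H2; have : ((2 * c)%:E * (c * a)%:E <= i2%:E + (c ^+ 2 * a)%:E)%E.
    by apply: le_trans H2; apply: lee_wpmul2l => //; rewrite lee_fin mulr_ge0// ltW.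
  by rewrite -EFinM -EFinD !lee_fin; nra.
have : (\int[leb2]_(x in F) (c ^+ 2 * a)%:E <= b%:E * a%:E)%E.
  pose G (y : plane R * plane R) : \bar R := ((d y.1 y.2) ^+ 2 * \1_A y.2)%:E.
  have mchi : measurable_fun setT (\1_A : plane R -> R) by exact: measurable_indic.
  have mG : measurable_fun setT G.
    apply/measurable_EFinP; apply: measurable_funM; first exact: measurable_funX.
    exact: (measurableT_comp mchi measurable_snd).
  have G0 y : (0 <= G y)%E by rewrite lee_fin mulr_ge0// sqr_ge0.
  have GE x : (\int[leb2]_(z in A) (d x z ^+ 2)%:E = \int[leb2]_z G (x, z))%E.
    rewrite integral_mkcond; apply: eq_integral => z _.
    by rewrite patchE /G indicE /=; case: ifPn; rewrite ?mulr1 ?mulr0.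
  apply: (@le_trans _ _ (\int[leb2]_x \int[leb2]_z G (x, z))%E).
    rewrite [leLHS]integral_mkcond; apply: ge0_le_integral_nm => x _.
      by rewrite patchE; case: ifPn => // _; rewrite lee_fin mulr_ge0 ?sqr_ge0// ltW.
    rewrite patchE; case: ifPn => [/set_mem Fx|_]; last by apply: integral_ge0.
    by rewrite -GE; exact: sqF.
  rewrite tonelli_leb2_leb2// -Aa -integral_cst// [leRHS]integral_mkcond.
  apply: ge0_le_integral_nm => z _; first exact: integral_ge0.
  rewrite patchE; case: ifPn => zA; last first.
    by rewrite integral0_eq// => x _; rewrite /G /= indicE (negbTE zA) mulr0.
  apply: le_trans (Hb z (set_mem zA)); rewrite /sqint.
  apply: ge0_le_integral_nm => x _; first exact: G0.
  by rewrite /G /= indicE zA mulr1.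
rewrite integral_cst// EFinM -muleA [(a%:E * _)%E]muleC muleA => H.
by rewrite -(@lee_pmul2r _ a%:E).
Qed.

(** The shift is made in two steps parallel to the axes; the factors [2] come from
    [(a + b)^2 <= 2 a^2 + 2 b^2]. *)
Lemma sqint_shift_C1 w (v : plane R) :
  C1dir ((1, 0) : R * R) w -> C1dir ((0, 1) : R * R) w ->
  (sqint (fun x => w (shift_plane v x) - w x)%R <=
    (2 * v.1 ^+ 2)%:E * sqint (d1 w) + (2 * v.2 ^+ 2)%:E * sqint (d2 w))%E.
Proof.
move=> C1 C2; have [cw _ _] := C1; have mw := continuous_measurable_plane cw.
pose f1 (x : plane R) := w (v.1 *: (1, 0) + x) - w x.
pose f2 (x : plane R) := w (v.2 *: (0, 1) + x) - w x.
have msh (e : R * R) : measurable_fun setT (fun x : plane R => w (e + x)).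
  exact: (measurableT_comp mw (measurable_shift_plane e)).
have mf1 : measurable_fun setT f1 by exact: measurable_funB.
have mf2 : measurable_fun setT f2 by exact: measurable_funB.
have -> : (fun x => w (shift_plane v x) - w x) =
    (fun x => f1 (shift_plane (v.2 *: (0, 1)) x) + f2 x).
  apply/funext => x; rewrite /f1 /f2 -scale_shift addrA subrK; congr (w _ - _).
  have E1 : v.1 + x.1 = v.1 * 1 + (v.2 * 0 + x.1) by rewrite mulr1 mulr0 add0r.
  have E2 : v.2 + x.2 = v.1 * 0 + (v.2 * 1 + x.2) by rewrite mulr1 mulr0 add0r.
  by rewrite /shift_plane E1 E2.
apply: (le_trans (sqintD _ _)) => //.
  exact: (measurableT_comp mf1 (measurable_shift_plane _)).
rewrite (sqint_shift (v.2 *: (0, 1)) mf1) (EFinM 2 (v.1 ^+ 2)) (EFinM 2 (v.2 ^+ 2)) -!muleA.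
have two0 : (0 <= 2%:E :> \bar R)%E by rewrite lee_fin.
exact: leeD (lee_wpmul2l two0 (sqint_increment_norm v.1 C1))
  (lee_wpmul2l two0 (sqint_increment_norm v.2 C2)).
Qed.

End Spread.

(** * Logarithmic capacity *)

Section Capacity.
Context {R : realType}.
Implicit Types (w : R * R -> R) (z x : R * R).

Let rho (n : nat) : R := 2^-1 ^+ n.

(** [|z|^2] regularised at the scale [rho n]; the field [z / q n z] is then a smooth substitute for
    the gradient of [ln |z|]. *)
Let q n z : R := z.1 ^+ 2 + z.2 ^+ 2 + rho n ^+ 2.

Let rho_gt0 n : 0 < rho n. Proof. by rewrite exprn_gt0// invr_gt0. Qed.

Let q_gt0 n z : 0 < q n z.
Proof. by rewrite /q ltr_wpDl ?exprn_gt0// addr_ge0// sqr_ge0. Qed.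

Let rho_sqrV i : (rho i ^+ 2)^-1 = 4 ^+ i.
Proof. by rewrite /rho -!exprVn invrK exprAC -natrX. Qed.

Let rhoS i : 2 * rho i.+1 = rho i.
Proof. by rewrite /rho exprS mulrA divff// mul1r. Qed.

(** Dyadic decomposition: take the last [i <= n] whose box of radius [2 * rho i] contains [z].
    Either [z] is outside the box of radius [rho i], or [i = n]; in both cases
    [q n z >= (rho i)^2]. *)
Lemma inv_q_le n z : cbox 2 z ->
  (q n z)^-1 <= \sum_(i < n.+1) 4 ^+ i * \1_(cbox (2 * rho i)) z.
Proof.
move=> z2; have term_ge0 (i : 'I_n.+1) :
    0 <= (4 : R) ^+ i * \1_(cbox (2 * rho i)) z.
  by rewrite mulr_ge0// exprn_ge0.
suff [i [iz qi]] : exists i : 'I_n.+1, cbox (2 * rho i) z /\ (q n z)^-1 <= 4 ^+ i.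
  rewrite (bigD1 i)//= indicE mem_set// mulr1.
  by apply: (le_trans qi); rewrite lerDl; apply: sumr_ge0.
have H k : (k <= n)%N -> (exists i : 'I_n.+1, cbox (2 * rho i) z /\ (q n z)^-1 <= 4 ^+ i)
    \/ cbox (2 * rho k) z.
  elim: k => [_|k IH kn]; first by right; rewrite /rho expr0 mulr1.
  have [|zk] := IH (ltnW kn); first by left.
  rewrite rhoS; have [zk1|zk1] := pselect (cbox (rho k) z); first by right.
  left; exists (@Ordinal n.+1 k (ltnW kn)); split=> //=.
  rewrite -rho_sqrV lef_pV2 ?posrE ?q_gt0 ?exprn_gt0//.
  have r0 := rho_gt0 k; rewrite /q.
  have Hz : rho k < `|z.1| \/ rho k < `|z.2|.
    have [h1|h1] := leP `|z.1| (rho k); last by left.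
    have [h2|h2] := leP `|z.2| (rho k); last by right.
    by case: zk1.
  have := real_normK (num_real z.1); have := real_normK (num_real z.2).
  have := exprn_gt0 2 (rho_gt0 n); have := normr_ge0 z.1; have := normr_ge0 z.2.
  by case: Hz; nra.
have [//|zn] := H n (leqnn n).
exists ord_max; split=> //=; rewrite -rho_sqrV lef_pV2 ?posrE ?q_gt0 ?exprn_gt0//.
by rewrite /q lerDr addr_ge0// sqr_ge0.
Qed.

Lemma integral_inv_q n :
  (\int[leb2]_(z in (cbox 2 : set (plane R))) ((q n z)^-1)%:E <= (16 * n.+1%:R)%:E)%E.
Proof.
apply: (@le_trans _ _ (\int[leb2]_(z in [set: plane R])
    \sum_(i < n.+1) (4 ^+ i * \1_(cbox (2 * rho i) : set (plane R)) z)%:E)%E).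
  rewrite integral_mkcond; apply: ge0_le_integral_nm => z _; rewrite patchE.
    by case: ifPn => // _; rewrite lee_fin invr_ge0 ltW.
  case: ifPn => [/set_mem z2|_].
    by rewrite sumEFin lee_fin; exact: inv_q_le.
  by apply: sume_ge0 => i _; rewrite lee_fin mulr_ge0// exprn_ge0.
rewrite ge0_integral_sum//; last first.
  move=> i; apply/measurable_EFinP/measurable_funM => //.
  by apply: measurable_indic; exact: measurable_cbox.
(* Each scale weighs [4^i (4 rho i)^2 = 16]: the integral grows linearly in the number of scales,
   that is, logarithmically in [1 / rho n]. *)
rewrite (eq_bigr (fun=> 16%:E)).
  by rewrite sumEFin lee_fin sumr_const card_ord mulr_natr.
move=> i _; have mB := measurable_cbox (2 * rho i).
under eq_integral do rewrite EFinM.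
rewrite ge0_integralZl_EFin//; last first.
  by apply/measurable_EFinP; exact: measurable_indic.
rewrite integral_indic// setIT leb2_cbox ?mulr_ge0// ?ltW//.
rewrite -EFinM; congr EFin; rewrite -rho_sqrV.
have r0 : rho i != 0 by rewrite gt_eqF.
by field.
Qed.

Let e1 : R * R := (1, 0).
Let e2 : R * R := (0, 1).

(* Divergence of [w F] for the vector field [F z = z / (|z|^2 + r^2)], whose own
   divergence is [2 r^2 / (|z|^2 + r^2)^2]; the cross term is split by AM-GM with
   weight [th]. *)
Let kernel_pointwise (a D1 D2 z1 z2 r th : R) (qq := z1 ^+ 2 + z2 ^+ 2 + r ^+ 2) :
  0 < r -> 0 < th -> 0 <= a ->
  a * (2 * r ^+ 2 * qq^-1 ^+ 2) <=
  (a * (z1 * (- qq ^- 2 * (2 * z1)) + qq^-1 * 1) + z1 * qq^-1 * D1) +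
  (a * (z2 * (- qq ^- 2 * (2 * z2)) + qq^-1 * 1) + z2 * qq^-1 * D2) +
  (th / 2 * (D1 ^+ 2 + D2 ^+ 2) + (2 * th)^-1 * qq^-1).
Proof.
move=> r0 th0 a0; have q0 : 0 < qq.
  by rewrite /qq ltr_wpDl ?exprn_gt0// addr_ge0// sqr_ge0.
have rE : r ^+ 2 = qq - z1 ^+ 2 - z2 ^+ 2 by rewrite /qq; ring.
rewrite -subr_ge0.
set D := (X in 0 <= X).
have -> : D = th / 2 * (D1 + z1 / (th * qq)) ^+ 2 + th / 2 * (D2 + z2 / (th * qq)) ^+ 2
   + (2 * th)^-1 * (r ^+ 2 / qq ^+ 2).
  by rewrite /D rE; field; rewrite !gt_eqF.
by rewrite !addr_ge0// mulr_ge0// ?sqr_ge0 ?divr_ge0 ?invr_ge0 ?mulr_ge0 ?sqr_ge0// ltW.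
Qed.

(** [kernel_pointwise] is integrated for [w(x + .)], supported in [cbox 2]. The divergence
    integrates to [0], the squared derivatives give the energy, and [1 / q] gives the logarithmic
    term. What remains on the left is [w] against the density [2 r^2 / q^2], restricted to the box
    of radius [r = rho n]. *)
Lemma kernel_bound w D1 D2 n x (th : R) : 0 < th ->
  isC1 e1 w D1 -> isC1 e2 w D2 -> vanish_off (cbox 1) w -> (forall z, 0 <= w z) ->
  cbox 1 x ->
  ((2 / (9 * rho n ^+ 2))%:E * \int[leb2]_(z in (cbox (rho n) : set (plane R))) (w (x + z))%:E <=
   (th / 2)%:E * (sqint D1 + sqint D2) + (8 * n.+1%:R / th)%:E)%E.
Proof.
move=> th0 C1 C2 w0 wge0 x1; have [cw cd1 _] := C1; have [_ cd2 _] := C2.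
have VD1 : vanish_off (cbox 1) D1 by rewrite -(isC1_C1dir C1).2; exact: vanish_derive.
have VD2 : vanish_off (cbox 1) D2 by rewrite -(isC1_C1dir C2).2; exact: vanish_derive.
have mB := measurable_cbox (R := R).
have iq e : isC1 e (q n) (fun z => (z.1 * e.1 + z.1 * e.1) + (z.2 * e.2 + z.2 * e.2) + 0).
  have f1 : isC1 e (fun z : R * R => z.1) (fun=> e.1).
    have := isC1_linear e 1 0; rewrite mul1r mul0r addr0.
    by congr isC1; apply/funext => z; rewrite mul1r mul0r addr0.
  have f2 : isC1 e (fun z : R * R => z.2) (fun=> e.2).
    have := isC1_linear e 0 1; rewrite mul1r mul0r add0r.
    by congr isC1; apply/funext => z; rewrite mul1r mul0r add0r.
  exact: (isC1D (isC1D (isC1M f1 f1) (isC1M f2 f2)) (isC1_cst e (rho n ^+ 2))).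
have f1 : isC1 e1 (fun z : R * R => z.1) (fun=> 1).
  have := isC1_linear e1 1 0; rewrite mul1r mul0r addr0.
  by congr isC1; apply/funext => z; rewrite mul1r mul0r addr0.
have f2 : isC1 e2 (fun z : R * R => z.2) (fun=> 1).
  have := isC1_linear e2 0 1; rewrite mul1r mul0r add0r.
  by congr isC1; apply/funext => z; rewrite mul1r mul0r add0r.
have qn0 z : q n z != 0 by rewrite gt_eqF.
have iw1 := isC1_shift x C1; have iw2 := isC1_shift x C2.
have P1 := isC1M iw1 (isC1M f1 (isC1V qn0 (iq e1))).
have P2 := isC1M iw2 (isC1M f2 (isC1V qn0 (iq e2))).
have off2 z : ~ cbox 2 z -> ~ cbox 1 (x + z).
  move=> nz [/= h1 h2]; apply: nz; have [k1 k2] := x1; split.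
    rewrite -(addKr x.1 z.1); apply: (le_trans (ler_normD _ _)).
    by rewrite normrN -[leRHS]/(1 + 1); apply: lerD.
  rewrite -(addKr x.2 z.2); apply: (le_trans (ler_normD _ _)).
  by rewrite normrN -[leRHS]/(1 + 1); apply: lerD.
have wx0 z : ~ cbox 2 z -> w (x + z) = 0 by move/off2/w0.
have [Q1 E1] := isC1_C1dir P1; have [Q2 E2] := isC1_C1dir P2.
have V1 : vanish_off (cbox 2) (fun z => w (x + z) * (z.1 * (q n z)^-1)).
  by move=> z /wx0 ->; rewrite mul0r.
have V2 : vanish_off (cbox 2) (fun z => w (x + z) * (z.2 * (q n z)^-1)).
  by move=> z /wx0 ->; rewrite mul0r.
have I1 := integral_derive0 (ler0n _ 2) Q1 V1; have I2 := integral_derive0 (ler0n _ 2) Q2 V2.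
have [_ cQ1 _] := Q1; have [_ cQ2 _] := Q2.
have J1 := continuous_integrable (ler0n _ 2) cQ1 (vanish_derive e1 V1).
have J2 := continuous_integrable (ler0n _ 2) cQ2 (vanish_derive e2 V2).
set G1 := 'D_e1 _ in I1 J1 E1; set G2 := 'D_e2 _ in I2 J2 E2.
have md1 := continuous_measurable_plane cd1; have md2 := continuous_measurable_plane cd2.
have mq : measurable_fun setT (fun z : plane R => (q n z)^-1).
  apply: continuous_measurable_plane => z; have [cq _ _] := iq e1.
  by apply: cvgV; [exact: qn0|exact: cq].
have mchi : measurable_fun setT (\1_(cbox 2) : plane R -> R) by exact: measurable_indic.
pose H z : R := th / 2 * ((D1 (x + z)) ^+ 2 + (D2 (x + z)) ^+ 2) +
   ((2 * th)^-1 * ((q n z)^-1 * \1_(cbox 2 : set (plane R)) z)).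
have ms1 : measurable_fun setT (fun z : plane R => D1 (x + z)).
  exact: (measurableT_comp md1 (measurable_shift_plane x)).
have ms2 : measurable_fun setT (fun z : plane R => D2 (x + z)).
  exact: (measurableT_comp md2 (measurable_shift_plane x)).
have HE : (\int[leb2]_z (H z)%:E <= (th / 2)%:E * (sqint D1 + sqint D2) + (8 * n.+1%:R / th)%:E)%E.
  under eq_integral do rewrite EFinD EFinM EFinD (EFinM (2 * th)^-1).
  rewrite ge0_integralD//; last 4 first.
  - by move=> z _; rewrite -EFinD -EFinM lee_fin mulr_ge0 ?addr_ge0 ?sqr_ge0// ltW// divr_gt0.
  - apply: measurable_funeM; apply: emeasurable_funD; first [exact: measurable_sqr ms1|exact: measurable_sqr ms2].
  - move=> z _; rewrite -EFinM lee_fin mulr_ge0// ?mulr_ge0 ?invr_ge0//; last by rewrite ltW.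
    by rewrite mulr_ge0// ltW.
  - apply: measurable_funeM; apply/measurable_EFinP/measurable_funM; [exact: mq|exact: mchi].
  rewrite ge0_integralZl_EFin//; last 3 first.
  - by move=> z _; rewrite -EFinD lee_fin addr_ge0 ?sqr_ge0.
  - apply: emeasurable_funD; first [exact: measurable_sqr ms1|exact: measurable_sqr ms2].
  - by rewrite ltW// divr_gt0.
  rewrite ge0_integralD//; last 4 first.
  - by move=> z _; rewrite lee_fin sqr_ge0.
  - first [exact: measurable_sqr ms1|exact: measurable_sqr ms2].
  - by move=> z _; rewrite lee_fin sqr_ge0.
  - first [exact: measurable_sqr ms1|exact: measurable_sqr ms2].
  have -> : (\int[leb2]_z ((D1 (x + z)) ^+ 2)%:E = sqint D1)%E.
    exact: (sqint_shift x md1).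
  have -> : (\int[leb2]_z ((D2 (x + z)) ^+ 2)%:E = sqint D2)%E.
    exact: (sqint_shift x md2).
  apply: leeD => //.
  rewrite ge0_integralZl_EFin//; last 3 first.
  - by move=> z _; rewrite lee_fin mulr_ge0// invr_ge0 ltW.
  - by apply/measurable_EFinP/measurable_funM; [exact: mq|exact: mchi].
  - by rewrite invr_ge0 mulr_ge0// ltW.
  have -> : (8 * n.+1%:R / th)%:E = ((2 * th)^-1%:E * (16 * n.+1%:R)%:E)%E.
    by rewrite -EFinM; congr EFin; field; rewrite gt_eqF.
  apply: lee_wpmul2l; first by rewrite lee_fin invr_ge0 mulr_ge0// ltW.
  apply: le_trans (integral_inv_q n).
  rewrite [leRHS]integral_mkcond; apply: ge0_le_integral_nm => z _.
    by rewrite lee_fin mulr_ge0// invr_ge0 ltW.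
  by rewrite patchE indicE; case: ifPn; rewrite ?mulr1 ?mulr0.
have [sfin1 sfin2] : (sqint D1 < +oo)%E /\ (sqint D2 < +oo)%E.
  split.
    by have [] := continuous_L2 ler01 cd1 VD1.
  by have [] := continuous_L2 ler01 cd2 VD2.
have H0 z : 0 <= H z.
  rewrite /H addr_ge0// mulr_ge0// ?addr_ge0 ?sqr_ge0 ?invr_ge0 ?mulr_ge0 ?invr_ge0//.
  - by rewrite ltW// divr_gt0.
  - exact: ltW.
  - exact/ltW/q_gt0.
have mH : measurable_fun setT (H : plane R -> R).
  apply: measurable_funD; apply: measurable_funM => //.
    apply: measurable_funD; first [exact: measurable_funX ms1|exact: measurable_funX ms2].
  by apply: measurable_funM; [exact: mq|exact: mchi].
have JH : leb2.-integrable setT (EFin \o (H : plane R -> R)).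
  apply/integrableP; split; first exact/measurable_EFinP.
  under eq_integral => z _ do rewrite /= ger0_norm//.
  apply: le_lt_trans HE _; rewrite lte_add_pinfty ?ltry// lte_mul_pinfty ?lee_fin//.
    by rewrite ltW// divr_gt0.
  exact: lte_add_pinfty.
apply: le_trans HE.
have -> : (\int[leb2]_z (H z)%:E = \int[leb2]_z ((G1 z)%:E + (G2 z)%:E + (H z)%:E))%E.
  rewrite integralD//; last exact: integrableD.
  by rewrite integralD// [X in (X + _ + _)%E]I1 [X in (_ + X + _)%E]I2 !add0e.
have mwx : measurable_fun setT (fun z : plane R => w (x + z)).
  exact: (measurableT_comp (continuous_measurable_plane cw) (measurable_shift_plane x)).
rewrite -ge0_integralZl_EFin//; first last.
- by rewrite divr_ge0// mulr_ge0// sqr_ge0.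
- exact/measurable_EFinP/measurable_funTS.
- by move=> z _; rewrite lee_fin.
rewrite integral_mkcond; apply: ge0_le_integral_nm => z _.
  rewrite patchE; case: ifPn => // _; rewrite -EFinM lee_fin mulr_ge0//.
  by rewrite divr_ge0// mulr_ge0// sqr_ge0.
have r0 := rho_gt0 n; have qz0 := q_gt0 n z.
have grad_q1 : z.1 * e1.1 + z.1 * e1.1 + (z.2 * e1.2 + z.2 * e1.2) + 0 = 2 * z.1.
  by rewrite /e1 /=; ring.
have grad_q2 : z.1 * e2.1 + z.1 * e2.1 + (z.2 * e2.2 + z.2 * e2.2) + 0 = 2 * z.2.
  by rewrite /e2 /=; ring.
have E : G1 z + G2 z + H z >= w (x + z) * (2 * rho n ^+ 2 * (q n z)^-1 ^+ 2).
  have [z2|nz2] := pselect (cbox 2 z); last first.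
    by rewrite wx0// mul0r E1 E2 wx0// !mul0r !add0r (VD1 _ (off2 _ nz2)) (VD2 _ (off2 _ nz2)) mulr0 mulr0 !add0r H0.
  have := kernel_pointwise (D1 (x + z)) (D2 (x + z)) z.1 z.2 r0 th0 (wge0 (x + z)).
  rewrite -/(q n z) /H E1 E2 indicE mem_set// [_ * true%:R]mulr1 !grad_q1 !grad_q2.
  exact.
rewrite patchE; case: ifPn => [/set_mem zr|_]; last first.
  rewrite -!EFinD lee_fin; apply: le_trans E.
  by rewrite !mulr_ge0// ?invr_ge0 ltW.
rewrite -EFinM -!EFinD lee_fin; apply: le_trans E; rewrite mulrC ler_wpM2l//.
(* On the box [|z|^2 <= 2 r^2]; hence the density is at least [2 r^2 / (3 r^2)^2 = 2 / (9 r^2)]. *)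
have q3 : q n z <= 3 * rho n ^+ 2.
  have [h1 h2] := zr; rewrite /q -(real_normK (num_real z.1)) -(real_normK (num_real z.2)).
  by have := normr_ge0 z.1; have := normr_ge0 z.2; nra.
have -> : 2 / (9 * rho n ^+ 2) = 2 * rho n ^+ 2 * ((3 * rho n ^+ 2)^-1) ^+ 2.
  by field; rewrite gt_eqF.
apply: ler_wpM2l; first by rewrite mulr_ge0// sqr_ge0.
have i3 : (3 * rho n ^+ 2)^-1 <= (q n z)^-1.
  by rewrite lef_pV2 ?posrE ?q_gt0// mulr_gt0// exprn_gt0.
by rewrite lerXn2r// nnegrE invr_ge0 ?mulr_ge0 ?sqr_ge0// ltW.
Qed.

End Capacity.

Section CapacityBound.
Context {R : realType}.

(** From [exp(-1/2) >= 1/2], hence [exp(1/2) <= 2]. It lets powers of [4], the inverse areas of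
    dyadic boxes, be compared with exponentials. *)
Lemma expR1_le4 : expR 1 <= 4 :> R.
Proof.
have := expR_ge1Dx (- (2^-1) : R); have := expRxMexpNx_1 (2^-1 : R).
have : expR 1 = expR 2^-1 * expR 2^-1 :> R by rewrite -expRD; congr expR; field.
by have := expR_gt0 (2^-1 : R); nra.
Qed.

Lemma dyadic_scale (m : R) : 0 < m -> m <= 1 ->
  exists n : nat, (2^-1 ^+ n) ^+ 2 <= m /\ n.+1%:R <= 2 * (1 - ln m).
Proof.
move=> m0 m1; have lm : ln m <= 0 by exact: ln_le0.
pose n := (Num.truncn (- ln m)).+1; exists n; split; last first.
  have : (Num.truncn (- ln m))%:R <= - ln m by rewrite truncn_le oppr_ge0.
  by rewrite /n -!natr1; lra.
have nl : - ln m < n%:R by exact: truncnS_gt.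
rewrite -exprM mulnC exprM -[leRHS](@lnK _ m) ?posrE//.
apply: (@le_trans _ _ (expR (- n%:R))); last by rewrite ler_expR; lra.
rewrite expRN -[n%:R]mulr1 expRM_natl -exprVn lerXn2r ?nnegrE ?invr_ge0 ?expR_ge0 ?sqr_ge0 ?exprn_ge0 ?invr_ge0//.
rewrite exprVn lef_pV2 ?posrE ?expR_gt0 ?exprn_gt0//.
by rewrite -natrX; exact: expR1_le4.
Qed.

(** At a scale [r] with [r^2 <= m], either some mean of [w] over a box of radius [r] is at least
    [1/8], and [kernel_bound] applies, or every mean around a point of [F] is smaller than [1/8]
    while [w >= 1/4] there, and [spread] applies. The first case fixes the constant:
    [1/18 <= 72 (n + 1) E <= 144 E (1 - ln m)] and [18 * 144 = 2592]. *)
Lemma capacity_bound (w D1 D2 : R * R -> R) (F : set (plane R)) (m E : R) :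
  isC1 ((1, 0) : R * R) w D1 -> isC1 ((0, 1) : R * R) w D2 ->
  vanish_off (cbox 1) w -> (forall z, 0 <= w z) ->
  measurable F -> F `<=` cbox 1 -> (forall x, F x -> 4^-1 <= w x) ->
  leb2 F = m%:E -> 0 < m -> m <= 1 -> (sqint D1 + sqint D2 <= E%:E)%E ->
  1 <= 2592 * E * (1 - ln m).
Proof.
move=> C1 C2 w0 wge0 mF F1 wF Fm m0 m1 DE.
have [n [nm nl]] := dyadic_scale m0 m1.
set r := 2^-1 ^+ n in nm; have r0 : 0 < r by rewrite exprn_gt0// invr_gt0.
have L1 : 1 <= 1 - ln m by have := ln_le0 m1; lra.
have E0 : 0 <= E.
  by rewrite -lee_fin (le_trans _ DE)// adde_ge0// sqint_ge0.
have [cw cD1 _] := C1; have [_ cD2 _] := C2.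
have mw := continuous_measurable_plane cw.
pose Q : set (plane R) := cbox r.
have mQ : measurable Q by exact: measurable_cbox.
have [[x [x1 Ix]]|small] := pselect (exists x, cbox 1 x /\
    ((r ^+ 2 / 2)%:E <= \int[leb2]_(z in Q) (w (x + z))%:E)%E).
  (* This weight makes the logarithmic term [8 / 144 = 1/18], half of the lower bound [1/9]. *)
  have th0 : 0 < 144 * n.+1%:R :> R by rewrite mulr_gt0.
  have K := kernel_bound n th0 C1 C2 w0 wge0 x1.
  have : ((2 / (9 * r ^+ 2))%:E * (r ^+ 2 / 2)%:E <=
    (144 * n.+1%:R / 2)%:E * E%:E + (8 * n.+1%:R / (144 * n.+1%:R))%:E)%E.
    apply: (@le_trans _ _ _ _ _ (le_trans _ K)).
      by apply: lee_wpmul2l => //; rewrite lee_fin divr_ge0// mulr_ge0// sqr_ge0.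
    by apply: leeD => //; apply: lee_wpmul2l => //; rewrite lee_fin ltW// divr_gt0.
  rewrite -!EFinM -EFinD lee_fin.
  have -> : 2 / (9 * r ^+ 2) * (r ^+ 2 / 2) = 9^-1 by field; rewrite gt_eqF.
  have -> : 8 * n.+1%:R / (144 * n.+1%:R) = 18^-1 :> R.
    by field; rewrite nat1r pnatr_eq0.
  by move=> H; nra.
(* In the second case [spread] gives [m / 64 <= 2 r^2 E <= 2 m E], hence [1 <= 128 E]. *)
have B z : Q z -> (sqint (fun x => w (shift_plane z x) - w x)%R <= (2 * r ^+ 2 * E)%:E)%E.
  move=> [z1 z2].
  have [Q1 E1] := isC1_C1dir C1; have [Q2 E2] := isC1_C1dir C2.
  apply: (le_trans (sqint_shift_C1 z Q1 Q2)); rewrite /d1 /d2 E1 E2.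
  have sz (t : R) : `|t| <= r -> 2 * t ^+ 2 <= 2 * r ^+ 2.
    by move=> tr; rewrite ler_pM2l// -real_normK ?num_real// lerXn2r ?nnegrE// ltW.
  apply: (@le_trans _ _ ((2 * r ^+ 2)%:E * (sqint D1 + sqint D2))%E).
    rewrite [leRHS](ge0_muleDr _ (sqint_ge0 D1) (sqint_ge0 D2)).
    by apply: leeD; apply: lee_wpmul2r; rewrite ?sqint_ge0// lee_fin sz.
  by rewrite (EFinM _ E); apply: lee_wpmul2l => //; rewrite lee_fin mulr_ge0// sqr_ge0.
have Qa : leb2 Q = ((2 * r) ^+ 2)%:E by rewrite /Q leb2_cbox// ltW.
have a0 : 0 < (2 * r) ^+ 2 by rewrite exprn_gt0// mulr_gt0.
have c0 : (0 : R) < 8^-1 by rewrite invr_gt0.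
have Hx x : F x -> ((8^-1 * (2 * r) ^+ 2)%:E <=
    \int[leb2]_(z in Q) (`|w (shift_plane (id z) x) - w x|)%:E)%E.
  move=> Fx; have msx : measurable_fun setT (fun z : plane R => w (x + z)).
    exact: (measurableT_comp mw (measurable_shift_plane x)).
  have Ilt : (\int[leb2]_(z in Q) (w (x + z))%:E < (r ^+ 2 / 2)%:E)%E.
    rewrite ltNge; apply/negP => h; apply: small; exists x; split => //.
    exact: F1.
  set I1 := (X in (X < _)%E) in Ilt; set I2 := (X in (_ <= X)%E).
  have : ((4^-1 * (2 * r) ^+ 2)%:E <= I1 + I2)%E.
    rewrite EFinM -Qa -integral_cst// /I1 /I2 -ge0_integralD//; last 3 first.
    - by move=> z _; rewrite lee_fin.
    - exact/measurable_EFinP/measurable_funTS.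
    - apply/measurable_EFinP/measurableT_comp => //.
      apply: measurable_funB => //; apply: measurable_funTS.
      apply: (eq_measurable_fun (fun z => w (x + z))) => // z _.
      by rewrite /shift_plane addrC.
    apply: ge0_le_integral_nm => z _; first by rewrite lee_fin invr_ge0.
    rewrite -EFinD lee_fin (le_trans (wF _ Fx))//.
    have -> : shift_plane (id z) x = x + z by rewrite addrC.
    have := ler_norm (w x - w (x + z)); rewrite distrC; lra.
  have I10 : (0 <= I1)%E by apply: integral_ge0 => z _; rewrite lee_fin.
  move: Ilt I10; case: I1 => [i1| |]//; case: I2 => [i2| |]// => [h1 h0 h2|h1 h0 h2].
    by move: h1 h0 h2; rewrite -EFinD !lee_fin lte_fin => h1 h0 h2; nra.
  by rewrite leey.
have := spread mw mQ mF (@measurable_id _ _ setT) Qa a0 c0 B Hx.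
by rewrite Fm -EFinM lee_fin => H; nra.
Qed.

End CapacityBound.

(** * Weak gradients *)

Section TestFunctions.
Context {R : realType}.
Implicit Types (w phi : R * R -> R) (z : R * R) (Om : set (R * R)).

Let e1 : R * R := (1, 0).
Let e2 : R * R := (0, 1).

Lemma abs_le_enorm z : `|z.1| <= enorm z /\ `|z.2| <= enorm z.
Proof.
by split; rewrite -sqrtr_sqr; apply: ler_wsqrtr; rewrite ?lerDl ?lerDr sqr_ge0.
Qed.

Lemma disk_cbox (r : R) : disk r `<=` cbox r.
Proof.
move=> z /= zr; have [h1 h2] := abs_le_enorm z.
by split; rewrite (le_trans _ (ltW zr)).
Qed.

Lemma continuous_enorm : continuous (@enorm R).
Proof.
move=> z; apply: (@continuous_comp _ _ _ (fun z : R * R => z.1 ^+ 2 + z.2 ^+ 2) (@Num.sqrt R)).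
  apply: cvgD.
    by apply: cvgM; exact: cvg_fst.
  by apply: cvgM; exact: cvg_snd.
exact: sqrt_continuous.
Qed.

Lemma open_disk (r : R) : open (disk r).
Proof.
rewrite (_ : disk r = @enorm R @^-1` [set x | x < r])//.
by apply: open_comp; [move=> z _; exact: continuous_enorm|exact: open_lt].
Qed.

Lemma measurable_disk (r : R) : measurable (disk r : set (plane R)).
Proof. by apply: open_measurable_plane; exact: open_disk. Qed.

Lemma test_isC1 Om phi : test_fun Om phi -> isC1 e1 phi (d1 phi) /\ isC1 e2 phi (d2 phi).
Proof.
move=> [sm _ _]; have [c0 D0] := sm [::].
have [c1 _] := sm [:: true]; have [c2 _] := sm [:: false].
split; split; [exact: c0|exact: c1| |exact: c0|exact: c2|] => z;
  have [D1 D2] := D0 z.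
- exact: (DeriveDef D1 erefl).
- exact: (DeriveDef D2 erefl).
Qed.

Lemma test_supp Om phi z : test_fun Om phi -> ~ Om z -> phi z = 0.
Proof.
move=> [_ _ sub] nz; apply/eqP; apply: contra_notT nz => pz.
by apply: sub; apply: subset_closure.
Qed.

Lemma test_vanish Om phi r : test_fun Om phi -> Om `<=` cbox r ->
  vanish_off (cbox r) phi.
Proof. by move=> tf sub z nz; apply: (test_supp tf) => /sub. Qed.

Lemma test_funS Om Om' phi : Om `<=` Om' -> test_fun Om phi -> test_fun Om' phi.
Proof. by move=> sub [h1 h2 h3]; split=> //; exact: subset_trans h3 sub. Qed.

Lemma closure_derive_supp e phi :
  closure [set z | 'D_e phi z != 0] `<=` closure [set z | phi z != 0].
Proof.
have clE : closure (closure [set z | phi z != 0]) = closure [set z | phi z != 0].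
  by apply/esym/closure_id; exact: closed_closure.
rewrite -[X in _ `<=` X]clE; apply: closure_subset => z /= Dz; apply: contrapT => nz; move/eqP: Dz; apply.
have nbz : nbhs z (~` closure [set z | phi z != 0]).
  by apply: open_nbhs_nbhs; split => //; exact/closed_openC/closed_closure.
have cz : (fun h : R => h *: e + z) @ (0 : R)^' --> (0 : R) *: e + z.
  apply: cvg_within_filter; apply: cvgD; last exact: cvg_cst.
  by apply: cvgZl; exact: cvg_id.
rewrite scale0r add0r in cz.
have p0 y : ~ closure [set z | phi z != 0] y -> phi y = 0.
  move=> ny; apply/eqP; apply: contra_notT ny => py.
  exact: subset_closure.
have {}cz : \forall h \near (0 : R)^', (~` closure [set z | phi z != 0]) (h *: e + z) := cz _ nbz.
rewrite /derive; apply/cvg_lim => //.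
apply: (cvg_trans (near_eq_cvg _)); last exact: cvg_cst.
move: cz; apply: filterS => h /p0 ph.
by rewrite /shift /= ph (p0 _ nz) subrr scaler0.
Qed.

Lemma test_derive Om phi (b : bool) : test_fun Om phi ->
  test_fun Om (if b then d1 phi else d2 phi).
Proof.
move=> [sm cpt sub].
have cl : closure [set z | (if b then d1 phi else d2 phi) z != 0] `<=`
    closure [set z | phi z != 0].
  by case: b; exact: closure_derive_supp.
split; last exact: subset_trans sub.
- move=> s; have := sm (rcons s b).
  by rewrite /iter_partial foldr_rcons.
- by apply: subclosed_compact cpt cl; exact: closed_closure.
Qed.

Lemma test_bounded Om phi : test_fun Om phi ->
  exists r : R, 0 <= r /\ vanish_off (cbox r) phi.
Proof.
move=> [_ /compact_bounded [M [_ HM]] _]; exists (`|M| + 1); split.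
  by rewrite addr_ge0.
move=> z nz; apply/eqP; apply: contra_notT nz => pz.
have /= : `|z| <= `|M| + 1.
  apply: HM; first by rewrite (le_lt_trans (ler_norm M))// ltrDl.
  exact: subset_closure.
by rewrite prod_normE ge_max => /andP[].
Qed.

Lemma test_L2 Om phi : test_fun Om phi -> L2 phi.
Proof.
move=> tf; have [r [r0 v]] := test_bounded tf.
by apply: continuous_L2 r0 _ v; have [[]] := test_isC1 tf.
Qed.

Lemma test_d1_L2 Om phi : test_fun Om phi -> L2 (d1 phi).
Proof. by move=> /(test_derive true)/test_L2. Qed.

Lemma test_d2_L2 Om phi : test_fun Om phi -> L2 (d2 phi).
Proof. by move=> /(test_derive false)/test_L2. Qed.

End TestFunctions.

(** * Sobolev functions as limits of test functions *)

Section H01Facts.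
Context {R : realType}.
Implicit Types (w phi : R * R -> R) (z : R * R) (v : R * R -> R * R).

Lemma weak_gradient_L2 w v : weak_gradient w v -> L2 (fst \o v) /\ L2 (snd \o v).
Proof. by move=> [/LfunP2 ? /LfunP2 ? _]. Qed.

Lemma weak_gradient_ip w v phi : weak_gradient w v -> test_fun setT phi ->
  ip w (d1 phi) = - ip (fst \o v) phi /\ ip w (d2 phi) = - ip (snd \o v) phi.
Proof. by move=> [_ _ H] /H. Qed.

Definition gradE v : R := n2 (fst \o v) + n2 (snd \o v).

(** The approximation clause of [H01] in epsilon form, split into the coordinates of the
    gradient. *)
Definition approximable w v := forall e : R, 0 < e ->
  exists phi, [/\ test_fun (disk 1) phi,
    (sqint (fun z => phi z - w z)%R < e%:E)%E,
    (sqint (fun z => d1 phi z - (v z).1)%R < e%:E)%E &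
    (sqint (fun z => d2 phi z - (v z).2)%R < e%:E)%E].

Lemma enorm_sqr z : enorm z ^+ 2 = z.1 ^+ 2 + z.2 ^+ 2.
Proof. by rewrite sqr_sqrtr// addr_ge0// sqr_ge0. Qed.

Lemma sqint_le_enorm (g : R * R -> R * R) (f : R * R -> R) :
  (forall z, `|f z| <= enorm (g z)) ->
  (sqint f <= sqint (fun z => enorm (g z)))%E.
Proof.
move=> fg; apply: sqint_le => z.
by rewrite [leRHS]ger0_norm// sqrtr_ge0.
Qed.

Lemma H01_approx w : H01 (disk 1) w ->
  L2 w /\ exists v, weak_gradient w v /\ approximable w v.
Proof.
move=> [/LfunP2 Lw _ [v [wg [phi [tf c0 c1]]]]]; split => //.
exists v; split => // e e0.
have [n [h0 h1]] : exists n,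
    (sqint (fun z => phi n z - w z)%R < e%:E)%E /\
    (sqint (fun z => enorm ((d1 (phi n) z, d2 (phi n) z) - v z))%R < e%:E)%E.
  have /filterI/(_ (cvg_L2norm_sqint c1 e0)) := cvg_L2norm_sqint c0 e0.
  by move=> [n _ /(_ n (leqnn n))] [? ?]; exists n.
exists (phi n); split => //; apply: le_lt_trans h1; apply: sqint_le_enorm => z.
  by have [] := abs_le_enorm ((d1 (phi n) z, d2 (phi n) z) - v z).
by have [] := abs_le_enorm ((d1 (phi n) z, d2 (phi n) z) - v z).
Qed.

Lemma approx_n2 (f g : plane R -> R) (e : R) : L2 f -> L2 g ->
  (sqint (fun z => f z - g z)%R < e%:E)%E -> n2 (fun z => f z - g z) < e.
Proof. by move=> Lf Lg; rewrite L2_fin ?lte_fin//; exact: L2B. Qed.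

Lemma n2D2 (f g : plane R -> R) : L2 f -> L2 g ->
  n2 (fun z => f z + g z) <= 2 * n2 f + 2 * n2 g.
Proof.
move=> Lf Lg; have [mf _] := Lf; have [mg _] := Lg.
rewrite -lee_fin (EFinD (2 * n2 f)) (EFinM 2 (n2 f)) (EFinM 2 (n2 g)) -!L2_fin//; last exact: L2D.
exact: sqintD.
Qed.

(** Both gradients have the same pairing with every derivative of a test function. As [v] is a limit
    of such derivatives, [<v, v> = <v', v>] in each coordinate, and Cauchy-Schwarz gives
    [|v| <= |v'|]. This is how energies built on [approx_grad] are compared with [grad_norm], whose
    gradient is merely some weak gradient. *)
Lemma grad_compare w v v' : weak_gradient w v -> approximable w v ->
  weak_gradient w v' -> gradE v <= gradE v'.
Proof.
move=> wg ap wg'; have [L1 L2'] := weak_gradient_L2 wg.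
have [L1' L2''] := weak_gradient_L2 wg'.
have key (b : bool) (f f' : plane R -> R) : L2 f -> L2 f' ->
    (forall phi, test_fun (disk 1) phi ->
      ip f (if b then d1 phi else d2 phi) = ip f' (if b then d1 phi else d2 phi)) ->
    (forall e : R, 0 < e -> exists phi, test_fun (disk 1) phi /\
      n2 (fun z => (if b then d1 phi else d2 phi) z - f z) < e) -> n2 f <= n2 f'.
  move=> Lf Lf' same app.
  have ff : ip f f = ip f' f.
    apply/eqP; rewrite -subr_eq0 -ipBl//.
    have LB := L2B Lf Lf'; set a := n2 (fun z => f z - f' z).
    apply/negPn/negP => nz; set t := ip _ f in nz.
    have t0 : 0 < `|t| by rewrite normr_gt0.
    have a0 : 0 <= a := n2_ge0 _.
    (* At this precision Cauchy-Schwarz would give [t^2 <= a t^2 / (a + 1) < t^2]. *)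
    have e0 : 0 < t ^+ 2 / (a + 1).
      by rewrite divr_gt0 ?exprn_even_gt0//= ltr_wpDl.
    have [phi [tf small]] := app _ e0.
    have Ld : L2 (if b then d1 phi else d2 phi).
      by case: (b); [exact: test_d1_L2 tf|exact: test_d2_L2 tf].
    set d := (if b then _ else _) in small Ld.
    have dE : ip (fun z => f z - f' z) d = 0.
      by rewrite ipBl// /d same// subrr.
    have tE : t = - ip (fun z => f z - f' z) (fun z => d z - f z).
      by rewrite ipBr// dE sub0r opprK.
    have := ip_le_sqrt LB (L2B Ld Lf); rewrite -normrN -tE => CS.
    have : t ^+ 2 <= a * n2 (fun z => d z - f z).
      rewrite -real_normK ?num_real// -(sqr_sqrtr a0) -[X in _ <= _ * X](sqr_sqrtr (n2_ge0 _)).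
      by rewrite -exprMn lerXn2r ?nnegrE ?mulr_ge0 ?sqrtr_ge0.
    have := n2_ge0 (fun z => d z - f z); move: small.
    rewrite ltr_pdivlMr ?ltr_wpDl//; move: (n2 _) => b'.
    have : 0 < t ^+ 2 by rewrite exprn_even_gt0//=.
    by nra.
  have CS := ip_le_sqrt Lf' Lf; rewrite -ff ipff ger0_norm ?n2_ge0// in CS.
  have [->|nf0] := eqVneq (n2 f) 0; first exact: n2_ge0.
  have f0 : 0 < n2 f by rewrite lt_def nf0 n2_ge0.
  have sf : 0 < Num.sqrt (n2 f) by rewrite sqrtr_gt0.
  rewrite -ler_sqrt ?n2_ge0// -(ler_pM2r sf) -expr2 sqr_sqrtr ?n2_ge0//.
have sub (T : R * R -> R) : test_fun (disk 1) T -> test_fun setT T by exact: test_funS.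
apply: lerD.
  apply: (key true) => // [phi tf|e e0].
    have T1 := sub _ (test_derive true tf).
    have [A _] := weak_gradient_ip wg T1; have [B _] := weak_gradient_ip wg' T1.
    by apply: oppr_inj; rewrite -A -B.
  have [phi [tf _ h _]] := ap e e0; exists phi; split => //.
  exact: (approx_n2 (test_d1_L2 tf) L1).
apply: (key false) => // [phi tf|e e0].
  have T1 := sub _ (test_derive false tf).
  have [_ A] := weak_gradient_ip wg T1; have [_ B] := weak_gradient_ip wg' T1.
  by apply: oppr_inj; rewrite -A -B.
have [phi [tf _ _ h]] := ap e e0; exists phi; split => //.
exact: (approx_n2 (test_d2_L2 tf) L2').
Qed.

(** The C^1 estimate passes to the limit by writing [w] as a test function plus an error small in
    L^2. The constant is [2 * 2 * 2]: from splitting off the error, from the two axis directions,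
    and from comparing the derivatives of the test function with [v]. *)
Lemma increment_bound w v (a : plane R) (r : R) : L2 w -> weak_gradient w v ->
  approximable w v -> `|a.1| <= r -> `|a.2| <= r ->
  (sqint (fun z => w (shift_plane a z) - w z)%R <= (8 * r ^+ 2 * gradE v)%:E)%E.
Proof.
move=> Lw wg ap a1 a2; have [L1 L2'] := weak_gradient_L2 wg.
have r0 : 0 <= r := le_trans (normr_ge0 _) a1.
have [mw _] := Lw.
have msh f : measurable_fun setT f -> measurable_fun setT (fun z : plane R => f (shift_plane a z) : R).
  by move=> mf; exact: (measurableT_comp mf (measurable_shift_plane a)).
apply/lee_addgt0Pr => e e0.
(* Chosen so that the error terms [16 r^2 d + 8 d] below add up to [e]. *)
pose d := e / (16 * r ^+ 2 + 8).
have k0 : 0 < 16 * r ^+ 2 + 8 by rewrite ltr_wpDl// mulr_ge0// sqr_ge0.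
have d0 : 0 < d by rewrite divr_gt0.
have [phi [tf h0 h1 h2]] := ap d d0.
have [C1 C2] := test_isC1 tf; have Lp := test_L2 tf.
have Lp1 := test_d1_L2 tf; have Lp2 := test_d2_L2 tf.
have [mp _] := Lp.
pose g z := w z - phi z.
have mg : measurable_fun setT g by exact: measurable_funB.
have -> : (fun z => w (shift_plane a z) - w z) = (fun z =>
    (phi (shift_plane a z) - phi z) + (g (shift_plane a z) - g z)).
  by apply/funext => z; rewrite /g; ring.
apply: (le_trans (sqintD _ _)).
- by apply: measurable_funB => //; exact: msh.
- by apply: measurable_funB => //; exact: msh.
have gd : (sqint g <= d%:E)%E.
  rewrite -sqintN; apply: ltW; apply: le_lt_trans h0.
  by rewrite le_eqVlt; apply/orP; left; apply/eqP; congr sqint; apply/funext => z; rewrite opprB.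
have B1 : (sqint (fun z => g (shift_plane a z) - g z)%R <= (4 * d)%:E)%E.
  apply: (le_trans (sqintB (msh _ mg) mg)); rewrite (sqint_shift a mg).
  have -> : 4 * d = 2 * d + 2 * d by ring.
  by rewrite (EFinD (2 * d)) (EFinM 2 d); apply: leeD; apply: lee_wpmul2l.
have near (f h : plane R -> R) : L2 f -> L2 h -> (sqint (fun z => f z - h z)%R < d%:E)%E ->
    n2 f <= 2 * d + 2 * n2 h.
  move=> Lf Lh fh; have := n2D2 (L2B Lf Lh) Lh.
  rewrite (_ : (fun z => f z - h z + h z) = f); last by apply/funext => z; rewrite subrK.
  by have := approx_n2 Lf Lh fh; lra.
have n1 := near _ _ Lp1 L1 h1; have n2' := near _ _ Lp2 L2' h2.
have [Q1 _] := isC1_C1dir C1; have [Q2 _] := isC1_C1dir C2.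
have sq (t : R) : `|t| <= r -> t ^+ 2 <= r ^+ 2.
  by move=> tr; rewrite -real_normK ?num_real// lerXn2r ?nnegrE.
have B2 : (sqint (fun z => phi (shift_plane a z) - phi z)%R <=
    (2 * r ^+ 2 * (4 * d + 2 * gradE v))%:E)%E.
  apply: (le_trans (sqint_shift_C1 a Q1 Q2)).
  rewrite !L2_fin// -!EFinM -EFinD lee_fin /gradE.
  have := sq _ a1; have := sq _ a2; have := sqr_ge0 a.1; have := sqr_ge0 a.2.
  have := n2_ge0 (d1 phi); have := n2_ge0 (d2 phi); move: n1 n2'.
  move: (n2 (d1 phi)) (n2 (d2 phi)) (n2 (fst \o v)) (n2 (snd \o v)) => p1 p2 q1 q2.
  move: (a.1 ^+ 2) (a.2 ^+ 2) (r ^+ 2) => A1 A2 RR; nra.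
apply: (@le_trans _ _ ((2 * (2 * r ^+ 2 * (4 * d + 2 * gradE v)) + 2 * (4 * d))%:E)).
  by rewrite (EFinD (2 * _)) (EFinM 2 (4 * d)) (EFinM 2); apply: leeD; apply: lee_wpmul2l.
rewrite -EFinD lee_fin le_eqVlt; apply/orP; left; apply/eqP.
by rewrite /d; field; rewrite gt_eqF.
Qed.

(** The translation by [(2, 0)] moves the unit disk off itself, so [|w|] is bounded by its increment
    wherever it is nonzero; [32 = 8 * 2^2]. *)
Lemma poincare w v : L2 w -> weak_gradient w v -> approximable w v ->
  vanish_off (disk 1) w -> n2 w <= 32 * gradE v.
Proof.
move=> Lw wg ap w0.
have := @increment_bound w v (2, 0) 2 Lw wg ap _ _.
rewrite /= normr0 ger0_norm// => /(_ (lexx _) (ler0n _ _)) H.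
rewrite -lee_fin -L2_fin//.
have -> : 32 * gradE v = 8 * 2 ^+ 2 * gradE v by ring.
apply: le_trans H; apply: sqint_le => z.
have [wz|/eqP wz] := eqVneq (w z) 0; first by rewrite wz normr0.
rewrite (w0 (shift_plane (2, 0) z)) ?sub0r ?normrN// /disk /=.
have z1 : disk 1 z by apply: contrapT => /w0.
have [h1 _] := abs_le_enorm z; have [h2 _] := abs_le_enorm (shift_plane (2, 0) z).
move=> h3; have := le_lt_trans h2 h3; have := le_lt_trans h1 z1.
by rewrite /= !ltr_norml => /andP[? ?] /andP[? ?]; lra.
Qed.

Lemma grad_normE w v : weak_gradient w v -> exists g,
  weak_gradient w g /\ grad_norm w = Num.sqrt (gradE g).
Proof.
move=> wg; exists (grad w); have wgg : weak_gradient w (grad w).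
  by apply: (@xgetPex _ _ [set v | weak_gradient w v]); exists v.
split => //; have [L1 L2'] := weak_gradient_L2 wgg.
rewrite /grad_norm L2norm_sqint.
have -> : sqint (enorm \o grad w) = (gradE (grad w))%:E.
  rewrite /gradE EFinD -!L2_fin// -ge0_integralD//; last 4 first.
  - by move=> z _; rewrite lee_fin sqr_ge0.
  - by apply: measurable_sqr; case: L1.
  - by move=> z _; rewrite lee_fin sqr_ge0.
  - by apply: measurable_sqr; case: L2'.
  by apply: eq_integral => z _; rewrite /= enorm_sqr EFinD.
by rewrite poweR_EFin /= powR12_sqrt// addr_ge0// n2_ge0.
Qed.

End H01Facts.

(** * Boundedness of weakly convergent sequences *)

Section GlidingHump.
Context {R : realType} {X : Type}.
(** [N] plays the part of a norm on the class [H], and [e j] that of a functional of norm at most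
    [4] which is large at [x j]. The growth [40^j] against the weights [20^-j] leaves a factor
    [2^j]. *)
Context (H : set X) (N : X -> R) (e : nat -> X -> R) (x : nat -> X).
Context (N_ge0 : forall y, H y -> 0 <= N y)
  (e_le : forall j y, H y -> `|e j y| <= 4 * N y)
  (Hx : forall j, H (x j))
  (e_ge : forall j, N (x j) / 2 <= `|e j (x j)|)
  (N_big : forall j, 40 ^+ j <= N (x j)).

(* Each sign keeps the value at [x j] of the partial sum at least that of its last
   term [q^j e j (x j)], of order [2^j]; the tail of the series is a small fraction of it. *)
Let q : R := 20^-1.

Let sgn (l : X -> R) j : R :=
  if `|q ^+ j * e j (x j)| <= `|l (x j) + q ^+ j * e j (x j)| then 1 else -1.

Fixpoint hump (n : nat) : X -> R :=
  if n is j.+1 then fun y => hump j y + sgn (hump j) j * q ^+ j * e j y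
  else fun=> 0.

Definition hump_coef (j : nat) : R := sgn (hump j) j * q ^+ j.

Lemma hump_series y : hump ^~ y = series (fun j => hump_coef j * e j y).
Proof.
apply/funext; elim => [|n IH]; first by rewrite /series /= big_geq.
by rewrite /= IH /series /= big_nat_recr.
Qed.

Lemma hump_coef_norm j : `|hump_coef j| = q ^+ j.
Proof.
rewrite normrM [`|q ^+ j|]ger0_norm ?exprn_ge0 ?invr_ge0// /sgn.
by case: ifP => _; rewrite ?normrN normr1 mul1r.
Qed.

(** The exact partial sum of the geometric series is kept so that the induction closes;
    [20 / 19 = 1 / (1 - q)]. *)
Lemma hump_tail y j i : H y ->
  `|hump (j + i) y - hump j y| <= 4 * N y * q ^+ j * (1 - q ^+ i) * (20 / 19).
Proof.
move=> Hy; elim: i => [|i IH]; first by rewrite addn0 subrr normr0 expr0 subrr mulr0 mul0r.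
rewrite addnS /= -/(hump_coef (j + i)) addrAC.
apply: (le_trans (ler_normD _ _)).
have := lerD IH (ler_wpM2l (normr_ge0 (hump_coef (j + i))) (e_le (j + i) Hy)).
rewrite -normrM hump_coef_norm => /le_trans; apply.
rewrite exprD exprS le_eqVlt; apply/orP; left; apply/eqP.
by rewrite /q; field.
Qed.

Lemma hump_tail_le y j i : H y ->
  `|hump (j + i) y - hump j y| <= 4 * N y * q ^+ j * (20 / 19).
Proof.
move=> Hy; apply: (le_trans (hump_tail j i Hy)).
rewrite ler_wpM2r ?divr_ge0// ler_piMr//.
  by rewrite !mulr_ge0 ?N_ge0// exprn_ge0// invr_ge0.
by rewrite lerBlDr lerDl exprn_ge0// invr_ge0.
Qed.

Lemma hump_cvg y : H y -> cvgn (hump ^~ y).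
Proof.
move=> Hy; rewrite hump_series; apply: normed_cvg.
apply: (@series_le_cvg _ _ (fun j => 4 * N y * q ^+ j)) => [j|j|j|].
- exact: normr_ge0.
- by rewrite !mulr_ge0 ?N_ge0// exprn_ge0// invr_ge0.
- by rewrite /= normrM hump_coef_norm mulrC ler_wpM2r ?e_le// exprn_ge0// invr_ge0.
- by apply: is_cvg_geometric_series; rewrite ger0_norm ?invr_ge0// invf_lt1// ltr1n.
Qed.

Lemma hump_lim_tail y j : H y ->
  `|limn (hump ^~ y) - hump j y| <= 4 * N y * q ^+ j * (20 / 19).
Proof.
move=> Hy; have cl := hump_cvg Hy.
have c1 : (fun n => `|hump n y - hump j y|) @ \oo --> `|limn (hump ^~ y) - hump j y|.
  by apply: cvg_norm; apply: cvgB => //; exact: cvg_cst.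
rewrite -(cvg_lim _ c1)//; apply: limr_le; first by apply/cvg_ex; eexists; exact: c1.
near=> n; have jn : (j <= n)%N by near: n; exact: nbhs_infty_ge.
by rewrite -(subnKC jn); exact: hump_tail_le.
Unshelve. all: by end_near. Qed.

Lemma hump_lim_le y : H y -> `|limn (hump ^~ y)| <= 8 * N y.
Proof.
move=> Hy; have := hump_lim_tail 0 Hy; rewrite /= subr0 expr0 mulr1.
by have := N_ge0 Hy; lra.
Qed.

(** At [x j] the partial sum through index [j] is at least [q^j N / 2] and the tail at most
    [(4/19) q^j N]; moreover [1/2 - 4/19 > 1/4] and [q^j N >= 20^-j 40^j = 2^j]. *)
Lemma hump_lim_ge j : 2 ^+ j / 4 <= `|limn (hump ^~ (x j))|.
Proof.
have T := hump_lim_tail j.+1 (Hx j).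
have big : q ^+ j * (N (x j) / 2) <= `|hump j.+1 (x j)|.
  have q0 : 0 <= q ^+ j by rewrite exprn_ge0// invr_ge0.
  apply: (@le_trans _ _ `|q ^+ j * e j (x j)|).
    by rewrite normrM (ger0_norm q0) ler_wpM2l.
  rewrite /= /sgn; case: ifPn => [|]; first by rewrite mul1r.
  (* If [|a + b| < |b|], then [2 |b| <= |a + b| + |a - b|] forces [|a - b| >= |b|], so the negative
     sign works. *)
  rewrite -ltNge mulN1r mulNr; set a := hump j (x j); set b := q ^+ j * _ => ab.
  have := ler_normD (a + b) (- (a - b)); rewrite normrN.
  rewrite (_ : a + b - (a - b) = 2 * b); last by ring.
  by rewrite normrM ger0_norm//; lra.
have N0 := N_ge0 (Hx j).
have qN : 2 ^+ j <= q ^+ j * N (x j).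
  apply: (@le_trans _ _ (q ^+ j * 40 ^+ j)).
    by rewrite -exprMn /q (_ : 20^-1 * 40 = 2 :> R)//; field.
  by rewrite ler_wpM2l// exprn_ge0// invr_ge0.
have := ler_distD (limn (hump ^~ (x j))) (hump j.+1 (x j)) 0.
rewrite !subr0 [X in _ <= X + _]distrC; move: T big qN.
rewrite exprS {1}/q; move: (limn _) (hump _ _) => A B.
have : 0 <= 2 ^+ j :> R by exact: exprn_ge0.
move: (N (x j)) N0 (q ^+ j) (2 ^+ j) => n n0 Q P.
have -> : 4 * n * (20^-1 * Q) * (20 / 19) = Q * n * (4 / 19) by field.
have -> : Q * (n / 2) = (Q * n) / 2 by field.
by move: (Q * n) `|B| `|A - B| `|A| => y b d a; lra.
Qed.

End GlidingHump.

(** * Norming functionals and uniform energy bounds *)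

Section UniformBound.
Local Opaque d1 d2 n2 ip sqint.
Context {R : realType}.
Implicit Types (w phi : R * R -> R) (v : R * R -> R * R).

Definition grad_pair w v phi : R := ip (fst \o v) (d1 phi) + ip (snd \o v) (d2 phi).

(* The pairing of the gradient of [w] with that of [phi], expressed through [w] alone:
   it is linear in [w] without reference to a choice of weak gradient. *)
Definition minus_laplacian_form phi w : R :=
  - (ip w (d1 (d1 phi)) + ip w (d2 (d2 phi))).

Lemma minus_laplacian_formE w v phi : weak_gradient w v -> test_fun setT phi ->
  minus_laplacian_form phi w = grad_pair w v phi.
Proof.
move=> wg tf; rewrite /minus_laplacian_form /grad_pair.
have T1 : test_fun setT (d1 phi) := test_derive true tf.
have T2 : test_fun setT (d2 phi) := test_derive false tf.
have [H1 _] := weak_gradient_ip wg T1; have [_ H2] := weak_gradient_ip wg T2.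
transitivity (- (- ip (fst \o v) (d1 phi) + - ip (snd \o v) (d2 phi))).
  by congr (- (_ + _)); [exact: H1|exact: H2].
by rewrite -opprD opprK.
Qed.

Lemma grad_pair_le w v phi : weak_gradient w v -> test_fun setT phi ->
  `|grad_pair w v phi| <=
    2 * (Num.sqrt (gradE v) * Num.sqrt (n2 (d1 phi) + n2 (d2 phi))).
Proof.
move=> wg tf; have [L1 L2'] := weak_gradient_L2 wg.
have le a b : 0 <= a -> 0 <= b ->
    Num.sqrt a <= Num.sqrt (a + b) /\ Num.sqrt b <= Num.sqrt (a + b) :> R.
  by move=> a0 b0; split; apply: ler_wsqrtr; rewrite ?lerDl ?lerDr.
have [a1 a2] := le _ _ (n2_ge0 (fst \o v)) (n2_ge0 (snd \o v)).
have [b1 b2] := le _ _ (n2_ge0 (d1 phi)) (n2_ge0 (d2 phi)).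
apply: (le_trans (ler_normD _ _)); rewrite mulr_natl mulr2n; apply: lerD.
  apply: (le_trans (ip_le_sqrt L1 (test_d1_L2 tf))).
  exact: ler_pM (sqrtr_ge0 _) (sqrtr_ge0 _) a1 b1.
apply: (le_trans (ip_le_sqrt L2' (test_d2_L2 tf))).
exact: ler_pM (sqrtr_ge0 _) (sqrtr_ge0 _) a2 b2.
Qed.

Lemma minus_laplacian_form_linear phi (a : R) w w' : test_fun setT phi ->
  L2 w -> L2 w' -> minus_laplacian_form phi (fun z => a * w z + w' z) =
  a * minus_laplacian_form phi w + minus_laplacian_form phi w'.
Proof.
move=> tf Lw Lw'; rewrite /minus_laplacian_form.
have T1 : L2 (d1 (d1 phi)) := test_d1_L2 (test_derive true tf).
have T2 : L2 (d2 (d2 phi)) := test_d2_L2 (test_derive false tf).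
have La := L2Z a Lw.
move: (d1 (d1 phi)) (d2 (d2 phi)) T1 T2 => f g Lf Lg.
rewrite (ipDl La Lw' Lf) (ipDl La Lw' Lg) (ipZl a Lw Lf) (ipZl a Lw Lg).
by move: (ip _ _) (ip _ _) (ip _ _) (ip _ _) => *; ring.
Qed.

(** A weak gradient that is also a limit of gradients of test functions, as required for norming by
    test functions; [energy_norm] is built on it. *)
Definition approx_grad w : R * R -> R * R :=
  xget (fun=> 0) [set v | weak_gradient w v /\ approximable w v].

Lemma approx_gradP w : H01 (disk 1) w ->
  weak_gradient w (approx_grad w) /\ approximable w (approx_grad w).
Proof.
move=> /H01_approx[_ [v Hv]].
exact: (@xgetPex _ _ [set v | weak_gradient w v /\ approximable w v] (ex_intro _ v Hv)).
Qed.

Definition energy_norm w : R := Num.sqrt (gradE (approx_grad w)).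

Lemma gradE_ge0 v : 0 <= gradE v.
Proof. by rewrite addr_ge0// n2_ge0. Qed.

Lemma energy_norm_le w : H01 (disk 1) w -> energy_norm w <= grad_norm w.
Proof.
move=> /approx_gradP[wg ap]; have [g [wgg ->]] := grad_normE wg.
by apply: ler_wsqrtr; exact: grad_compare ap wgg.
Qed.

(** [phi] is taken within [N / 4] of [w] in each derivative, where [N] is the energy norm of [w].
    The pairing then loses at most [N * N / 4] per coordinate and stays above [N^2 / 2]; the
    gradient of [phi] has norm at most [2 N], which with the [2] of [grad_pair_le] gives the factor
    [4]. *)
Lemma norming_test w : H01 (disk 1) w -> 0 < energy_norm w -> exists phi,
  [/\ test_fun setT phi,
    forall y, H01 (disk 1) y ->
      `|minus_laplacian_form phi y / energy_norm w| <= 4 * energy_norm y &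
    energy_norm w / 2 <= `|minus_laplacian_form phi w / energy_norm w|].
Proof.
move=> Hw; have [wg ap] := approx_gradP Hw; have [L1 L2'] := weak_gradient_L2 wg.
set v := approx_grad w in wg ap L1 L2'; set N := energy_norm w => N0.
have N2 : N ^+ 2 = gradE v by rewrite sqr_sqrtr// gradE_ge0.
have e0 : 0 < N ^+ 2 / 16 by rewrite divr_gt0// exprn_gt0.
have [phi [tf _ h1 h2]] := ap _ e0.
have tfT : test_fun setT phi by exact: test_funS tf.
have T1 := test_d1_L2 tf; have T2 := test_d2_L2 tf.
have k1 := approx_n2 T1 L1 h1; have k2 := approx_n2 T2 L2' h2.
exists phi; split => // [y Hy|].
  have [wgy _] := approx_gradP Hy.
  rewrite (minus_laplacian_formE wgy tfT) normrM normfV (gtr0_norm N0) ler_pdivrMr//.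
  apply: (le_trans (grad_pair_le wgy tfT)).
  have -> : 4 * energy_norm y * N = 2 * (energy_norm y * (2 * N)) by ring.
  rewrite ler_pM2l// ler_wpM2l ?sqrtr_ge0//.
  rewrite -[leRHS](gtr0_norm _) ?mulr_gt0// -sqrtr_sqr; apply: ler_wsqrtr.
  have near (f g : plane R -> R) : L2 f -> L2 g -> n2 (fun z => f z - g z) < N ^+ 2 / 16 ->
      n2 f <= N ^+ 2 / 8 + 2 * n2 g.
    move=> Lf Lg fg; have := n2D2 (L2B Lf Lg) Lg.
    by rewrite (_ : (fun z => f z - g z + g z) = f); [lra|apply/funext => z; rewrite subrK].
  have sum4 (p1 p2 a b S : R) : S = a + b -> p1 <= S / 8 + 2 * a ->
      p2 <= S / 8 + 2 * b -> 0 <= a -> 0 <= b -> p1 + p2 <= 2 ^+ 2 * S by nra.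
  rewrite exprMn.
  exact: (sum4 _ _ _ _ _ N2 (near _ _ T1 L1 k1) (near _ _ T2 L2' k2) (n2_ge0 _) (n2_ge0 _)).
rewrite (minus_laplacian_formE wg tfT) normrM normfV (gtr0_norm N0) ler_pdivlMr//.
have near (f g : plane R -> R) : L2 f -> L2 g -> n2 g <= N ^+ 2 ->
    n2 (fun z => f z - g z) < N ^+ 2 / 16 -> n2 g - N ^+ 2 / 4 <= ip g f.
  move=> Lf Lg gN fg.
  have E : ip g f = n2 g + ip g (fun z => f z - g z) by rewrite ipBr// ipff addrC subrK.
  have := ip_le_sqrt Lg (L2B Lf Lg).
  have s1 : Num.sqrt (n2 g) <= N.
    by rewrite -[leRHS](gtr0_norm N0) -sqrtr_sqr; exact: ler_wsqrtr.
  have s2 : Num.sqrt (n2 (fun z => f z - g z)) <= N / 4.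
    rewrite -[leRHS](@gtr0_norm _ (N / 4)) ?divr_gt0// -sqrtr_sqr; apply: ler_wsqrtr.
    by rewrite expr_div_n; apply/ltW; rewrite (_ : 4 ^+ 2 = 16)//; ring.
  have := ler_pM (sqrtr_ge0 _) (sqrtr_ge0 _) s1 s2.
  rewrite E ler_norml; move: (Num.sqrt _ * _) => q qN /andP[q1 _].
  have -> : N ^+ 2 / 4 = N * (N / 4) by rewrite expr2 mulrA.
  by rewrite lerD2l lerNl; rewrite lerNl in q1; exact: le_trans q1 qN.
apply: le_trans (ler_norm _); rewrite /grad_pair mulrAC -expr2.
have leN (a b : R) : N ^+ 2 = a + b -> 0 <= a -> 0 <= b -> a <= N ^+ 2 /\ b <= N ^+ 2.
  by move=> ->; split; lra.
have [l1 l2] := leN _ _ N2 (n2_ge0 _) (n2_ge0 _).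
have sum2 (p1 p2 a b : R) : N ^+ 2 = a + b -> a - N ^+ 2 / 4 <= p1 ->
    b - N ^+ 2 / 4 <= p2 -> N ^+ 2 / 2 <= p1 + p2.
  by move=> *; lra.
exact: (sum2 _ _ _ _ N2 (near _ _ T1 L1 l1 k1) (near _ _ T2 L2' l2 k2)).
Qed.

(** If the energies were unbounded, terms of size at least [40^j] could be selected. The limit of
    the humps built on them is a bounded functional, so its values along the sequence converge and
    stay bounded, against the lower bounds [2^j / 4]. *)
Lemma weakly_cvg0_bounded (w : nat -> R * R -> R) : weakly_cvg0 (disk 1) w ->
  exists M : R, forall k, energy_norm (w k) <= M.
Proof.
move=> [Hw wc]; apply: contrapT => unb.
have big j : exists k, 40 ^+ j <= energy_norm (w k).
  apply: contrapT => nk; apply: unb; exists (40 ^+ j) => k.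
  by rewrite leNgt; apply/negP => h; apply: nk; exists k; exact: ltW.
have [k kbig] := choice big.
pose x j := w (k j).
have N0 j : 0 < energy_norm (x j) by rewrite (lt_le_trans _ (kbig j))// exprn_gt0.
have [phi Hphi] := choice (fun j => norming_test (Hw (k j)) (N0 j)).
pose e j y := minus_laplacian_form (phi j) y / energy_norm (x j).
have e_le j y : H01 (disk 1) y -> `|e j y| <= 4 * energy_norm y.
  by have [_ h _] := Hphi j; exact: h.
have e_ge j : energy_norm (x j) / 2 <= `|e j (x j)| by have [_ _] := Hphi j.
have Nge y : H01 (disk 1) y -> 0 <= energy_norm y by move=> _; exact: sqrtr_ge0.
pose l y := limn (hump e x ^~ y).
have hc (y : R * R -> R) (Hy : H01 (disk 1) y) := hump_cvg (x := x) Nge e_le Hy.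
have lin (a : R) y y' n : H01 (disk 1) y -> H01 (disk 1) y' ->
    hump e x n (fun z => a * y z + y' z) = a * hump e x n y + hump e x n y'.
  move=> /H01_approx[Ly _] /H01_approx[Ly' _].
  elim: n => [|n IH] /=; first by rewrite mulr0 addr0.
  have [tf _ _] := Hphi n.
  have eE : e n (fun z => a * y z + y' z) = a * e n y + e n y'.
    by rewrite /e (minus_laplacian_form_linear a tf Ly Ly') mulrDl -mulrA.
  by rewrite IH eE mulrDr mulrCA addrACA -mulrDr.
have dual : H01_dual (disk 1) l.
  split.
    move=> a y y' Hy Hy'; rewrite /l; apply/cvg_lim => //.
    rewrite (_ : hump e x ^~ _ = (fun n => a * hump e x n y + hump e x n y')).
      by apply: cvgD; [apply: cvgMr; exact: hc|exact: hc].
    by apply/funext => n; exact: lin.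
  exists 8 => y Hy; apply: (le_trans (@hump_lim_le _ _ _ _ _ x Nge e_le y Hy)).
  by rewrite ler_pM2l// energy_norm_le.
have /cvg_seq_bounded/pinfty_ex_gt0[K K0 lK] : cvgn (fun n => l (w n)).
  by apply/cvg_ex; exists 0; exact: wc.
have ge j : 2 ^+ j / 4 <= K.
  apply: le_trans (hump_lim_ge Nge e_le (fun j => Hw (k j)) e_ge kbig j) _.
  exact: lK.
have := ge (Num.truncn (4 * K)).
rewrite ler_pdivrMr// leNgt => /negP; apply.
have := truncnS_gt (4 * K); rewrite mulrC => /lt_le_trans; apply.
by rewrite -natrX ler_nat; exact: ltn_expl.
Qed.

End UniformBound.

(** * Level sets and energy *)

Section LevelSetSum.
Context {R : realType}.
Implicit Types (w phi D : R * R -> R) (v : R * R -> R * R) (z : R * R).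

(* A smooth substitute for truncation at level [2^i]: it is at least [1/4] where
   [|phi|] exceeds [(3/4) 2^i], and the squares of the rescaled derivatives add up
   to a bounded quantity over [i]. *)
Definition soft_level (i : nat) phi z : R :=
  phi z * phi z * (4 ^+ i + phi z * phi z)^-1.

(** The derivative of [p^2 / (4^i + p^2)]. *)
Definition soft_slope (i : nat) (p : R) : R :=
  2 * 4 ^+ i * p / (4 ^+ i + p ^+ 2) ^+ 2.

Lemma soft_level_isC1 i e phi D : isC1 e phi D ->
  isC1 e (soft_level i phi) (fun z => soft_slope i (phi z) * D z).
Proof.
move=> C; have k0 : 0 < 4 ^+ i :> R by exact: exprn_gt0.
have P := isC1M C C.
have Q := isC1D (isC1_cst e (4 ^+ i)) P.
have g0 z : 0 < 4 ^+ i + phi z * phi z.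
  by rewrite ltr_pwDl// -expr2 sqr_ge0.
have := isC1M P (isC1V (fun z => lt0r_neq0 (g0 z)) Q).
rewrite /soft_level; congr isC1; apply/funext => z; rewrite /soft_slope.
by field; rewrite gt_eqF// expr2.
Qed.

(** Each term is dominated by a telescoping difference [a i - a (i + 1)] with [0 <= a <= 1]. As
    [a i - a (i + 1)] has numerator [(3/4) 4^i p^2], the factor [16 / 3] produces the numerator
    [4 * 4^i p^2] of the squared slope. *)
Lemma soft_slope_sum N p : \sum_(i < N) 4 ^+ i * soft_slope i p ^+ 2 <= 16 / 3.
Proof.
pose a i := p ^+ 2 / (4 ^+ i / 4 + p ^+ 2).
have k0 i : 0 < 4 ^+ i :> R by exact: exprn_gt0.
have p0 := sqr_ge0 p.
have a0 i : 0 <= a i <= 1.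
  have h : 0 < 4 ^+ i / 4 + p ^+ 2 by rewrite ltr_pwDl// divr_gt0.
  rewrite divr_ge0 ?(ltW h)//= ler_pdivrMr// mul1r lerDr.
  by rewrite divr_ge0// ltW.
have step i : 4 ^+ i * soft_slope i p ^+ 2 <= 16 / 3 * (a i - a i.+1).
  rewrite /a /soft_slope (exprS 4 i); have := k0 i; move: (4 ^+ i) => L L0.
  have h1 : 0 < L / 4 + p ^+ 2 by rewrite ltr_pwDl// divr_gt0.
  have h2 : 0 < L + p ^+ 2 by rewrite ltr_pwDl.
  have -> : 4 * L / 4 + p ^+ 2 = L + p ^+ 2 by field.
  have -> : L * (2 * L * p / (L + p ^+ 2) ^+ 2) ^+ 2 =
      (4 * (p ^+ 2) * L) * (L ^+ 2 / (L + p ^+ 2) ^+ 4).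
    by field; rewrite gt_eqF.
  have -> : 16 / 3 * (p ^+ 2 / (L / 4 + p ^+ 2) - p ^+ 2 / (L + p ^+ 2)) =
      (4 * (p ^+ 2) * L) * ((L / 4 + p ^+ 2)^-1 * (L + p ^+ 2)^-1).
    by field; rewrite !gt_eqF//; move: h1 h2; lra.
  apply: ler_wpM2l; first by apply: mulr_ge0; [exact: mulr_ge0|exact: ltW].
  rewrite ler_pdivrMr; last exact: exprn_gt0.
  move: (p ^+ 2) p0 h1 h2 => P P0 h1 h2.
  have -> : (L / 4 + P)^-1 * (L + P)^-1 * (L + P) ^+ 4 = (L + P) ^+ 3 / (L / 4 + P).
    by field; rewrite !gt_eqF//; lra.
  rewrite ler_pdivlMr// -subr_ge0.
  have -> : (L + P) ^+ 3 - L ^+ 2 * (L / 4 + P) =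
      3 / 4 * L ^+ 3 + 2 * L ^+ 2 * P + 3 * L * P ^+ 2 + P ^+ 3 by field.
  by rewrite !addr_ge0// !mulr_ge0 ?exprn_ge0// ?invr_ge0// ltW.
apply: (@le_trans _ _ (\sum_(i < N) 16 / 3 * (a i - a i.+1))).
  by apply: ler_sum => i _; exact: step.
rewrite -mulr_sumr -[leRHS]mulr1 ler_pM2l ?divr_gt0//.
rewrite -(big_mkord xpredT (fun i => a i - a i.+1)).
rewrite (@telescope_sumr_eq _ 0 N (fun i => - a i))//; last first.
  by move=> i _; rewrite opprK addrC.
by have := a0 0; have := a0 N; lra.
Qed.

Lemma soft_energy_sum N phi D : continuous phi -> continuous D ->
  (\sum_(i < N) (4 ^+ i)%:E * sqint (fun z => soft_slope i (phi z) * D z)%R <=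
   (16 / 3)%:E * sqint D)%E.
Proof.
move=> cphi cD.
have mp := continuous_measurable_plane cphi; have mD := continuous_measurable_plane cD.
have ms i : measurable_fun setT (fun z : plane R => soft_slope i (phi z) * D z).
  apply: measurable_funM => //; apply: continuous_measurable_plane => z.
  have c1 : (fun z => 2 * 4 ^+ i * phi z) @ z --> 2 * 4 ^+ i * phi z.
    by apply: cvgM; [exact: cvg_cst|exact: cphi].
  have c2 : (fun z => 4 ^+ i + phi z ^+ 2) @ z --> 4 ^+ i + phi z ^+ 2.
    by apply: cvgD; [exact: cvg_cst|exact: cvgM (cphi z) (cphi z)].
  apply: cvgM c1 _; apply: cvgV; last exact: (cvgM c2 c2).
  by rewrite expf_neq0// gt_eqF// ltr_pwDl// ?exprn_gt0 ?sqr_ge0.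
have k0 i : 0 <= 4 ^+ i :> R by exact: exprn_ge0.
under eq_bigr => i _.
  rewrite -ge0_integralZl_EFin//; [|by move=> z _; rewrite lee_fin sqr_ge0|exact: measurable_sqr (ms i)].
  over.
rewrite -ge0_integral_sum//; last 2 first.
- by move=> i; apply: measurable_funeM; exact: measurable_sqr (ms i).
- by move=> i z _; rewrite -EFinM lee_fin mulr_ge0// sqr_ge0.
rewrite -ge0_integralZl_EFin//; last 2 first.
- by move=> z _; rewrite lee_fin sqr_ge0.
- exact: measurable_sqr mD.
apply: ge0_le_integral_nm => z _.
  by apply: sume_ge0 => i _; rewrite -EFinM lee_fin mulr_ge0// sqr_ge0.
under eq_bigr do rewrite -EFinM.
rewrite sumEFin -EFinM lee_fin.
under eq_bigr do rewrite exprMn mulrA.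
by rewrite -mulr_suml ler_wpM2r ?sqr_ge0// soft_slope_sum.
Qed.

Lemma measurable_level (f : plane R -> R) (c : R) : measurable_fun setT f ->
  measurable [set z : plane R | c < `|f z|].
Proof.
move=> mf; rewrite -[X in measurable X]setTI.
have -> : [set z : plane R | c < `|f z|] = (fun z => `|f z|) @^-1` [set` `]c, +oo[].
  by apply/seteqP; split => z /=; rewrite in_itv /= andbT.
by apply: (measurableT_comp _ mf) => //; exact: measurable_itv.
Qed.

Lemma chebyshev_sqr (f : plane R -> R) (c : R) : measurable_fun setT f -> 0 < c ->
  ((c ^+ 2)%:E * leb2 [set z | (c < `|f z|)%R] <= sqint f)%E.
Proof.
move=> mf c0; have mS := measurable_level c mf.
rewrite -integral_cst// integral_mkcond; apply: ge0_le_integral_nm => z _; rewrite patchE.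
  by case: ifPn => // _; rewrite lee_fin sqr_ge0.
case: ifPn => [/set_mem /= h|_]; last by rewrite lee_fin sqr_ge0.
rewrite lee_fin -[leRHS]real_normK ?num_real// lerXn2r ?nnegrE ?(ltW c0)//.
exact: ltW.
Qed.

Definition level_measure (u : plane R -> R) (s : R) : R :=
  fine (leb2 [set z | s < `|u z|]).

End LevelSetSum.

Section LevelSetBound.
Context {R : realType}.
Implicit Types (w : R * R -> R) (v : R * R -> R * R).

Lemma level_measureE w (s : R) : 1 <= s ->
  measurable_fun setT (w : plane R -> R) ->
  (leb2 [set z : plane R | (1 < `|w z|)%R] <= 1%:E)%E ->
  leb2 [set z : plane R | s < `|w z|] = (level_measure w s)%:E /\
  0 <= level_measure w s <= 1.
Proof.
move=> s1 mw le1.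
have le : (leb2 [set z : plane R | (s < `|w z|)%R] <= 1%:E)%E.
  apply: le_trans le1; apply: le_measure; rewrite ?inE; try exact: measurable_level.
  by move=> z /=; exact: le_lt_trans.
have E : leb2 [set z : plane R | s < `|w z|] = (level_measure w s)%:E.
  by rewrite fineK// ge0_fin_numE// (le_lt_trans le)// ltry.
by split => //; rewrite -!lee_fin -E le andbT.
Qed.

(** Allows one test function to serve all levels below [N]: at this precision the approximation
    spoils at most half of each nonnegligible level set. *)
Lemma common_precision (m : nat -> R) N :
  exists e : R, [/\ 0 < e, e <= 1 & forall i, (i < N)%N -> 0 < m i -> 32 * e <= m i].
Proof.
elim: N => [|N [e [e0 e1 H]]]; first by exists 1.
have [mN|mN] := ltP 0 (m N); last first.
  exists e; split => // i; rewrite ltnS leq_eqVlt => /predU1P[->|/H//].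
  by rewrite ltNge mN.
exists (Num.min e (m N / 32)); split.
- by rewrite lt_min e0 divr_gt0.
- by rewrite ge_min e1.
move=> i; rewrite ltnS leq_eqVlt => /predU1P[-> _|iN mi].
  by rewrite mulrC -ler_pdivlMr// ge_min lexx orbT.
apply: le_trans (H _ iN mi); rewrite ler_pM2l// ge_min lexx //.
Qed.

(** Halving the measure costs at most [ln 2 <= 1 <= 1 - ln m]. *)
Lemma ln_half_le (m m' : R) : 0 < m -> m <= 1 -> m / 2 <= m' ->
  1 - ln m' <= 2 * (1 - ln m).
Proof.
move=> m0 m1 mm'.
have h0 : 0 < m / 2 by rewrite divr_gt0.
have : ln (m / 2) <= ln m' by rewrite ler_ln ?posrE ?(lt_le_trans h0).
rewrite ln_div ?posrE//.
have : ln 2 <= 1 :> R.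
  have := @le_ln1Dx R 1; rewrite (_ : 1 + 1 = 2 :> R)//.
  by apply; lra.
by have := ln_le0 m1; lra.
Qed.

Lemma ln_expR1_div (m : R) : 0 < m -> ln (expR 1 / m) = 1 - ln m.
Proof. by move=> m0; rewrite ln_div ?posrE ?expR_gt0// expRK. Qed.

(* The term of index [i] is [0] if the level set is negligible, as [ln (e / 0) = ln 0 = 0]. *)
Lemma level_sum w v N : L2 w -> weak_gradient w v -> approximable w v ->
  vanish_off (disk 1) w ->
  (leb2 [set z : plane R | (1 < `|w z|)%R] <= 1%:E)%E ->
  \sum_(i < N) 4 ^+ i / ln (expR 1 / level_measure w (2 ^+ i)) <=
    72 * 72 * (16 / 3) * (2 * gradE v + 4).
Proof.
move=> Lw wg ap w0 le1; have [mw _] := Lw.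
pose m i := level_measure w (2 ^+ i).
have p2 i : 1 <= 2 ^+ i :> R by rewrite exprn_ege1// ler1n.
have mP i := level_measureE (p2 i) mw le1.
have [e [e0 e1 He]] := common_precision m N.
have [phi [tf h0 h1 h2]] := ap e e0.
have [L1 L2'] := weak_gradient_L2 wg.
have Lp := test_L2 tf; have [mp _] := Lp.
have T1 := test_d1_L2 tf; have T2 := test_d2_L2 tf.
have [C1 C2] := test_isC1 tf.
have vp : vanish_off (cbox 1) phi by apply: (test_vanish tf); exact: disk_cbox.
move: (d1 phi) (d2 phi) h1 h2 T1 T2 C1 C2 => D1 D2 h1 h2 T1 T2 C1 C2.
have [cp cD1 _] := C1; have [_ cD2 _] := C2.
have vD1 : vanish_off (cbox 1) D1 by rewrite -(isC1_C1dir C1).2; exact: vanish_derive.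
have vD2 : vanish_off (cbox 1) D2 by rewrite -(isC1_C1dir C2).2; exact: vanish_derive.
pose S1 i z := soft_slope i (phi z) * D1 z.
pose S2 i z := soft_slope i (phi z) * D2 z.
have SL2 i D : isC1 ((1, 0) : R * R) phi D \/ isC1 ((0, 1) : R * R) phi D ->
    vanish_off (cbox 1) D -> L2 (fun z => soft_slope i (phi z) * D z).
  move=> CD vD; apply: (continuous_L2 ler01); last by move=> z /vD ->; rewrite mulr0.
  by case: CD => /(soft_level_isC1 i)[].
have LS1 i : L2 (S1 i) by apply: SL2 => //; left.
have LS2 i : L2 (S2 i) by apply: SL2 => //; right.
(* Capacity of the part of the level set where the approximation is good; [72 * 72 = 2 * 2592], the
   factor [2] coming from [ln_half_le]. *)
have term i : (i < N)%N -> 4 ^+ i / ln (expR 1 / m i) <=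
    72 * 72 * (4 ^+ i * (n2 (S1 i) + n2 (S2 i))).
  move=> iN; have [Fm /andP[m0 m1]] := mP i; rewrite -/(m i) in Fm m0 m1.
  have rhs0 : 0 <= 72 * 72 * (4 ^+ i * (n2 (S1 i) + n2 (S2 i))).
    by rewrite !mulr_ge0 ?exprn_ge0// addr_ge0// n2_ge0.
  move: m0; rewrite le_eqVlt => /predU1P[m0|m0].
    by rewrite -m0 invr0 mulr0 (@ln0 _ 0)// invr0 mulr0.
  rewrite ln_expR1_div//; have l1 : 1 <= 1 - ln (m i) by have := ln_le0 m1; lra.
  set s := 2 ^+ i in Fm; have s0 : 0 < s by rewrite exprn_gt0.
  pose F := [set z : plane R | s < `|w z|].
  pose B := [set z : plane R | s / 4 < `|phi z - w z|].
  have mF : measurable F by exact: measurable_level.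
  have mB : measurable B by apply: measurable_level; exact: measurable_funB.
  have mG : measurable (F `\` B) by exact: measurableD.
  (* Chebyshev at height [s / 4 >= 1/4] gives [leb2 B <= 16 e], and [32 e <= m i]. *)
  have Bsmall : (leb2 B <= (m i / 2)%:E)%E.
    have ch := chebyshev_sqr (measurable_funB mp mw) (divr_gt0 s0 (ltr0n _ 4)).
    have : (16^-1%:E * leb2 B <= e%:E)%E.
      apply: le_trans (ltW h0); apply: le_trans ch.
      apply: lee_wpmul2r => //; rewrite lee_fin expr_div_n.
      rewrite (_ : 4 ^+ 2 = 16 :> R); last by rewrite -natrX.
      rewrite ler_peMl ?invr_ge0// exprn_ege1// p2 //.
    have := He i iN m0; case: (leb2 B) => [b| |] //=.
      by rewrite -EFinM !lee_fin; lra.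
      by rewrite gt0_muley ?lte_fin ?invr_gt0.
    by rewrite leNye.
  have Gfin : (leb2 (F `\` B) <= (m i)%:E)%E.
    by rewrite -Fm; apply: le_measure; rewrite ?inE//; exact: subDsetl.
  have GE : leb2 (F `\` B) = (fine (leb2 (F `\` B)))%:E.
    by rewrite fineK// ge0_fin_numE// (le_lt_trans Gfin)// ltry.
  set m' := fine _ in GE.
  have m'1 : m' <= 1 by rewrite -lee_fin -GE (le_trans Gfin)// lee_fin.
  have mm' : m i / 2 <= m'.
    have ED : leb2 F = (leb2 (F `\` B) + leb2 (F `&` B))%E := measureDI leb2 mF mB.
    have IB : (leb2 (F `&` B) <= (m i / 2)%:E)%E.
      by apply: (le_trans _ Bsmall); apply: le_measure; rewrite ?inE//; exact: measurableI.
    move: ED IB (measure_ge0 leb2 (F `&` B)); rewrite [leb2 F]Fm GE; case: (leb2 _) => [b| |]//.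
    by rewrite -EFinD !lee_fin => -[->] ? ?; lra.
  have m'0 : 0 < m' by rewrite (lt_le_trans _ mm')// divr_gt0.
  (* Here [|phi| >= (3/4) s], so the soft level is at least [(9/16) / (1 + 9/16) = 9/25]. *)
  have quarter z : (F `\` B) z -> 4^-1 <= soft_level i phi z.
    move=> [/= Fz /negP]; rewrite -leNgt => Bz.
    have fz : 3 / 4 * s <= `|phi z|.
      have arith (a b c t : R) : t < a -> c <= t / 4 -> a <= c + b -> 3 / 4 * t <= b by lra.
      apply: (arith _ _ _ _ Fz Bz).
      by have := ler_distD (phi z) (w z) 0; rewrite !subr0 [X in _ <= X + _]distrC.
    have fz2 : 9 / 16 * s ^+ 2 <= phi z ^+ 2.
      by rewrite -[leRHS]real_normK ?num_real//; have := normr_ge0 (phi z); nra.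
    rewrite /soft_level -expr2.
    have <- : s ^+ 2 = 4 ^+ i by rewrite /s exprAC -natrX.
    have q0 : 0 < s ^+ 2 + phi z ^+ 2 by apply: ltr_pwDl; [exact: exprn_gt0|exact: sqr_ge0].
    rewrite ler_pdivlMr//; move: fz2 (sqr_ge0 s); move: (s ^+ 2) (phi z ^+ 2) => a b; lra.
  have soft0 z : 0 <= soft_level i phi z.
    rewrite /soft_level -expr2; apply: divr_ge0; first exact: sqr_ge0.
    by apply: addr_ge0; [exact: exprn_ge0|exact: sqr_ge0].
  have E12 : (sqint (S1 i) + sqint (S2 i) <= (n2 (S1 i) + n2 (S2 i))%:E)%E.
    by rewrite EFinD -!L2_fin.
  have sub : F `\` B `<=` cbox 1.
    move=> z [/= Fz _]; apply: disk_cbox; apply: contrapT => /w0 wz.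
    have : s < `|0 : R| by rewrite -wz; exact: Fz.
    by rewrite normr0 ltNge (ltW s0).
  have van : vanish_off (cbox 1) (soft_level i phi).
    by move=> z /vp pz; rewrite /soft_level pz !mul0r.
  have arith (E l l' k : R) : 0 <= E -> 0 <= k -> l' <= 2 * l ->
      1 <= 2592 * E * l' -> k <= 72 * 72 * (k * E) * l.
    move=> E0 k0 ll' cap; have : 1 <= 72 * 72 * E * l.
      by apply: (le_trans cap); have := ler_wpM2l E0 ll'; lra.
    by move=> /(ler_wpM2l k0); lra.
  have cap := capacity_bound (soft_level_isC1 i C1) (soft_level_isC1 i C2) van soft0
    mG sub quarter GE m'0 m'1 E12.
  have n0 : 0 <= n2 (S1 i) + n2 (S2 i) by rewrite addr_ge0// n2_ge0.
  rewrite ler_pdivrMr; last lra.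
  exact: arith n0 (exprn_ge0 i (ler0n R 4)) (ln_half_le m0 m1 mm') cap.
apply: (@le_trans _ _ (\sum_(i < N) 72 * 72 * (4 ^+ i * (n2 (S1 i) + n2 (S2 i))))).
  by apply: ler_sum => i _; exact: term.
have sumS (D : R * R -> R) : continuous D -> L2 D ->
    (forall i, L2 (fun z => soft_slope i (phi z) * D z)) ->
    \sum_(i < N) 4 ^+ i * n2 (fun z => soft_slope i (phi z) * D z) <= 16 / 3 * n2 D.
  move=> cD LD LS; rewrite -lee_fin EFinM -L2_fin// -sumEFin.
  under eq_bigr do rewrite EFinM -L2_fin//.
  exact: soft_energy_sum.
have := sumS _ cD1 T1 LS1; have := sumS _ cD2 T2 LS2.
rewrite -mulr_sumr.
have -> : \sum_(i < N) 4 ^+ i * (n2 (S1 i) + n2 (S2 i)) =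
    \sum_(i < N) 4 ^+ i * n2 (S1 i) + \sum_(i < N) 4 ^+ i * n2 (S2 i).
  by rewrite -big_split; apply: eq_bigr => i _; rewrite mulrDr.
have near (f h : plane R -> R) : L2 f -> L2 h -> (sqint (fun z => f z - h z)%R < e%:E)%E ->
    n2 f <= 2 * e + 2 * n2 h.
  move=> Lf Lh fh; have := n2D2 (L2B Lf Lh) Lh.
  rewrite (_ : (fun z => f z - h z + h z) = f); last by apply/funext => z; rewrite subrK.
  by have := approx_n2 Lf Lh fh; lra.
have := near _ _ T1 L1 h1; have := near _ _ T2 L2' h2; rewrite /gradE /S1 /S2.
by move: (n2 _) (n2 _) (n2 _) (n2 _) (\sum_(i < N) _) (\sum_(i < N) _) => *; lra.
Qed.

End LevelSetBound.

(** * Decay of level sets under D-weak convergence *)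

Section ComplexPower.
Context {R : realType}.
Implicit Types z : R * R.

Lemma enormD z z' : enorm (z + z') <= enorm z + enorm z'.
Proof.
have := ler_normD (Complex z.1 z.2 : R[i]) (Complex z'.1 z'.2).
by rewrite /Num.norm /=; simpc => /andP[_].
Qed.

Lemma enormN z : enorm (- z) = enorm z.
Proof. by rewrite /enorm /= !sqrrN. Qed.

Lemma cpowS z j : cpow z j.+1 = (z.1 * (cpow z j).1 - z.2 * (cpow z j).2,
  z.1 * (cpow z j).2 + z.2 * (cpow z j).1).
Proof. by rewrite /cpow exprS; case: (_ ^+ j) => a b. Qed.

Lemma cpow1 z : cpow z 1 = z.
Proof. by case: z => x y; rewrite /cpow expr1. Qed.

Lemma enorm_cpow z j : enorm (cpow z j) = enorm z ^+ j.
Proof.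
elim: j => [|j IH].
  by rewrite expr0 /cpow expr0 /enorm /= expr1n expr0n addr0 sqrtr1.
rewrite exprS -IH /enorm -sqrtrM ?addr_ge0 ?sqr_ge0// cpowS /=.
by congr Num.sqrt; ring.
Qed.

Lemma continuous_cpow j : continuous (fun z => (cpow z j).1) /\ continuous (fun z => (cpow z j).2).
Proof.
elim: j => [|j [IH1 IH2]].
  by split; [apply: (@cst_continuous _ _ (1 : R))|apply: (@cst_continuous _ _ (0 : R))].
have -> : (fun z => (cpow z j.+1).1) = (fun z => z.1 * (cpow z j).1 - z.2 * (cpow z j).2).
  by apply/funext => z; rewrite cpowS.
have -> : (fun z => (cpow z j.+1).2) = (fun z => z.1 * (cpow z j).2 + z.2 * (cpow z j).1).
  by apply/funext => z; rewrite cpowS.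
split=> z.
  by apply: cvgB; apply: cvgM; [exact: cvg_fst|exact: IH1|exact: cvg_snd|exact: IH2].
by apply: cvgD; apply: cvgM; [exact: cvg_fst|exact: IH2|exact: cvg_snd|exact: IH1].
Qed.

Lemma measurable_cpow j : measurable_fun setT (fun z : plane R => cpow z j : plane R).
Proof.
have [c1 c2] := continuous_cpow j.
have := measurable_fun_pair (continuous_measurable_plane c1) (continuous_measurable_plane c2).
by apply: eq_measurable_fun => z _; case: (cpow z j).
Qed.

End ComplexPower.

(** * The mean over the half disk as a bounded functional *)

Section MeanFunctional.
Context {R : realType}.

(** The radius [1/2] makes [|z^j| <= 2^-j] on the support. *)
Definition half_disk_ind : plane R -> R := \1_(disk 2^-1).

Lemma leb2_half_disk : exists a : R,
  [/\ leb2 (disk 2^-1 : set (plane R)) = a%:E, 4^-1 <= a & a <= 1].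
Proof.
have mD := measurable_disk (2^-1 : R); have mC := measurable_cbox (R := R).
have up : (leb2 (disk 2^-1 : set (plane R)) <= 1%:E)%E.
  apply: (@le_trans _ _ (leb2 (cbox 2^-1 : set (plane R)))).
    by apply: le_measure; rewrite ?inE//; exact: disk_cbox.
  by rewrite leb2_cbox ?invr_ge0// divff// expr1n.
have lo : (4^-1%:E <= leb2 (disk 2^-1 : set (plane R)))%E.
  apply: (@le_trans _ _ (leb2 (cbox 4^-1 : set (plane R)))).
    by rewrite leb2_cbox ?invr_ge0// lee_fin; lra.
  apply: le_measure; rewrite ?inE// => z [z1 z2] /=.
  rewrite /disk /= /enorm -[ltRHS](@ger0_norm _ 2^-1) ?invr_ge0// -sqrtr_sqr ltr_sqrt; last lra.
  have sq (t : R) : `|t| <= 4^-1 -> t ^+ 2 <= 16^-1.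
    move=> t4; rewrite -real_normK ?num_real//.
    by have := normr_ge0 t; nra.
  by have := sq _ z1; have := sq _ z2; lra.
exists (fine (leb2 (disk 2^-1 : set (plane R)))).
have E : leb2 (disk 2^-1 : set (plane R)) = (fine (leb2 (disk 2^-1 : set (plane R))))%:E.
  by rewrite fineK// ge0_fin_numE// (le_lt_trans up)// ltry.
by split => //; rewrite -lee_fin -E.
Qed.

Lemma half_disk_ind_L2 : L2 half_disk_ind /\ n2 half_disk_ind <= 1.
Proof.
have mD := measurable_disk (2^-1 : R).
have [a [aE _ a1]] := leb2_half_disk.
have E : sqint half_disk_ind = a%:E.
  rewrite -aE -[in RHS](setIT (disk _)) -integral_indic//; apply: eq_integral => z _.
  by rewrite /half_disk_ind indicE; case: (_ \in _); rewrite ?expr1n ?expr0n.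
have L : L2 half_disk_ind.
  by split; [exact: measurable_indic|rewrite E ltry].
by split => //; rewrite /n2 E.
Qed.

Definition mean_form (w : R * R -> R) : R := ip w half_disk_ind.

Lemma H01_vanish (Om : set (R * R)) w : H01 Om w -> vanish_off Om w.
Proof. by case. Qed.

(** Cauchy-Schwarz and the Poincare inequality, with [32 <= 6^2]. *)
Lemma mean_form_dual : H01_dual (disk 1) mean_form.
Proof.
have [Li n1] := half_disk_ind_L2.
split=> [a u v /H01_approx[Lu _] /H01_approx[Lv _]|].
  by rewrite /mean_form (ipDl (L2Z a Lu) Lv Li) (ipZl a Lu Li).
exists 6 => u Hu; have [Lu _] := H01_approx Hu; have [wg ap] := approx_gradP Hu.
apply: (le_trans (ip_le_sqrt Lu Li)).
have P := poincare Lu wg ap (H01_vanish Hu).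
apply: (@le_trans _ _ (6 * energy_norm u)); last first.
  by rewrite ler_pM2l//; exact: energy_norm_le.
rewrite -[leRHS]mulr1; apply: ler_pM; rewrite ?sqrtr_ge0//; last first.
  by rewrite -[leRHS]sqrtr1; exact: ler_wsqrtr.
rewrite /energy_norm -[6](@ger0_norm R)// -sqrtr_sqr -sqrtrM ?sqr_ge0//.
apply: ler_wsqrtr; apply: (le_trans P); apply: ler_wpM2r; first exact: gradE_ge0.
by rewrite -natrX ler_nat.
Qed.

End MeanFunctional.

(** * Level sets of a D-weakly vanishing sequence *)

Section DWeakDecay.
Context {R : realType} (Om : set (R * R)) (u : nat -> R * R -> R).
Context (dom_Om : domain Om) (Om_sub : Om `<=` disk 2^-1).
Context (u_H01 : forall k, H01 Om (u k)) (u_Dweak : D_weakly_cvg0 Om u).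

(** Membership is part of weak convergence, here along a constant sequence of operators. *)
Lemma gop_H01 j zeta k : (0 < j)%N -> closure Om zeta ->
  H01 (disk 1) (gop j zeta (u k)).
Proof.
move=> j0 cz; have D1 : forall k : nat, gop_set Om (gop j zeta) by exists j, zeta.
by have [H _] := u_Dweak D1; exact: H.
Qed.

Lemma u_L2 k : L2 (u k).
Proof. by have [/LfunP2] := u_H01 k. Qed.

(** If [zeta] and [zeta + z] both lie in the half disk then [|z| < 1], so the cut-off at the unit
    disk changes nothing. *)
Lemma gop1E zeta k : Om zeta -> gop 1 zeta (u k) = (fun z => u k (zeta + z)).
Proof.
move=> Oz; apply/funext => z; rewrite /gop cpow1 powR1 mul1r.
case: ifPn => // /negP nz; apply/esym/(H01_vanish (u_H01 k)) => /Om_sub h.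
apply: nz; rewrite inE /disk /=.
have := enormD (zeta + z) (- zeta); rewrite addrAC subrr add0r enormN.
by move: h (Om_sub Oz); rewrite /disk /=; lra.
Qed.

(** Uniformity by selecting offenders: for each [k] take an operator whose mean exceeds [eta] if
    there is one, and any operator otherwise. D-weak convergence along this single sequence excludes
    offenders for large [k]. *)
Lemma mean_small (eta : R) : 0 < eta -> exists K : nat, forall k, (K <= k)%N ->
  forall j zeta, (0 < j)%N -> closure Om zeta ->
    `|mean_form (gop j zeta (u k))| <= eta.
Proof.
move=> eta0; have [[z0 Oz0] _ _] := dom_Om.
have H k : exists g, gop_set Om g /\
    ((exists j zeta, [/\ (0 < j)%N, closure Om zeta &
       eta < `|mean_form (gop j zeta (u k))|]) -> eta < `|mean_form (g (u k))|).
  have [[j [zeta [j0 cz bad]]]|nb] := pselect (exists j zeta, [/\ (0 < j)%N,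
      closure Om zeta & eta < `|mean_form (gop j zeta (u k))|]).
    by exists (gop j zeta); split => //; exists j, zeta.
  exists (gop 1 z0); split => //; exists 1%N, z0; split => //.
  exact: subset_closure.
have [g Hg] := choice H.
have [_ wc] := u_Dweak (fun k => (Hg k).1).
have /cvgrPdist_lt/(_ _ eta0)[K _ HK] := wc _ mean_form_dual.
exists K => k Kk j zeta j0 cz; rewrite leNgt; apply/negP => bad.
have : eta < `|mean_form (g k (u k))| by apply: (Hg k).2; exists j, zeta.
by have := HK k Kk; rewrite /= sub0r normrN => /lt_trans h /h; rewrite ltxx.
Qed.

(** Weak convergence controls the translates to a point of [Om]; measures of level sets and norms of
    increments are translation invariant, so this suffices for [u k] itself. *)
Lemma translated_bound : exists (z0 : R * R) (M : R), 0 <= M /\ forall k, exists v,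
  [/\ L2 (fun z => u k (z0 + z)), weak_gradient (fun z => u k (z0 + z)) v,
    approximable (fun z => u k (z0 + z)) v, vanish_off (disk 1) (fun z => u k (z0 + z))
    & gradE v <= M].
Proof.
have [[z0 Oz0] _ _] := dom_Om; exists z0.
have cz : closure Om z0 by exact: subset_closure.
have D1 : forall k : nat, gop_set Om (gop 1 z0) by move=> _; exists 1%N, z0.
have [M HM] := weakly_cvg0_bounded (u_Dweak D1).
exists (M ^+ 2); split; first exact: sqr_ge0.
move=> k; have Hk := gop_H01 k (ltn0Sn 0) cz; have Mk := HM k.
rewrite gop1E// in Hk Mk; have [Lw _] := H01_approx Hk; have [wg ap] := approx_gradP Hk.
exists (approx_grad (fun z => u k (z0 + z))); split => //.
  exact: (H01_vanish Hk).
rewrite -[leLHS]sqr_sqrtr ?gradE_ge0// lerXn2r ?nnegrE ?sqrtr_ge0//.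
exact: le_trans (sqrtr_ge0 _) Mk.
Qed.

Lemma level_shift (f : plane R -> R) (z0 : plane R) (s : R) : measurable_fun setT f ->
  leb2 [set z : plane R | s < `|f (shift_plane z0 z)|] = leb2 [set z : plane R | s < `|f z|].
Proof. by move=> mf; rewrite -(leb2_shift z0 (measurable_level s mf)). Qed.

Lemma level_le1 k (s : R) : 0 < s ->
  (leb2 [set z : plane R | (s < `|u k z|)%R] <= 1%:E)%E.
Proof.
move=> s0; have [mu _] := u_L2 k.
apply: (@le_trans _ _ (leb2 (cbox 2^-1 : set (plane R)))).
  apply: le_measure; rewrite ?inE; [exact: measurable_level|exact: measurable_cbox|].
  move=> z /= sz; apply: disk_cbox; apply: Om_sub; apply: contrapT => nO.
  have uz : u k z = 0 by exact: (H01_vanish (u_H01 k) nO).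
  have : s < `|0 : R| by rewrite -uz; exact: sz.
  by rewrite normr0 ltNge (ltW s0).
by rewrite leb2_cbox ?invr_ge0// divff// expr1n.
Qed.

(** A point [x] of the level set lies in [Om], hence is itself an admissible centre. The mean of
    [u k] along [x + z^j] is small while [|u k x| > s], so the increments are large on average and
    [spread] applies with increments bounded through [|z^j| <= 2^-j]. *)
Lemma level_decay (M : R) k (eta s : R) j : (0 < j)%N -> 0 < s ->
  (forall (a : plane R) (r : R), `|a.1| <= r -> `|a.2| <= r ->
    (sqint (fun z => u k (shift_plane a z) - u k z)%R <= (8 * r ^+ 2 * M)%:E)%E) ->
  (forall zeta, closure Om zeta -> `|mean_form (gop j zeta (u k))| <= eta) ->
  eta * Num.sqrt j%:R <= s / 8 ->
  ((s ^+ 2)%:E * leb2 [set z : plane R | (s < `|u k z|)%R] <= (32 * 4^-1 ^+ j * M)%:E)%E.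
Proof.
move=> j0 s0 incr mean etas; have [mu _] := u_L2 k.
have [a [aE a4 a1]] := leb2_half_disk (R := R).
have a0 : 0 < a by rewrite (lt_le_trans _ a4)// invr_gt0.
have mD := measurable_disk (2^-1 : R).
have mF := measurable_level s mu.
have [Lind _] := half_disk_ind_L2 (R := R).
have tb z : disk 2^-1 z -> (sqint (fun x => u k (shift_plane (cpow z j) x) - u k x)%R <=
    (8 * (2^-1 ^+ j) ^+ 2 * M)%:E)%E.
  move=> /= zd; have [h1 h2] := abs_le_enorm (cpow z j).
  have le : enorm (cpow z j) <= 2^-1 ^+ j.
    by rewrite enorm_cpow lerXn2r ?nnegrE ?sqrtr_ge0 ?invr_ge0// ltW.
  by apply: incr; [exact: le_trans h1 le|exact: le_trans h2 le].
have s20 : 0 < s / 2 by rewrite divr_gt0.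
have osc x : [set z : plane R | s < `|u k z|] x -> ((s / 2 * a)%:E <=
    \int[leb2]_(z in (disk 2^-1 : set (plane R)))
      (`|u k (shift_plane (cpow z j) x) - u k x|)%:E)%E.
  move=> /= sx.
  have Ox : Om x.
    apply: contrapT => nO; have ux : u k x = 0 by exact: (H01_vanish (u_H01 k) nO).
    by move: sx; rewrite ux normr0 ltNge (ltW s0).
  have cx : closure Om x by exact: subset_closure.
  have [Lg _] := H01_approx (gop_H01 k j0 cx).
  pose c : R := j%:R `^ (- 2^-1).
  have c0 : 0 < c by rewrite powR_gt0// ltr0n.
  have cs : c * Num.sqrt j%:R = 1.
    rewrite /c -powR12_sqrt ?ler0n// -powRD; first by rewrite addNr powRr0.
    by rewrite addNr eqxx pnatr_eq0 -lt0n j0.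
  pose f (z : plane R) := u k (shift_plane (cpow z j) x).
  have gf z : gop j x (u k) z * half_disk_ind z = c * (f z * half_disk_ind z).
    rewrite /half_disk_ind indicE.
    have [/set_mem zd|_] := boolP (_ \in _); last by rewrite !mulr0.
    rewrite !mulr1 /gop mem_set; last first.
      by rewrite /disk /=; apply: (lt_trans zd); rewrite invf_lt1// ltr1n.
    by congr (_ * u k _); rewrite addrC.
  have ig := L2_integrable Lg Lind.
  have fi : leb2.-integrable setT (EFin \o (fun z => f z * half_disk_ind z)).
    have := integrableZl measurableT c^-1 ig.
    apply: eq_integrable => // z _ /=.
    by rewrite gf -EFinM (mulrA c^-1 c) mulVf ?gt_eqF// mul1r.
  have ux1 : leb2.-integrable setT (EFin \o (fun z => u k x * half_disk_ind z)).
    have := integrableZl measurableT (u k x) (L2_integrable Lind Lind).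
    apply: eq_integrable => // z _ /=; rewrite -EFinM; congr (_ * _)%:E.
    by rewrite /half_disk_ind indicE; case: (_ \in _); rewrite ?mulr1 ?mulr0.
  set I := (\int[leb2]_z (f z * half_disk_ind z))%R.
  have Ic : mean_form (gop j x (u k)) = c * I.
    rewrite /mean_form /ip /I -RintegralZl//.
    by apply: eq_Rintegral => z _; exact: gf.
  (* Undoing the factor [j^(-1/2)] leaves [|I| <= eta * sqrt j <= s / 8], and the half disk has area
     [a >= 1/4]. *)
  have Ismall : `|I| <= s / 2 * a.
    have := mean _ cx; rewrite Ic normrM (gtr0_norm c0) => cI.
    have sj : 0 <= Num.sqrt j%:R :> R by exact: sqrtr_ge0.
    have : `|I| <= eta * Num.sqrt j%:R.
      by have := ler_wpM2r sj cI; rewrite mulrAC cs mul1r.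
    by nra.
  have Ux : (\int[leb2]_z (u k x * half_disk_ind z))%R = u k x * a.
    rewrite /Rintegral; under eq_integral do rewrite EFinM.
    rewrite integralZl//; last first.
      apply/integrableP; split; first by apply/measurable_EFinP; case: Lind.
      under eq_integral => z _.
        rewrite /= ger0_norm ?indicE//; over.
      by rewrite integral_indic// setIT aE ltry.
    by rewrite integral_indic// setIT aE -EFinM.
  pose h z := (f z * half_disk_ind z) - (u k x * half_disk_ind z).
  have hi : leb2.-integrable setT (EFin \o h).
    by have := integrableB measurableT fi ux1; apply: eq_integrable.
  have hE : (\int[leb2]_z h z)%R = I - u k x * a.
    by rewrite /h RintegralB// Ux.
  have : (`|I - u k x * a|%:E <= \int[leb2]_z (`|h z|)%:E)%E.
    rewrite -hE EFin_normr_Rintegral//.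
    by have /integrableP[mh _] := hi; exact: (le_abse_integral leb2 measurableT mh).
  rewrite [X in (_ <= X)%E -> _](_ : _ = \int[leb2]_(z in (disk 2^-1 : set (plane R)))
      (`|u k (shift_plane (cpow z j) x) - u k x|)%:E)%E; last first.
    rewrite [RHS]integral_mkcond; apply: eq_integral => z _.
    rewrite patchE /h /half_disk_ind indicE; case: ifPn => _; rewrite ?mulr1//.
    by rewrite !mulr0 subrr normr0.
  apply: le_trans; rewrite lee_fin.
  have := ler_distD I (u k x * a) 0; rewrite !subr0 distrC normrM (gtr0_norm a0).
  by move: Ismall sx; nra.
have := spread mu mD mF (measurable_cpow j) aE a0 s20 tb osc.
have -> : 8 * (2^-1 ^+ j) ^+ 2 * M = 4^-1 * (32 * 4^-1 ^+ j * M).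
  have -> : (4^-1 : R) ^+ j = (2^-1 ^+ j) ^+ 2 by rewrite exprAC exprVn -natrX.
  by field.
have -> : (s / 2) ^+ 2 = 4^-1 * s ^+ 2 by field.
rewrite (EFinM 4^-1 (s ^+ 2)) (EFinM 4^-1 (32 * _ * M)) -muleA.
by rewrite lee_pmul2l// lte_fin invr_gt0.
Qed.

Lemma sup_decay (eps : R) : 0 < eps -> exists K : nat, forall k, (K <= k)%N ->
  forall t : R, 0 < t -> t < 1 ->
    (leb2 [set z : plane R | (eps * Num.sqrt (ln (expR 1 / t)) < `|u k z|)%R] <= t%:E)%E.
Proof.
move=> eps0; have [z0 [M [M0 HM]]] := translated_bound.
have incr k (a : plane R) (r : R) : `|a.1| <= r -> `|a.2| <= r ->
    (sqint (fun z => u k (shift_plane a z) - u k z)%R <= (8 * r ^+ 2 * M)%:E)%E.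
  move=> a1 a2; have [v [Lw wg ap _ vM]] := HM k; have [mu _] := u_L2 k.
  have mf : measurable_fun setT (fun z : plane R => u k (shift_plane a z) - u k z).
    by apply: measurable_funB => //; exact: (measurableT_comp mu (measurable_shift_plane a)).
  rewrite -(sqint_shift z0 mf).
  have -> : (fun z => u k (shift_plane a (shift_plane z0 z)) - u k (shift_plane z0 z)) =
     (fun z => u k (z0 + shift_plane a z) - u k (z0 + z)).
    by apply/funext => z; congr (u k _ - _); exact: (addrCA a z0 z).
  apply: (le_trans (increment_bound Lw wg ap a1 a2)).
  by rewrite lee_fin ler_wpM2l// mulr_ge0// sqr_ge0.
(* [4^N] absorbs the energy bound and [eps^-2]; one more unit in [n] will pay for [t]. *)
have [N HN] : exists N : nat, 32 * M / eps ^+ 2 <= 4 ^+ N.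
  exists (Num.truncn (32 * M / eps ^+ 2)).+1.
  rewrite (le_trans (ltW (truncnS_gt _)))// -natrX ler_nat.
  by apply: ltnW; exact: ltn_expl.
pose n := N.+1.
have sn0 : 0 < Num.sqrt n%:R :> R by rewrite sqrtr_gt0 ltr0n.
(* [eta] depends on [eps] and [n] only, so the index [K] is fixed before [t]; the growth of
   [j = n * m] with [t] is covered by the uniformity of [mean_small]. *)
have eta0 : 0 < eps / (8 * Num.sqrt n%:R) by rewrite divr_gt0// mulr_gt0.
have [K HK] := mean_small eta0.
exists K => k Kk t t0 t1; rewrite ln_expR1_div//.
set L := 1 - ln t.
have L1 : 1 <= L by have := ln_le0 (ltW t1); rewrite /L; lra.
pose m := Num.truncn L.
have m1 : (1 <= m)%N by rewrite truncn_gt0.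
have mL : m%:R <= L by rewrite truncn_le; lra.
have Lm : L < m.+1%:R by exact: truncnS_gt.
have sL : 0 < Num.sqrt L by rewrite sqrtr_gt0; lra.
have s0 : 0 < eps * Num.sqrt L by rewrite mulr_gt0.
have j0 : (0 < n * m)%N by rewrite muln_gt0.
have etas : eps / (8 * Num.sqrt n%:R) * Num.sqrt (n * m)%:R <= eps * Num.sqrt L / 8.
  rewrite natrM sqrtrM ?ler0n//.
  have -> : eps / (8 * Num.sqrt n%:R) * (Num.sqrt n%:R * Num.sqrt m%:R) =
     eps * Num.sqrt m%:R / 8 by field; rewrite gt_eqF.
  by rewrite ler_pM2r ?invr_gt0// ler_pM2l//; exact: ler_wsqrtr.
have D := level_decay j0 s0 (incr k) (fun zeta => HK k Kk _ zeta j0) etas.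
(* [t = exp(1 - L)] and [L < m + 1], so [t >= exp(- m) >= 4^-m]. *)
have tm : 4^-1 ^+ m <= t.
  have tE : t = expR (1 - L) by rewrite /L opprB addrC subrK lnK.
  rewrite tE; apply: (@le_trans _ _ (expR (- m%:R))); last first.
    by rewrite ler_expR; move: Lm; rewrite -natr1; lra.
  rewrite expRN -[m%:R]mulr1 expRM_natl -exprVn lerXn2r ?nnegrE ?invr_ge0 ?expR_ge0//.
  by rewrite lef_pV2 ?posrE ?expR_gt0// expR1_le4.
have key : 32 * 4^-1 ^+ (n * m) * M <= (eps * Num.sqrt L) ^+ 2 * t.
  have -> : (eps * Num.sqrt L) ^+ 2 = eps ^+ 2 * L.
    by rewrite exprMn sqr_sqrtr// (le_trans ler01).
  have e20 : 0 < eps ^+ 2 by rewrite exprn_gt0.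
  have h1 : 32 * M <= 4 ^+ N * eps ^+ 2 by rewrite -ler_pdivrMr.
  (* [n * m = N * m + m >= N + m], since [m >= 1]. *)
  have h2 : 4 ^+ N * 4^-1 ^+ (n * m) <= 4^-1 ^+ m :> R.
    rewrite /n mulSn exprD mulrCA ler_piMr ?exprn_ge0 ?invr_ge0//.
    apply: (@le_trans _ _ (4 ^+ N * 4^-1 ^+ N)).
      rewrite ler_wpM2l ?exprn_ge0// ler_wiXn2l ?invr_ge0 ?invf_le1 ?ler1n//.
      by rewrite leq_pmulr.
    by rewrite -exprMn divff// expr1n.
  have q0 : 0 <= (4^-1 : R) ^+ (n * m) by rewrite exprn_ge0// invr_ge0.
  move: h1 h2 tm q0; move: (4 ^+ N : R) ((4^-1 : R) ^+ (n * m)) ((4^-1 : R) ^+ m) => A B C.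
  move: (eps ^+ 2) e20 => E E0 h1 h2 h3 h4.
  have : 32 * M * B <= A * E * B by rewrite ler_wpM2r.
  have : E * (A * B) <= E * t by rewrite ler_pM2l// (le_trans h2).
  have : 0 <= E * t * (L - 1) by rewrite mulr_ge0 ?subr_ge0// mulr_ge0 ?ltW.
  by lra.
move: D; case: (leb2 _) => [b| |]//.
- rewrite -EFinM !lee_fin => D.
  have : (eps * Num.sqrt L) ^+ 2 * b <= (eps * Num.sqrt L) ^+ 2 * t.
    exact: le_trans D key.
  by rewrite ler_pM2l// exprn_gt0.
- by rewrite gt0_muley ?lte_fin ?exprn_gt0.
- by rewrite leNye.
Qed.

End DWeakDecay.

(** * Lorentz-Zygmund norms *)

Section LogIntegral.
Context {R : realType}.

(** The derivative of [1 / (1 - ln t)]. *)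
Let g (t : R) : R := (1 - ln t) ^- 2 / t.

Lemma one_sub_ln_ge1 (t : R) : 0 < t -> t <= 1 -> 1 <= 1 - ln t.
Proof. by move=> t0 t1; have := ln_le0 t1; lra. Qed.

Lemma inv_log_sqr_ge0 (t : R) : 0 < t -> 0 <= g t.
Proof. by move=> t0; rewrite mulr_ge0// ?invr_ge0 ?sqr_ge0// ltW. Qed.

Lemma inv_log_gt0 (t : R) : 0 < t -> t < expR 1 -> 0 < 1 - ln t.
Proof.
move=> t0 te; rewrite subr_gt0 -[ltRHS]expRK ltr_ln ?posrE//; exact: expR_gt0.
Qed.

Lemma continuous_inv_log_sqr (t : R) : 0 < t -> t < expR 1 -> {for t, continuous g}.
Proof.
move=> t0 te; apply: cvgM; last by apply: cvgV => //; exact: lt0r_neq0.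
apply: cvgV; first by rewrite expf_neq0// gt_eqF// inv_log_gt0.
by apply: cvgM; (apply: cvgB; [exact: cvg_cst|exact: continuous_ln]).
Qed.

Lemma measurable_inv_log_sqr : measurable_fun (`]0, 1] : set (measurableTypeR R)) g.
Proof.
apply: (@measurable_funS _ _ _ _ `]0, expR 1[) => //.
  move=> t /=; rewrite !in_itv/= => /andP[-> t1] /=; apply: (le_lt_trans t1).
  by rewrite -expR0 ltr_expR.
apply: open_continuous_measurable_fun; first exact: interval_open.
by move=> t; rewrite inE/= in_itv/= => /andP[]; exact: continuous_inv_log_sqr.
Qed.

Lemma is_derive_inv_log (t : R) : 0 < t -> t <= 1 ->
  is_derive t 1 (fun x => (1 - ln x)^-1) (g t).
Proof.
move=> t0 t1; have L1 := one_sub_ln_ge1 t0 t1; have Ln0 : 1 - ln t != 0 by rewrite gt_eqF//; lra.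
have D1 : is_derive t 1 (fun x => 1 - ln x) (0 - t^-1).
  by apply: is_deriveB; exact: is_derive1_ln.
have := is_deriveV (f := fun x => 1 - ln x) Ln0 D1.
by move=> D; apply: (is_derive_eq D); rewrite /g /GRing.scale /= sub0r mulrN mulNr opprK.
Qed.

Lemma inv_log_integral_seg (a m : R) : 0 < a -> a < m -> m <= 1 ->
  (\int[mu R]_(t in `[a, m]) (g t)%:E = ((1 - ln m)^-1 - (1 - ln a)^-1)%:E)%E.
Proof.
move=> a0 am m1.
have D t : a <= t -> t <= m -> is_derive t 1 (fun x : R => (1 - ln x)^-1) (g t).
  by move=> at_ tm; apply: is_derive_inv_log; [exact: (lt_le_trans a0 at_)|exact: (le_trans tm m1)].
have Dd t : a <= t -> t <= m -> {for t, continuous (fun x : R => (1 - ln x)^-1)}.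
  move=> h1 h2; apply/differentiable_continuous/derivable1_diffP.
  by have [] := D _ h1 h2.
rewrite (continuous_FTC2 (F := fun x : R => (1 - ln x)^-1)) ?EFinB//.
- apply/subspace_continuousP => t /=; rewrite in_itv/= => /andP[h1 h2].
  apply: cvg_within_filter; apply: continuous_inv_log_sqr; first exact: (lt_le_trans a0 h1).
  by apply: (le_lt_trans (le_trans h2 m1)); rewrite -expR0 ltr_expR.
- split.
  + by move=> t; rewrite in_itv/= => /andP[/ltW h1 /ltW h2]; have [] := D _ h1 h2.
  + by apply: cvg_at_right_filter; apply: Dd; rewrite ?lexx// ltW.
  + by apply: cvg_at_left_filter; apply: Dd; rewrite ?lexx// ltW.
- move=> t; rewrite in_itv/= => /andP[/ltW h1 /ltW h2].
  by rewrite derive1E; have [_ ->] := D _ h1 h2.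
Qed.

Lemma inv_log_integral_le (m : R) : 0 < m -> m <= 1 ->
  (\int[mu R]_(t in `]0%R, m[) (g t)%:E <= ((1 - ln m)^-1)%:E)%E.
Proof.
move=> m0 m1.
(* Exhaustion away from the singularity at [0]; [n.+2] keeps the left end strictly below [m]. *)
pose F (n : nat) : set (measurableTypeR R) := `[m / n.+2%:R, m]%classic.
have F0 n t : F n t -> 0 < t.
  by rewrite /F /= in_itv/= => /andP[h _]; rewrite (lt_le_trans _ h)// divr_gt0.
have mg (D : set (measurableTypeR R)) : measurable D -> D `<=` `]0, 1] ->
    measurable_fun D (EFin \o g).
  move=> mD D1; apply/measurable_EFinP; apply: measurable_funS D1 _ => //.
  exact: measurable_inv_log_sqr.
have ndF : nondecreasing_seq F.
  move=> n p np; rewrite subsetEset => t; rewrite /F /= !in_itv/= => /andP[h ->].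
  rewrite andbT (le_trans _ h)// ler_pM2l// lef_pV2 ?posrE ?ltr0n// ler_nat.
  by rewrite !ltnS.
have mF n : measurable (F n) by exact: measurable_itv.
have f0 n t : F n t -> (0 <= (g t)%:E)%E by move=> /F0 t0; rewrite lee_fin inv_log_sqr_ge0.
have F1 n : F n `<=` `]0, 1].
  move=> t Fn; move: (Fn); rewrite /F /= !in_itv/= (F0 _ _ Fn) => /andP[_ tm].
  exact: (le_trans tm m1).
have := @ge0_nondecreasing_set_cvg_integral _ _ _ F (EFin \o g) (mu R) ndF mF
  (fun n => mg (F n) (mF n) (F1 n)) f0.
move=> cv; apply: (@le_trans _ _ (\int[mu R]_(t in \bigcup_n F n) (EFin \o g) t)%E).
  apply: ge0_subset_integral => //.
  - exact: bigcup_measurable.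
  - apply: mg; first exact: bigcup_measurable.
    by move=> t [n _]; exact: F1.
  - by move=> t [n _ Fn]; exact: f0 Fn.
  - move=> t /=; rewrite in_itv/= => /andP[t0 tm].
    exists (Num.truncn (m / t)) => //; rewrite /F /= in_itv/= (ltW tm) andbT.
    rewrite ler_pdivrMr ?ltr0n// mulrC -ler_pdivrMr//.
    by rewrite (le_trans (ltW (truncnS_gt _)))// ler_nat.
rewrite -(cvg_lim _ cv)//; apply: lime_le; first by apply/cvg_ex; eexists; exact: cv.
apply: nearW => n /=.
have n2 : (1 : R) < n.+2%:R by rewrite ltr1n.
have a0 : 0 < m / n.+2%:R by rewrite divr_gt0.
have am : m / n.+2%:R < m by rewrite ltr_pdivrMr ?ltr0n// ltr_pMr.
rewrite /F /= (inv_log_integral_seg a0 am m1) lee_fin lerBlDr lerDl invr_ge0.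
by have := one_sub_ln_ge1 a0 (le_trans (ltW am) m1); lra.
Qed.

End LogIntegral.

(** * Dyadic layers of a rearrangement *)

Section LayerCake.
(** [rho] stands for the rearrangement of a function and [m i] for the measure of its level set
    above [2^i]; [C] bounds the capacity sum. *)
Context {R : realType} (rho : R -> \bar R) (m : nat -> R) (C : R).
Context (rho_ge0 : forall t, (0 <= rho t)%E) (m01 : forall i, 0 <= m i <= 1).
Context (rho_m : forall i t, 0 < t -> m i <= t -> (rho t <= (2 ^+ i)%:E)%E).
Context (sum_m : forall N, \sum_(i < N) 4 ^+ i / ln (expR 1 / m i) <= C).

Lemma layer_term_ge0 i : 0 <= 4 ^+ i / ln (expR 1 / m i).
Proof.
rewrite mulr_ge0 ?exprn_ge0// invr_ge0.
have /andP[] := m01 i; rewrite le_eqVlt => /predU1P[<- _|mi0 mi1].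
  by rewrite invr0 mulr0 ln0.
by rewrite ln_expR1_div//; have := one_sub_ln_ge1 mi0 mi1; lra.
Qed.

Lemma layer_C_ge0 : 0 <= C.
Proof. by have := sum_m 0; rewrite big_ord0. Qed.

(** A single term of the sum is at most [C], and [1 - ln] decreases. In particular [t < m i] holds
    for finitely many [i] only. *)
Lemma layer_term_le i (t : R) : 0 < t -> t < m i -> 4 ^+ i <= C * (1 - ln t).
Proof.
move=> t0 tm; have m0 := lt_trans t0 tm; have /andP[_ m1] := m01 i.
have lm : 1 <= 1 - ln (m i) by exact: one_sub_ln_ge1.
have ltm : ln t <= ln (m i) by rewrite ler_ln ?posrE// ltW.
have := sum_m i.+1; rewrite big_ord_recr /= ln_expR1_div// => S.
have S0 : 0 <= \sum_(j < i) 4 ^+ j / ln (expR 1 / m j).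
  by apply: sumr_ge0 => j _; exact: layer_term_ge0.
have : 4 ^+ i / (1 - ln (m i)) <= C by apply: le_trans S; rewrite lerDr.
rewrite ler_pdivrMr; last lra.
move=> /le_trans; apply; rewrite ler_wpM2l ?layer_C_ge0//; lra.
Qed.

(** The index is the predecessor of the least [i] with [m i <= t]; if that least index is [0], the
    bound is [2^0]. *)
Lemma layer_cases (t : R) : 0 < t -> t <= 1 ->
  (rho t <= 1%:E)%E \/ exists2 i, t < m i & (rho t <= (2 ^+ i.+1)%:E)%E.
Proof.
move=> t0 t1.
have ex : exists i, m i <= t.
  exists (Num.truncn (C * (1 - ln t))).+1; rewrite leNgt; apply/negP => /(layer_term_le t0).
  rewrite leNgt => /negP; apply; apply: (lt_le_trans (truncnS_gt _)).
  by rewrite -natrX ler_nat ltnW// ltn_expl.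
case: (ex_minnP ex) => -[|i] mi min; [left|right; exists i].
- by have := rho_m t0 mi; rewrite expr0.
- by rewrite ltNge; apply/negP => /min; rewrite ltnn.
- exact: rho_m.
Qed.

(** Unlike the decay estimate, this holds at every index of the sequence, and so supplies finiteness
    of each norm. *)
Lemma layer_sup_bound (t : R) : 0 < t -> t <= 1 ->
  (rho t <= (Num.sqrt (1 + 4 * C) * Num.sqrt (ln (expR 1 / t)))%:E)%E.
Proof.
move=> t0 t1; have L1 := one_sub_ln_ge1 t0 t1; have C0 := layer_C_ge0.
rewrite ln_expR1_div// -sqrtrM; last lra.
have [/le_trans|[i tm /le_trans]] := layer_cases t0 t1; apply; rewrite lee_fin.
  rewrite -[leLHS]sqrtr1 ler_wsqrtr//.
  have : 0 <= C * (1 - ln t) by rewrite mulr_ge0// (le_trans ler01).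
  by lra.
have -> : (2 : R) ^+ i.+1 = Num.sqrt (4 ^+ i.+1).
  have -> : (4 : R) = 2 ^+ 2 by rewrite -natrX.
  by rewrite exprAC sqrtr_sqr ger0_norm// exprn_ge0.
rewrite ler_wsqrtr// exprS; have := layer_term_le t0 tm; lra.
Qed.

Lemma layer_sqr_le t (b : R) : 0 <= b -> (rho t <= b%:E)%E -> (rho t ^+ 2 <= (b ^+ 2)%:E)%E.
Proof.
move=> b0; have := rho_ge0 t; case: (rho t) => [x| |]//.
rewrite (lee_fin 0) (lee_fin x) => x0 xb; rewrite -EFin_expe lee_fin.
by rewrite lerXn2r.
Qed.

(** [rho^2] is at most [1] plus the sum of [4^(i+1)] over the [i] with [t < m i], and each layer
    integrates to at most [4 * 4^i / ln(e / m i)]. [rho] carries no measurability, so [c] stays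
    under the integral until this measurable majorant is in place. *)
Lemma layer_integral_bound (c : R) : 0 <= c ->
  (\int[mu R]_(t in `]0%R, 1%R[) (c%:E * (((1 - ln t) ^- 2 / t)%:E * rho t ^+ 2))
    <= (c * (1 + 4 * C))%:E)%E.
Proof.
move=> c0.
pose g (t : R) : R := (1 - ln t) ^- 2 / t.
pose f i (t : R) : R := 4 ^+ i.+1 * (g t * \1_(`]0, m i[ : set R) t).
have mg : measurable_fun (`]0, 1[%classic : set (measurableTypeR R)) g.
  apply: measurable_funS (@measurable_inv_log_sqr R) => //.
  by move=> t /=; rewrite !in_itv/= => /andP[-> /ltW].
have mf i : measurable_fun (`]0, 1[%classic : set (measurableTypeR R)) (f i).
  by apply: measurable_funM => //; apply: measurable_funM.
have g0 t : (`]0, 1[%classic : set R) t -> 0 <= g t.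
  by rewrite /= in_itv/= => /andP[t0 _]; exact: inv_log_sqr_ge0.
have f0 i t : (`]0, 1[%classic : set R) t -> 0 <= f i t.
  by move=> /g0 gt; apply: mulr_ge0; [exact: exprn_ge0|apply: mulr_ge0].
have int_f i : (\int[mu R]_(t in `]0%R, 1%R[) (f i t)%:E
    <= (4 * (4 ^+ i / ln (expR 1 / m i)))%:E)%E.
  under eq_integral do rewrite EFinM.
  rewrite ge0_integralZl_EFin ?exprn_ge0//; last 2 first.
  - by move=> t /g0 ?; rewrite lee_fin mulr_ge0.
  - by apply/measurable_EFinP; apply: measurable_funM.
  have -> : (4 * (4 ^+ i / ln (expR 1 / m i)))%:E =
      ((4 ^+ i.+1)%:E * (ln (expR 1 / m i))^-1%:E)%E.
    by rewrite -EFinM exprS mulrA.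
  rewrite lee_wpmul2l ?lee_fin ?exprn_ge0//.
  have /andP[m0 m1] := m01 i.
  have -> : (\int[mu R]_(t in `]0%R, 1%R[) (g t * \1_`]0, m i[ t)%:E =
      \int[mu R]_(t in `]0%R, m i[) (g t)%:E)%E.
    rewrite integral_mkcond [RHS]integral_mkcond; apply: eq_integral => t _.
    rewrite !patchE indicE !mem_setE !in_itv/=.
    have [t0|] := ltP 0 t; rewrite /= ?if_same//.
    have [tm|_] := ltP t (m i); last by rewrite mulr0 if_same.
    by rewrite (lt_le_trans tm m1) mulr1.
  move: m0; rewrite le_eqVlt => /predU1P[<-|m0].
    by rewrite set_itv_ge ?bnd_simp ?ltxx// integral_set0 invr0 mulr0 ln0// invr0.
  by rewrite ln_expR1_div//; exact: inv_log_integral_le.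
have int_g : (\int[mu R]_(t in `]0%R, 1%R[) (g t)%:E <= 1)%E.
  by have := inv_log_integral_le ltr01 (lexx (1 : R)); rewrite ln1 subr0 invr1.
have mEf i : measurable_fun (`]0, 1[%classic : set (measurableTypeR R)) (EFin \o f i).
  exact/measurable_EFinP.
have Ef0 i t : (`]0, 1[%classic : set R) t -> (0 <= (f i t)%:E)%E.
  by move=> ?; rewrite lee_fin f0.
have ms : measurable_fun (`]0, 1[%classic : set (measurableTypeR R))
    (fun t => \sum_(i <oo) (f i t)%:E)%E.
  apply: (@ge0_emeasurable_sum _ _ _ _ (fun k x => (f k x)%:E) xpredT) => [k x Dx _|k _].
    exact: (Ef0 k x Dx).
  exact: mEf.
apply: (@le_trans _ _ (\int[mu R]_(t in `]0%R, 1%R[)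
   (c%:E * ((g t)%:E + \sum_(i <oo) (f i t)%:E)))%E).
  apply: ge0_le_integral_nm => t t01; have := g0 _ t01 => gt0.
    by rewrite !mule_ge0// ?lee_fin// expe_ge0.
  rewrite lee_wpmul2l ?lee_fin//.
  have /= := t01; rewrite in_itv/= => /andP[t0 t1].
  have sum0 : (0 <= \sum_(i <oo) (f i t)%:E)%E.
    by apply: nneseries_ge0 => i _ _; exact: Ef0.
  have [r1|[i tm ri]] := layer_cases t0 (ltW t1).
    apply: (@le_trans _ _ (g t)%:E); last by rewrite leeDl.
    rewrite -[leRHS]mule1 lee_wpmul2l ?lee_fin//.
    by have := layer_sqr_le ler01 r1; rewrite expr1n.
  (* The layer of index [i] alone already dominates, since [rho t <= 2^(i+1)] and [t < m i]. *)
  apply: (@le_trans _ _ (f i t)%:E).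
    rewrite /f indicE mem_set ?mulr1; last by rewrite /= in_itv/= t0.
    rewrite (mulrC (4 ^+ _)) (EFinM (g t)) lee_wpmul2l ?lee_fin//.
    have -> : (4 : R) = 2 ^+ 2 by rewrite -natrX.
    by rewrite exprAC; apply: layer_sqr_le ri; exact: exprn_ge0.
  rewrite (@le_trans _ _ (\sum_(j <oo) (f j t)%:E)%E)// ?leeDr ?lee_fin//.
  have := @nneseries_lim_ge R (fun j => (f j t)%:E) xpredT 0 i.+1 (fun j _ _ => Ef0 j t t01).
  apply: le_trans; rewrite big_mkord big_ord_recr /= leeDr// sume_ge0// => j _.
  exact: Ef0.
have s0 t : (`]0, 1[%classic : set R) t -> (0 <= \sum_(i <oo) (f i t)%:E)%E.
  by move=> t01; apply: nneseries_ge0 => i _ _; exact: Ef0.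
rewrite ge0_integralZl_EFin//; last 2 first.
- by move=> t t01; rewrite adde_ge0 ?s0// lee_fin g0.
- by apply: emeasurable_funD => //; exact/measurable_EFinP.
rewrite (EFinM c (1 + 4 * C)) lee_wpmul2l ?lee_fin//.
rewrite ge0_integralD//; last exact/measurable_EFinP.
have -> : (1 + 4 * C)%:E = (1 + (4 * C)%:E)%E by [].
rewrite leeD// integral_nneseries//.
apply: lime_le; first by apply: is_cvg_nneseries => n _ _; apply: integral_ge0 => t; exact: Ef0.
apply: nearW => n; rewrite big_mkord.
apply: (@le_trans _ _ (\sum_(i < n) (4 * (4 ^+ i / ln (expR 1 / m i)))%:E)%E).
  by apply: lee_sum => i _; exact: int_f.
by rewrite sumEFin lee_fin -mulr_sumr ler_pM2l.
Qed.

End LayerCake.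

(** * Estimates of the quasinorms *)

Section LorentzZygmund.
Context {R : realType}.
Implicit Types (u : R * R -> R).

Lemma ereal_cvg0 (f : nat -> \bar R) : (forall k, 0 <= f k)%E ->
  (forall e : R, 0 < e -> exists K : nat, forall k, (K <= k)%N -> (f k <= e%:E)%E) ->
  f k @[k --> \oo] --> 0%E.
Proof.
move=> f0 H; apply/fine_cvgP; split.
  have [K HK] := H _ ltr01; exists K => // k /HK fk.
  by rewrite ge0_fin_numE// (le_lt_trans fk)// ltry.
apply/cvgrPdist_le => e /H[K HK]; exists K => // k /HK fk /=.
rewrite sub0r normrN; have := f0 k; move: fk; case: (f k) => [x| |]//.
by rewrite (lee_fin x) (lee_fin 0) => ? x0 /=; rewrite ger0_norm.
Qed.

Lemma rearrangement_ge0 u t : (0 <= rearrangement u t)%E.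
Proof. by apply: le_ereal_inf_tmp => _ [s [s0 _] <-]; rewrite lee_fin ltW. Qed.

Lemma rearrangement_le u (s t : R) : 0 < s ->
  (leb2 [set z : plane R | (s < `|u z|)%R] <= t%:E)%E -> (rearrangement u t <= s%:E)%E.
Proof. by move=> s0 us; apply: ereal_inf_lbound; exists s. Qed.

Lemma LZnorm_ge0 q (al : R) u : (0 <= LZnorm q al u)%E.
Proof.
case: q => [r| |]; first exact: poweR_ge0.
- apply: (@le_trans _ _ ((ln (expR 1 / 2^-1) `^ al)%:E * rearrangement u 2^-1)%E).
    by rewrite mule_ge0 ?rearrangement_ge0// lee_fin powR_ge0.
  apply: ereal_sup_ubound; exists 2^-1 => //=.
  by rewrite in_itv/= invr_gt0 invf_lt1// ltr1n ltr0n.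
- apply: (@le_trans _ _ ((ln (expR 1 / 2^-1) `^ al)%:E * rearrangement u 2^-1)%E).
    by rewrite mule_ge0 ?rearrangement_ge0// lee_fin powR_ge0.
  apply: ereal_sup_ubound; exists 2^-1 => //=.
  by rewrite in_itv/= invr_gt0 invf_lt1// ltr1n ltr0n.
Qed.

Lemma LZnorm_sup_le u (e : R) :
  (forall t, 0 < t -> t < 1 ->
    (rearrangement u t <= (e * Num.sqrt (ln (expR 1 / t)))%:E)%E) ->
  (LZnorm +oo (- 2^-1) u <= e%:E)%E.
Proof.
move=> H; apply: ge_ereal_sup => _ [t + <-]; rewrite /= in_itv/= => /andP[t0 t1].
have := H t t0 t1; rewrite ln_expR1_div//; have L1 := one_sub_ln_ge1 t0 (ltW t1).
have L0 : 0 < 1 - ln t by lra.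
have p0 : 0 < (1 - ln t) `^ (- 2^-1) by rewrite powR_gt0.
move=> h; apply: (@le_trans _ _ (((1 - ln t) `^ (- 2^-1))%:E * (e * Num.sqrt (1 - ln t))%:E)%E).
  by rewrite lee_wpmul2l// lee_fin ltW.
rewrite -EFinM lee_fin -powR12_sqrt ?(ltW L0)// mulrCA -powRD; first by rewrite addNr powRr0 mulr1.
by rewrite addNr eqxx gt_eqF.
Qed.

(** Split [x^r = x^(r-2) x^2] and spend the sup bound on the first factor; the exponents of [L] add
    up to [(-1/r - 1/2) r + (r - 2)/2 = -2]. *)
Lemma LZ_integrand_le (L x e r : R) : 1 <= L -> 2 < r -> 0 <= x -> 0 < e ->
  x <= e * Num.sqrt L ->
  (L `^ (- r^-1 - 2^-1) * x) `^ r <= e `^ (r - 2) * (L ^- 2 * x ^+ 2).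
Proof.
move=> L1 r2; rewrite le_eqVlt => /predU1P[<- e0 _|x0 e0 xe].
  rewrite mulr0 powR0; last by rewrite gt_eqF//; lra.
  by rewrite !mulr_ge0 ?powR_ge0 ?invr_ge0 ?exprn_ge0//; lra.
have L0 : 0 < L by lra.
have r0 : r != 0 by rewrite gt_eqF//; lra.
rewrite powRM ?powR_ge0 ?(ltW x0)// -powRrM.
have -> : x `^ r = x `^ (r - 2) * x ^+ 2.
  rewrite -powR_mulrn ?(ltW x0)// -powRD; first by rewrite subrK.
  by rewrite (gt_eqF x0) implybT.
have h : x `^ (r - 2) <= e `^ (r - 2) * L `^ (2^-1 * (r - 2)).
  rewrite powRrM -powRM ?powR_ge0 ?(ltW e0)// powR12_sqrt ?(ltW L0)//.
  apply: ge0_ler_powR => //; rewrite ?nnegrE ?(ltW x0)//; first lra.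
  by rewrite mulr_ge0 ?sqrtr_ge0// ltW.
have LE : L `^ ((- r^-1 - 2^-1) * r) * L `^ (2^-1 * (r - 2)) = L ^- 2.
  rewrite -powRD; last by rewrite (gt_eqF L0) implybT.
  by rewrite -powR_invn ?(ltW L0)//; congr (_ `^ _); field.
rewrite mulrA [leRHS]mulrA ler_wpM2r ?sqr_ge0// -LE [leRHS]mulrCA.
by rewrite ler_wpM2l// powR_ge0.
Qed.

Lemma LZnorm_le u (e C r : R) : 2 < r -> 0 < e -> 0 <= C ->
  (forall t, 0 < t -> t < 1 ->
    (rearrangement u t <= (e * Num.sqrt (ln (expR 1 / t)))%:E)%E) ->
  (\int[mu R]_(t in `]0%R, 1%R[) ((e `^ (r - 2))%:E *
     (((1 - ln t) ^- 2 / t)%:E * rearrangement u t ^+ 2)) <= (e `^ (r - 2) * C)%:E)%E ->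
  (LZnorm r%:E (- r^-1 - 2^-1) u <= ((e `^ (r - 2) * C) `^ r^-1)%:E)%E.
Proof.
move=> r2 e0 C0 H int_le; rewrite /LZnorm -poweR_EFin.
have r0 : 0 <= r^-1 by rewrite invr_ge0; lra.
have eC : 0 <= e `^ (r - 2) * C by rewrite mulr_ge0// powR_ge0.
have int0 : (0 <= \int[mu R]_(t in `]0%R, 1%R[)
   ((((ln (expR 1 / t) `^ (- r^-1 - 2^-1))%:E * rearrangement u t) `^ r) * (t^-1)%:E))%E.
  apply: integral_ge0 => t; rewrite /= in_itv/= => /andP[t0 t1].
  by rewrite mule_ge0 ?poweR_ge0// lee_fin invr_ge0 ltW.
apply: gt0_ler_poweR => //; rewrite ?in_itv/= ?int0 ?leey ?lee_fin ?eC//.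
apply: le_trans int_le; apply: ge0_le_integral_nm => t; rewrite /= in_itv/= => /andP[t0 t1].
  by rewrite mule_ge0 ?poweR_ge0// lee_fin invr_ge0 ltW.
have L1 := one_sub_ln_ge1 t0 (ltW t1); have := H t t0 t1.
have [x x0 ->] : exists2 x, 0 <= x & rearrangement u t = x%:E.
  have := H t t0 t1; have := rearrangement_ge0 u t.
  by case: (rearrangement u t) => [x| |]// x0 _; exists x.
rewrite ln_expR1_div// (lee_fin x) => xe.
rewrite -!EFinM lee_fin.
have := LZ_integrand_le L1 r2 x0 e0 xe => h.
have ti : 0 <= t^-1 by rewrite invr_ge0 ltW.
apply: (le_trans (ler_wpM2r ti h)).
by rewrite le_eqVlt; apply/orP; left; apply/eqP; ring.
Qed.

End LorentzZygmund.

(* fine q^-1 is 1/q, and 0 for q = +oo *)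
Theorem corollary2p7 (R : realType) (Om : set (R * R)) (u : nat -> R * R -> R)
  (dom_Om : domain Om) (Om_sub : Om `<=` disk 2^-1)
  (u_H01 : forall k : nat, H01 Om (u k))
  (u_Dweak : D_weakly_cvg0 Om u) :
  forall q : \bar R, (2%:E < q)%E ->
    LZ_cvg0 q (- fine (q^-1)%E - 2^-1) u.
Proof.
have [z0 [M [M0 HM]]] := translated_bound dom_Om Om_sub u_H01 u_Dweak.
pose C : R := 72 * 72 * (16 / 3) * (2 * M + 4).
have C0 : 0 <= C by rewrite /C; lra.
have mu k : measurable_fun setT (u k : plane R -> R) by have [] := u_L2 u_H01 k.
have mw k : measurable_fun setT ((fun z => u k (z0 + z)) : plane R -> R).
  by have [v [[]]] := HM k.
have lvl k (s : R) : leb2 [set z : plane R | (s < `|u k (z0 + z)|)%R] =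
    leb2 [set z : plane R | (s < `|u k z|)%R].
  exact: level_shift (mu k).
have lvl1 k : (leb2 [set z : plane R | (1 < `|u k (z0 + z)|)%R] <= 1%:E)%E.
  by rewrite lvl; exact: (level_le1 Om_sub u_H01 k ltr01).
pose m k i := level_measure (fun z => u k (z0 + z)) (2 ^+ i).
have lvlm k i : leb2 [set z : plane R | (2 ^+ i < `|u k z|)%R] = (m k i)%:E /\ 0 <= m k i <= 1.
  have h1 : 1 <= (2 : R) ^+ i by rewrite exprn_ege1// ler1n.
  by have := level_measureE h1 (mw k) (lvl1 k); rewrite lvl.
have m01 k i : 0 <= m k i <= 1 by have [] := lvlm k i.
have rm k i t : 0 < t -> m k i <= t -> (rearrangement (u k) t <= (2 ^+ i)%:E)%E.
  move=> t0 mt; apply: rearrangement_le; first exact: exprn_gt0.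
  by have [-> _] := lvlm k i; rewrite lee_fin.
have sm k N : \sum_(i < N) 4 ^+ i / ln (expR 1 / m k i) <= C.
  have [v [Lw wg ap vo vM]] := HM k.
  apply: (le_trans (level_sum N Lw wg ap vo (lvl1 k))).
  by rewrite /C ler_wpM2l; lra.
have r0 k t : (0 <= rearrangement (u k) t)%E by exact: rearrangement_ge0.
pose K : R := Num.sqrt (1 + 4 * C).
have K0 : 0 < K by rewrite sqrtr_gt0; lra.
have supK k t : 0 < t -> t < 1 ->
    (rearrangement (u k) t <= (K * Num.sqrt (ln (expR 1 / t)))%:E)%E.
  by move=> t0 t1; exact: (layer_sup_bound (m01 k) (rm k) (sm k) t0 (ltW t1)).
have supe (e : R) : 0 < e -> exists N : nat, forall k, (N <= k)%N -> forall t, 0 < t -> t < 1 ->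
    (rearrangement (u k) t <= (e * Num.sqrt (ln (expR 1 / t)))%:E)%E.
  move=> e0; have [N HN] := sup_decay dom_Om Om_sub u_H01 u_Dweak e0.
  exists N => k Nk t t0 t1; apply: rearrangement_le; last exact: HN.
  rewrite mulr_gt0// sqrtr_gt0 ln_expR1_div//.
  by have := one_sub_ln_ge1 t0 (ltW t1); lra.
case=> [r| |] q2 //.
- rewrite fine_invr; have r2 : 2 < r by move: q2; rewrite lte_fin.
  have LZle k (e : R) : 0 < e ->
      (forall t, 0 < t -> t < 1 ->
        (rearrangement (u k) t <= (e * Num.sqrt (ln (expR 1 / t)))%:E)%E) ->
      (LZnorm r%:E (- r^-1 - 2^-1) (u k) <= ((e `^ (r - 2) * (1 + 4 * C)) `^ r^-1)%:E)%E.
    move=> e0 H; apply: LZnorm_le => //; first lra.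
    exact: (layer_integral_bound (r0 k) (m01 k) (rm k) (sm k) (powR_ge0 _ _)).
  (* Finiteness uses the bound [supK], available for every [k]; convergence uses [supe], available
     from some index on. *)
  split=> [k|].
    by apply: (le_lt_trans (LZle k K K0 (supK k))); rewrite ltry.
  apply: ereal_cvg0 => [k|e e0]; first exact: LZnorm_ge0.
  have D0 : 0 < 1 + 4 * C by lra.
  have b0 : 0 < e `^ r / (1 + 4 * C) by rewrite divr_gt0// powR_gt0.
  (* Solves [(d^(r-2) (1 + 4 C))^(1/r) = e], which is possible because [r > 2]. *)
  pose d := (e `^ r / (1 + 4 * C)) `^ (r - 2)^-1.
  have [N HN] := supe d (powR_gt0 _ b0).
  exists N => k Nk; apply: (le_trans (LZle k d (powR_gt0 _ b0) (HN k Nk))).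
  have rr : r - 2 != 0 by rewrite gt_eqF//; lra.
  have rn : r != 0 by rewrite gt_eqF//; lra.
  rewrite /d -powRrM mulVf// powRr1 ?(ltW b0)// divfK ?gt_eqF//.
  by rewrite -powRrM mulfV// powRr1// ltW.
- rewrite invey /= oppr0 sub0r; split=> [k|].
    by apply: (le_lt_trans (LZnorm_sup_le (supK k))); rewrite ltry.
  apply: ereal_cvg0 => [k|e e0]; first exact: LZnorm_ge0.
  have [N HN] := supe e e0; exists N => k Nk; exact: LZnorm_sup_le (HN k Nk).
Qed.
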